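(* Let $V$ be a finite-dimensional real vector space equipped with a non-degenerate inner product $(\cdot,\cdot)$ of signature $(p,q)$ with $p<q$. Let $R$ be a spacelike Jordan Osserman algebraic curvature tensor on $V$. Then for every $x\in S^+(V)$ the Jacobi operator $\mathcal{J}_R(x)$ is diagonalizable (as a real linear map of $V$; in particular all of its eigenvalues are real).
   Context: Signature $(p,q)$ means that a maximal timelike subspace (on which $(\cdot,\cdot)$ is negative definite) has dimension $p$ and a maximal spacelike subspace (on which it is positive definite) has dimension $q$. An algebraic curvature tensor is $R\in\otimes^4V^*$ satisfying $R(x,y,z,w)=R(z,w,x,y)=-R(y,x,z,w)$ and $R(x,y,z,w)+R(y,z,x,w)+R(z,x,y,w)=0$. The Jacobi operator $\mathcal{J}_R(x)$ is the self-adjoint linear map of $V$ defined by $(\mathcal{J}_R(x)y,z)=R(y,x,x,z)$ for all $y,z\in V$. $S^+(V)=\{x\in V:(x,x)=1\}$ is the pseudo-sphere of unit spacelike vectors. $R$ is called spacelike Jordan Osserman if the Jordan normal form of $\mathcal{J}_R(x)$ is the same for all $x\in S^+(V)$. *)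

(* Defs.v *)
From mathcomp Require Import all_boot all_order all_algebra.
From mathcomp Require Import mxred.
From mathcomp Require Import reals.
Set Implicit Arguments. Unset Strict Implicit. Unset Printing Implicit Defensive.
Import Order.TTheory GRing.Theory Num.Theory.
Local Open Scope ring_scope.

(* The vector space V is modelled as row vectors 'rV[R]_n (any n-dimensional
   real vector space is isomorphic to it).  Linear maps act on the right:
   y |-> y *m A. *)

Section Defs.
Variables (R : realType) (n : nat).

Definition form (G : 'M[R]_n) (u v : 'rV[R]_n) : R := (u *m G *m v^T) 0 0.

Definition inner_product (G : 'M[R]_n) : Prop := G^T = G /\ G \in unitmx.

Definition timelike_subspace m (G : 'M[R]_n) (U : 'M[R]_(m, n)) : Prop :=
  forall u : 'rV[R]_n, (u <= U)%MS -> u != 0 -> form G u u < 0.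
Definition spacelike_subspace m (G : 'M[R]_n) (U : 'M[R]_(m, n)) : Prop :=
  forall u : 'rV[R]_n, (u <= U)%MS -> u != 0 -> 0 < form G u u.

Definition has_signature (G : 'M[R]_n) (p q : nat) : Prop :=
  (exists U : 'M[R]_n, timelike_subspace G U /\ \rank U = p) /\
  (forall U : 'M[R]_n, timelike_subspace G U -> (\rank U <= p)%N) /\
  (exists U : 'M[R]_n, spacelike_subspace G U /\ \rank U = q) /\
  (forall U : 'M[R]_n, spacelike_subspace G U -> (\rank U <= q)%N).

Definition tensor4 := 'I_n -> 'I_n -> 'I_n -> 'I_n -> R.

Definition teval (T : tensor4) (x y z w : 'rV[R]_n) : R :=
  \sum_(i < n) \sum_(j < n) \sum_(k < n) \sum_(l < n)
    T i j k l * x 0 i * y 0 j * z 0 k * w 0 l.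

Definition algebraic_curvature_tensor (T : tensor4) : Prop :=
  (forall x y z w, teval T x y z w = teval T z w x y) /\
  (forall x y z w, teval T x y z w = - teval T y x z w) /\
  (forall x y z w,
     teval T x y z w + teval T y z x w + teval T z x y w = 0).

(* Jacobi operator: the linear map J_R(x) with (J_R(x) y, z) = R(y,x,x,z);
   as a matrix acting on row vectors, J = M G^{-1} with M_{jk} = R(e_j,x,x,e_k). *)
Definition jacobi (G : 'M[R]_n) (T : tensor4) (x : 'rV[R]_n) : 'M[R]_n :=
  (\matrix_(i < n, j < n) teval T (delta_mx 0 i) x x (delta_mx 0 j)) *m invmx G.

Definition unit_spacelike (G : 'M[R]_n) (x : 'rV[R]_n) : Prop := form G x x = 1.

(* spacelike Jordan Osserman: J_R(x) has the same Jordan normal form for all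
   x in S^+(V), i.e. all these operators are similar to each other *)
Definition spacelike_jordan_osserman (G : 'M[R]_n) (T : tensor4) : Prop :=
  forall x y, unit_spacelike G x -> unit_spacelike G y ->
    similar_in unitmx (jacobi G T x) (jacobi G T y).

End Defs.

(* Main.v *)
Require Import Defs.
From mathcomp Require Import all_boot all_order all_algebra.
From mathcomp Require Import mxred.
From mathcomp Require Import reals.
From mathcomp Require Import boolp classical_sets topology normedtype.
From mathcomp Require Import complex lra ring zify.
(* [form] is also the name of a structure of sesquilinear.v *)
Import Defs.
Set Implicit Arguments. Unset Strict Implicit. Unset Printing Implicit Defensive.
Import Order.TTheory GRing.Theory Num.Theory numFieldNormedType.Exports.
Local Open Scope ring_scope.

(* Suppose that some Jacobi operator is not diagonalizable.  The operators J(x)/(x,x), for [x]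
   spacelike, are all similar, so one real polynomial turns them into a continuous even family
   of self-adjoint maps Q(x) <> 0 of constant rank with Q(x) x = 0 and Q(x)^2 = 0 or
   Q(x)^3 = -Q(x).  Split V = W + T with W maximal spacelike and T its orthogonal complement, so
   that t = dim T <= p < q = dim W.  For x in W \ 0 the form -|Q z|^2, respectively -(Q^2 z, z),
   on T has constant negative index r >= 1; let S_x be a small nondegenerate perturbation of it.
   On the cone bundle X = {(x, z, mu) : x in the sphere of W, (z, mu) <> 0, S_x(z, z) <= mu^2} act
   sigma : (x, z, mu) -> (-x, z, -mu) and tau : (x, z, mu) -> (x, -z, -mu).  The fibres retract to
   r-spheres, so the equivariant mod 2 cohomology of X has the basis h^a e^b, a < q, b <= r, in
   the degree one classes h and e of the two involutions.  The W-component of Q(x) z + mu x never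
   vanishes on X, which gives e^q = 0, and neither does (z, mu), which gives e^t (e + h) = 0.
   Since t < q, freeness forces e^t = 0; along the section x -> (x, 0, 1) this contradicts the
   Borsuk-Ulam theorem.  The cohomology is that of Alexander and Spanier, computed with mod 2
   cochains on tuples of small diameter. *)

(** * Mod 2 cochains *)

(** If no [h] gave either equation for [Q], the minimal polynomial would be a product of distinct
    real linear factors: a repeated factor yields the first equation, a nonreal root the second.
    When [Q^2 = 0] the form [(Q z, Q z)] vanishes identically, hence the Euclidean norm of [Q z] in
    that case. The cone bundle comes without a trivialization. Its cohomology is found by a
    Mayer-Vietoris induction over thickened hemispheres of the base, which asks only that small base
    motions lift equivariantly. A short step down the gradient of the form is such a lift; for this
    the form is made nondegenerate. The sign of the perturbation also keeps the [W]-component away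
    from 0. Relations between classes come from functions: a degree one class depends only on the
    character of a sign function, continuous or not, so functions with given characters and no
    common zero make the product of the corresponding classes vanish. The bound [r >= 1] enters at
    the end: freeness first gives that [e^t] is a multiple of [h^t], and a nonzero one would
    identify [h^t e] with [h^(t+1)]. *)

Ltac bsolve := by repeat case.

Section Cochains.
Variable M : Type.
Implicit Types (c b : seq M -> bool) (s l : seq M) (f g : M -> M) (e : M -> bool).

(** Membership as a proposition, since the points of [M] have no decidable equality. *)
Fixpoint inl (x : M) s : Prop := if s is y :: s' then y = x \/ inl x s' else False.

Definition cadd c b : seq M -> bool := fun s => c s (+) b s.

(* [del c [:: x0; ...; xn]] is the sum of the values of [c] on the faces of the tuple. *)
Fixpoint del c s : bool :=
  if s is x :: s' then c s' (+) del (fun l => c (x :: l)) s' else false.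

Lemma del_ext c b s :
  (forall l, (forall x, inl x l -> inl x s) -> (size l).+1 = size s -> c l = b l) ->
  del c s = del b s.
Proof.
elim: s c b => //= x s IH c b H; rewrite H //; last by move=> y; right.
congr (_ (+) _); apply: IH => l Hl Hs; apply: H => /=; last by rewrite Hs.
by move=> y [->|/Hl]; [left|right].
Qed.

Lemma del_add c b s : del (cadd c b) s = del c s (+) del b s.
Proof.
elim: s c b => //= x s IH c b.
rewrite (IH (fun l => c (x :: l)) (fun l => b (x :: l))) /cadd.
move: (c s) (b s) (del _ s) (del _ s); bsolve.
Qed.

Lemma del_scale (k : bool) c s : del (fun l => k && c l) s = k && del c s.
Proof. by elim: s c => /= [|x s IH] c; rewrite ?andbF // IH -andb_addr. Qed.

Lemma del_del c s : del (del c) s = false.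
Proof.
elim: s c => //= x s IH c.
have -> : del (fun l => del c (x :: l)) s
  = del (cadd c (del (fun l => c (x :: l)))) s by [].
by rewrite del_add IH addbF addbb.
Qed.

Definition hmul e c : seq M -> bool :=
  fun s => if s is x :: _ then e x && c s else false.

(** Cup product with the coboundary of the 0-cochain [e]. Degree one classes occur only as such
    multiplications, and [e] may be discontinuous. *)
Definition hst e c : seq M -> bool :=
  fun s => if s is x :: s' then
    if s' is y :: _ then (e x (+) e y) && c s' else false else false.

(** The Leibniz rule. As [del] evaluates one-point tuples through the empty tuple, [c [::] = false]
    is what keeps the complex unaugmented. *)
Lemma del_hmul e c s : c [::] = false ->
  del (hmul e c) s = hst e c s (+) hmul e (del c) s.
Proof.
move=> c0; case: s => //= x s.
have -> : del (fun l => e x && c (x :: l)) s = e x && del (fun l => c (x :: l)) s.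
  exact: del_scale.
case: s => [|y s] /=; first by rewrite c0 /= !andbF.
move: (c (y :: s)) (c (x :: s)) (del _ s) (e x) (e y); bsolve.
Qed.

(** Up to [hmul e (del c)], [hst e c] is the coboundary of [hmul e c]; so [del_del] and the Leibniz
    rule suffice. *)
Lemma del_hst e c s : c [::] = false -> del (hst e c) s = hst e (del c) s.
Proof.
move=> c0.
have -> : del (hst e c) s = del (cadd (del (hmul e c)) (hmul e (del c))) s.
  apply: del_ext => l _ _; rewrite /cadd del_hmul // -addbA addbb addbF //.
rewrite del_add del_del addFb del_hmul //.
have -> : hmul e (del (del c)) s = false by case: s => // x s; rewrite /hmul del_del andbF.
by rewrite addbF.
Qed.

(** The cup-1 product of two 1-cochains is their product on an edge; here it is formed from the
    coboundaries of [e] and [e'] and followed by [c]. *)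
Definition hst2 e e' c : seq M -> bool :=
  fun s => if s is x :: s' then
    if s' is y :: _ then ((e x (+) e y) && (e' x (+) e' y)) && c s' else false else false.

(* Steenrod's cup-1 homotopy. *)
Lemma del_hst2 e e' c s : c [::] = false ->
  del (hst2 e e' c) s =
  hst e (hst e' c) s (+) hst e' (hst e c) s (+) hst2 e e' (del c) s.
Proof.
move=> c0; case: s => // x s.
have -> : del (hst2 e e' c) (x :: s) = hst2 e e' c s (+) del (fun l => hst2 e e' c (x :: l)) s by [].
have -> : del (fun l => hst2 e e' c (x :: l)) s =
  del (cadd (cadd (fun l => (e x && e' x) && c l) (fun l => e x && hmul e' c l))
        (cadd (fun l => e' x && hmul e c l) (hmul e (hmul e' c)))) s.
  apply: del_ext => -[|y l] _ _; rewrite /cadd /=; first by rewrite c0 !andbF.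
  move: (e x) (e y) (e' x) (e' y) (c _); bsolve.
rewrite !del_add !del_scale !del_hmul //.
case: s => [|y [|z s]]; first by rewrite /= !andbF.
  rewrite /= c0 /=; move: (e x) (e y) (e' x) (e' y); bsolve.
have -> : hmul e (del (hmul e' c)) (y :: z :: s)
   = hmul e (cadd (hst e' c) (hmul e' (del c))) (y :: z :: s).
  by rewrite {1}/hmul del_hmul.
rewrite /hst /hst2 /hmul /cadd.
move: (del c (y :: z :: s)) (c (z :: s)) (c (y :: z :: s)).
move: (e x) (e' x) (e y) (e' y) (e z) (e' z); bsolve.
Qed.

End Cochains.

Section Maps.
Variables (M N : Type) (f : M -> N).
Implicit Types (c : seq N -> bool) (s : seq M).

Lemma inl_map y s : inl y (map f s) -> exists2 x, inl x s & y = f x.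
Proof.
elim: s => //= x s IH [<-|/IH[z zs ->]]; first by exists x => //; left.
by exists z => //; right.
Qed.

Lemma map_inl x s : inl x s -> inl (f x) (map f s).
Proof. by elim: s => //= y s IH [->|/IH]; [left|right]. Qed.

Lemma del_map c s : del c (map f s) = del (fun l => c (map f l)) s.
Proof. by elim: s c => //= x s IH c; rewrite IH. Qed.

End Maps.

(** * The prism operator *)

Section Prism.
Variables (M N : Type) (f g : M -> N).
Implicit Types (c : seq N -> bool) (s : seq M).

(** The sum over [i] of [c] on the tuples [f x0, ..., f xi, g xi, ..., g xn]: the cochain homotopy
    between the pullbacks along [f] and [g]. *)
Fixpoint prism c s : bool :=
  if s is x :: s' then
    c [:: f x, g x & map g s'] (+) prism (fun l => c (f x :: l)) s'
  else false.

Lemma prism_ext c b s :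
  (forall l, (forall y, inl y l -> exists2 x, inl x s & y = f x \/ y = g x) ->
     size l = (size s).+1 -> c l = b l) ->
  prism c s = prism b s.
Proof.
elim: s c b => //= x s IH c b H; rewrite H /=; last by rewrite size_map.
  congr (_ (+) _); apply: IH => l Hl Hs; apply: H => /=; last by rewrite Hs.
  move=> y [<-|/Hl[z zs zy]]; first by exists x; left.
  by exists z => //; right.
move=> y [<-|[<-|/(@inl_map _ _ g)[z zs ->]]].
- by exists x; left.
- by exists x; [left|right].
- by exists z; right.
Qed.

Lemma prism_add c b s :
  prism (cadd c b) s = prism c s (+) prism b s.
Proof.
elim: s c b => //= x s IH c b.
rewrite (IH (fun l => c (f x :: l)) (fun l => b (f x :: l))) /cadd.
move: (c _) (b _) (prism _ s) (prism _ s); bsolve.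
Qed.

Lemma del_prism c s :
  del (prism c) s = prism (del c) s (+) c (map f s) (+) c (map g s).
Proof.
elim: s c => [|x s IH] c; first by rewrite /= addbb.
have -> : del (prism c) (x :: s) =
  prism c s (+) del (fun l => prism c (x :: l)) s by [].
have -> : del (fun l => prism c (x :: l)) s =
  del (cadd (fun l => c [:: f x, g x & map g l]) (prism (fun l => c (f x :: l)))) s.
  by apply: del_ext.
rewrite del_add IH.
have -> : prism (del c) (x :: s) =
  del c [:: f x, g x & map g s] (+) prism (cadd c (del (fun l => c (f x :: l)))) s.
  by [].
rewrite prism_add.
rewrite -(del_map g (fun l => c [:: f x, g x & l])) /=.
set A := prism c s; set B := del _ (map g s); set C := prism _ s.
move: A B C (c (g x :: _)) (c (f x :: map g s)) (c (f x :: map f s)) => [] [] [] [] [] [] //.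
Qed.

Lemma prism_map (h : M -> M) (k : N -> N) c s :
  (forall x, inl x s -> f (h x) = k (f x) /\ g (h x) = k (g x)) ->
  prism c (map h s) = prism (fun l => c (map k l)) s.
Proof.
elim: s c => //= x s IH c H.
have [-> ->] : f (h x) = k (f x) /\ g (h x) = k (g x) by apply: H; left.
rewrite IH => [|y ys]; last by apply: H; right.
congr (c (_ :: _ :: _) (+) _).
elim: s {IH} H => //= y s IH H.
rewrite (proj2 (H y _)) ?IH //; last by right; left.
by move=> z [<-|zs]; apply: H; [left|right; right].
Qed.
End Prism.

(** * Equivariant Alexander-Spanier cohomology *)

(** The balls of a pseudometric, without the distance: cochains see only the uniform structure.
    Distinct points may be near at every scale, as will be the points of one ray in a fibre. *)
Record uspace (R : realType) := Uspace {
  upt :> Type;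
  near : R -> upt -> upt -> Prop;
  near_refl : forall e x, 0 < e -> near e x x;
  near_sym : forall e x y, near e x y -> near e y x;
  near_tri : forall e e' x y z, near e x y -> near e' y z -> near (e + e') x z;
  near_mono : forall e e' x y, e <= e' -> near e x y -> near e' x y }.

Section Germs.
Variables (R : realType) (M : uspace R).
Implicit Types (X Y : M -> Prop) (s l : seq M) (P Q : seq M -> Prop) (e : R).

Definition small X e s :=
  forall x, inl x s -> X x /\ forall y, inl y s -> near e x y.

Lemma small_sub X e s l :
  small X e s -> (forall x, inl x l -> inl x s) -> small X e l.
Proof. by move=> ss ls x /ls/ss[Xx nx]; split=> // y /ls /nx. Qed.

Lemma small_le X Y e e' s :
  e <= e' -> (forall x, X x -> Y x) -> small X e s -> small Y e' s.
Proof.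
move=> ee XY ss x /ss[Xx nx]; split=> [|y /nx]; first exact: XY.
exact: near_mono.
Qed.

(** This stands for passing to germs along the diagonal, in place of a quotient by the cochains that
    vanish on small tuples. *)
Definition ev X P := exists2 e, 0 < e & forall s, small X e s -> P s.

Lemma ev_and X P Q : ev X P -> ev X Q -> ev X (fun s => P s /\ Q s).
Proof.
move=> [e e0 HP] [e' e'0 HQ]; exists (Num.min e e'); first by rewrite lt_min e0.
move=> s ss; split.
  by apply: HP; apply: small_le ss => //; rewrite ge_min lexx.
by apply: HQ; apply: small_le ss => //; rewrite ge_min lexx orbT.
Qed.

Lemma ev_imp X P Q :
  (forall s, (forall x, inl x s -> X x) -> P s -> Q s) -> ev X P -> ev X Q.
Proof.
move=> PQ [e e0 HP]; exists e => // s ss.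
by apply: PQ (HP s ss) => x /ss[].
Qed.

Lemma ev_imp2 X P P' Q :
  (forall s, (forall x, inl x s -> X x) -> P s -> P' s -> Q s) ->
  ev X P -> ev X P' -> ev X Q.
Proof.
by move=> PQ HP HP'; apply: ev_imp (ev_and HP HP') => s Xs [p p']; apply: PQ.
Qed.

Lemma ev_sub X Y P : (forall x, Y x -> X x) -> ev X P -> ev Y P.
Proof. by move=> YX [e e0 HP]; exists e => // s ss; apply: HP; apply: small_le ss. Qed.

Lemma ev_faces X P : ev X P -> ev X (fun s => forall l, (forall x, inl x l -> inl x s) -> P l).
Proof. by move=> [e e0 HP]; exists e => // s ss l ls; apply: HP; apply: small_sub ls. Qed.

Lemma ev_all X P : (forall s, (forall x, inl x s -> X x) -> P s) -> ev X P.
Proof. by move=> H; exists 1 => // s ss; apply: H => x /ss[]. Qed.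

Definition isom (k : M -> M) := forall e x y, near e x y -> near e (k x) (k y).

Lemma small_map X Y k e s : isom k -> (forall x, X x -> Y (k x)) ->
  small X e s -> small Y e (map k s).
Proof.
move=> ik kX ss y0 ys0; have [x xs ->] := inl_map ys0; have [Xx nx] := ss x xs; split; first exact: kX.
by move=> y1 ys1; have [y ys ->] := inl_map ys1; apply: ik; apply: nx.
Qed.

Lemma ev_map X Y k P : isom k -> (forall x, X x -> Y (k x)) ->
  ev Y P -> ev X (fun s => P (map k s)).
Proof. by move=> ik kX [e e0 HP]; exists e => // s ss; apply: HP; apply: (small_map ik kX ss). Qed.
End Germs.

Section Cohomology.
Variables (R : realType) (M : uspace R).
Implicit Types (X Y : M -> Prop) (s l : seq M) (c b : seq M -> bool)
  (K : seq (M -> M)) (e : M -> bool) (n : nat).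

(* A cochain of degree [d] is evaluated on tuples of size [n = d.+1]; all identities
   are only required on tuples of small diameter. *)
Definition coc X n c := ev X (fun s => size s = n.+1 -> del c s = false).
Definition inv K X n c :=
  ev X (fun s => size s = n -> forall k, inl k K -> c (map k s) = c s).
Definition eqg X n c b := ev X (fun s => size s = n -> c s = b s).
Definition cocyc K X n c := [/\ c [::] = false, inv K X n c & coc X n c].
(* [b [::] = false] prevents constants from being coboundaries in degree 0. *)
Definition exact K X n c :=
  exists b, [/\ b [::] = false, inv K X n.-1 b & eqg X n c (del b)].

Lemma inv_add K X n c b : inv K X n c -> inv K X n b -> inv K X n (cadd c b).
Proof.
apply: ev_imp2 => s Xs Hc Hb sn k kK.
by rewrite /cadd Hc // Hb.
Qed.

Lemma inv_sub K X Y n c : (forall x, Y x -> X x) -> inv K X n c -> inv K Y n c.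
Proof. exact: ev_sub. Qed.

Lemma inv_consr k K X n c : inv (k :: K) X n c -> inv K X n c.
Proof. by apply: ev_imp => s _ H sn k' k'K; apply: H => //; right. Qed.

Lemma cocyc_add K X n c b : cocyc K X n c -> cocyc K X n b -> cocyc K X n (cadd c b).
Proof.
move=> [c0 ci cc] [b0 bi bc]; split; first by rewrite /cadd c0 b0.
  exact: inv_add.
by move: cc bc; apply: ev_imp2 => s _ cc bc sn; rewrite del_add cc // bc.
Qed.

Lemma cocyc_sub K X Y n c : (forall x, Y x -> X x) -> cocyc K X n c -> cocyc K Y n c.
Proof. by move=> YX [c0 ci cc]; split=> //; apply: ev_sub YX _. Qed.

Lemma cocyc_consr k K X n c : cocyc (k :: K) X n c -> cocyc K X n c.
Proof. by move=> [c0 ci cc]; split=> //; apply: inv_consr ci. Qed.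

Lemma cocyc0 K X n : cocyc K X n (fun=> false).
Proof.
split=> //; apply: ev_all => // s _ _.
by elim: s => //= x s IH; rewrite IH.
Qed.

Lemma exact_add K X n c b : exact K X n c -> exact K X n b -> exact K X n (cadd c b).
Proof.
move=> [c' [c0 ci cc]] [b' [b0 bi bc]]; exists (cadd c' b'); split.
- by rewrite /cadd c0 b0.
- exact: inv_add.
by move: cc bc; apply: ev_imp2 => s _ cc bc sn; rewrite del_add /cadd cc // bc.
Qed.

Lemma exact_eq K X n c b : eqg X n c b -> exact K X n c -> exact K X n b.
Proof.
move=> cb [c' [c0 ci cc]]; exists c'; split=> //.
by move: cb cc; apply: ev_imp2 => s _ cb cc sn; rewrite -cb // cc.
Qed.

Lemma exact_eqf K X n c b : (forall s, size s = n -> c s = b s) -> exact K X n c -> exact K X n b.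
Proof. by move=> cb; apply/exact_eq/ev_all => s _; apply: cb. Qed.

Lemma exact0 K X n : exact K X n (fun=> false).
Proof.
exists (fun=> false); split=> //; apply: ev_all => // s _ _.
by elim: s => //= x s <-.
Qed.

Lemma exact_sub K X Y n c : (forall x, Y x -> X x) -> exact K X n c -> exact K Y n c.
Proof. by move=> YX [b [b0 bi bc]]; exists b; split=> //; apply: ev_sub YX _. Qed.

Lemma exact_consr k K X n c : exact (k :: K) X n c -> exact K X n c.
Proof. by move=> [b [b0 bi bc]]; exists b; split=> //; apply: inv_consr bi. Qed.

Lemma exact_cancel K X n c b :
  exact K X n (cadd c b) -> exact K X n b -> exact K X n c.
Proof.
move=> Hcb Hb; apply: exact_eqf (exact_add Hcb Hb) => s _.
by rewrite /cadd -addbA addbb addbF.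
Qed.

Lemma exact_trans K X n c b a :
  exact K X n (cadd c b) -> exact K X n (cadd b a) -> exact K X n (cadd c a).
Proof.
move=> Hcb Hb; apply: exact_eqf (exact_add Hcb Hb) => s _.
by rewrite /cadd addbA -(addbA (c s)) addbb addbF.
Qed.

Lemma exact_sym K X n c b : exact K X n (cadd c b) -> exact K X n (cadd b c).
Proof. by apply: exact_eqf => s _; rewrite /cadd addbC. Qed.

Lemma exact_scale K X n (k : bool) c : exact K X n c -> exact K X n (fun s => k && c s).
Proof. by case: k => // _; apply: exact0. Qed.

Lemma cocyc_scale K X n (k : bool) c : cocyc K X n c -> cocyc K X n (fun s => k && c s).
Proof. by case: k => // _; apply: cocyc0. Qed.

(** Over [X] each [k] either preserves [e] throughout or negates it throughout. The coboundary of
    such an [e] is invariant even where [e] is not. *)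
Definition sgnf K X (e : M -> bool) := forall k, inl k K ->
  forall x y, X x -> X y -> e (k x) (+) e (k y) = e x (+) e y.

Definition invf K X (e : M -> bool) := forall k, inl k K ->
  forall x, X x -> e (k x) = e x.

Lemma inv_hst K X n e c : sgnf K X e -> inv K X n c -> inv K X n.+1 (hst e c).
Proof.
move=> He /ev_faces; apply: ev_imp => -[|x [|y s]] Xs Hc sn k kK //.
have E : c (map k (y :: s)) = c (y :: s).
  by apply: Hc kK; [move=> z; right|case: sn => /= <-].
rewrite /= in E *; rewrite E; congr (_ && _).
by apply: He => //; apply: Xs; [left|right; left].
Qed.

Lemma cocyc_hst K X n e c : sgnf K X e -> cocyc K X n c -> cocyc K X n.+1 (hst e c).
Proof.
move=> He [c0 ci cc]; split=> //; first exact: inv_hst.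
move/ev_faces: cc; apply: ev_imp => -[|x [|y s]] Xs cc sn //.
rewrite del_hst // /hst (_ : del c (y :: s) = false) ?andbF //.
by apply: cc; [move=> z; right|case: sn => /= <-].
Qed.

Lemma exact_hst K X n e c : sgnf K X e -> exact K X n c -> exact K X n.+1 (hst e c).
Proof.
move=> He [b [b0 bi bc]]; exists (hst e b); split=> //.
  case: n bc bi => [|n] bc bi; last by apply: inv_hst.
  by apply: ev_all => -[].
move/ev_faces: bc; apply: ev_imp => -[|x [|y s]] Xs bc sn //.
rewrite del_hst // /hst (_ : c (y :: s) = del b (y :: s)) //.
by apply: bc; [move=> z; right|case: sn => /= <-].
Qed.

Lemma inv_hmul K X n e c : invf K X e -> inv K X n c -> inv K X n (hmul e c).
Proof.
move=> He; apply: ev_imp => -[|x s] Xs Hc sn k kK //=.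
by rewrite He //; [rewrite -(Hc sn k kK)|apply: Xs; left].
Qed.

Lemma exact_hst_inv K X n e c : invf K X e -> cocyc K X n c -> exact K X n.+1 (hst e c).
Proof.
move=> He [c0 ci cc]; exists (hmul e c); split=> //; first exact: inv_hmul.
move: cc; apply: ev_imp => -[|x s] Xs cc sn //.
by rewrite del_hmul // /hmul cc // andbF addbF.
Qed.

(** Degree one classes depend only on characters: [e (+) e'] is invariant, and for an invariant
    function the product with its coboundary has a primitive, namely [hmul]. *)
Lemma exact_hst_sgn K X n e e' c :
  (forall k, inl k K -> forall x, X x -> e (k x) (+) e' (k x) = e x (+) e' x) ->
  cocyc K X n c -> exact K X n.+1 (cadd (hst e c) (hst e' c)).
Proof.
move=> He Hc; apply: exact_eqf (@exact_hst_inv K X n (fun x => e x (+) e' x) c He Hc).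
move=> [|x [|y s]] //= _; rewrite /cadd /=.
move: (e x) (e y) (e' x) (e' y) (c _); bsolve.
Qed.

Lemma exact_hstC K X n e e' c : sgnf K X e -> sgnf K X e' -> cocyc K X n c ->
  exact K X n.+2 (cadd (hst e (hst e' c)) (hst e' (hst e c))).
Proof.
move=> He He' [c0 /ev_faces ci cc]; exists (hst2 e e' c); split=> //.
  move: ci; apply: ev_imp => -[|x [|y s]] Xs Hc sn k kK //.
  have E : c (map k (y :: s)) = c (y :: s).
    by apply: Hc kK; [move=> z; right|case: sn => /= <-].
  rewrite /= in E *; rewrite E.
  by congr (_ && _ && _); [apply: He|apply: He'] => //; apply: Xs; [left|right; left|left|right; left].
move/ev_faces: cc; apply: ev_imp => -[|x [|y s]] Xs cc sn //.
have E : hst2 e e' (del c) [:: x, y & s] = false.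
  rewrite /hst2 (_ : del c (y :: s) = false) ?andbF //.
  by apply: cc; [move=> z; right|case: sn => /= <-].
by rewrite /cadd del_hst2 // E addbF.
Qed.

End Cohomology.

Section Pull.
Variables (R : realType) (M N : uspace R).
Implicit Types (X : M -> Prop) (Y : N -> Prop) (c b : seq N -> bool) (f g : M -> N).

Definition ucont X f := forall e, 0 < e -> exists2 d, 0 < d &
  forall x y, X x -> X y -> near d x y -> near e (f x) (f y).

Lemma ev_pull X Y f (P : seq N -> Prop) : ucont X f -> (forall x, X x -> Y (f x)) ->
  ev Y P -> ev X (fun s => P (map f s)).
Proof.
move=> uf fXY [e e0 HP]; have [d d0 Hd] := uf _ e0; exists d => // s ss; apply: HP.
move=> y0 ys0; have [x xs ->] := inl_map ys0; have [Xx nx] := ss x xs; split; first exact: fXY.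
by move=> y1 ys1; have [y ys ->] := inl_map ys1; apply: Hd (nx y ys) => //; case: (ss y ys).
Qed.

Definition equiv (KM : seq (M -> M)) (KN : seq (N -> N)) X f :=
  forall k, inl k KM -> exists2 k', inl k' KN & forall x, X x -> f (k x) = k' (f x).

Lemma inv_pull KM KN X Y f n c : ucont X f -> (forall x, X x -> Y (f x)) ->
  equiv KM KN X f -> inv KN Y n c -> inv KM X n (fun s => c (map f s)).
Proof.
move=> uf fXY ef /(ev_pull uf fXY); apply: ev_imp => s Xs H sn k kK.
have [k' k'K fk] := ef k kK; rewrite -(H _ k') ?size_map //; congr c.
elim: s {sn H} Xs => //= x s IH Xs; rewrite fk ?IH //; last by apply: Xs; left.
by move=> y ys; apply: Xs; right.
Qed.

Lemma cocyc_pull KM KN X Y f n c : ucont X f -> (forall x, X x -> Y (f x)) ->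
  equiv KM KN X f -> cocyc KN Y n c -> cocyc KM X n (fun s => c (map f s)).
Proof.
move=> uf fXY ef [c0 ci cc]; split=> //; first exact: inv_pull ci.
move/(ev_pull uf fXY): cc; apply: ev_imp => s _ H sn.
by rewrite -del_map H ?size_map.
Qed.

Lemma exact_pull KM KN X Y f n c : ucont X f -> (forall x, X x -> Y (f x)) ->
  equiv KM KN X f -> exact KN Y n c -> exact KM X n (fun s => c (map f s)).
Proof.
move=> uf fXY ef [b [b0 bi bc]]; exists (fun s => b (map f s)); split=> //.
  exact: inv_pull bi.
move/(ev_pull uf fXY): bc; apply: ev_imp => s _ H sn.
by rewrite -del_map H ?size_map.
Qed.

Lemma hst_map e f c s : hst e c (map f s) = hst (e \o f) (fun l => c (map f l)) s.
Proof. by case: s => // x []. Qed.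

Definition equiv2 (KM : seq (M -> M)) (KN : seq (N -> N)) X f g :=
  forall k, inl k KM -> exists2 k', inl k' KN & forall x, X x ->
    f (k x) = k' (f x) /\ g (k x) = k' (g x).

(** When [f] and [g] are close on the scale at which [c] is closed and invariant, the prism sees
    only tuples on which both properties hold. The bound depends on [c] alone, so it serves for
    arbitrarily long chains of maps. *)
Lemma homotopy KM KN X Y n c : cocyc KN Y n c ->
  exists2 e, 0 < e & forall f g,
    ucont X f -> (forall x, X x -> Y (f x)) ->
    ucont X g -> (forall x, X x -> Y (g x)) -> equiv2 KM KN X f g ->
    (forall x, X x -> near e (f x) (g x)) ->
    exact KM X n (cadd (fun s => c (map f s)) (fun s => c (map g s))).
Proof.
(* One half of the scale is spent on the distance from [f] to [g], the other on the continuity of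
   each of them. *)
move=> [c0 ci cc]; have [e e0 He] := ev_and ci cc; exists (e / 2%:R); first by rewrite divr_gt0.
move=> f g uf fY ug gY efg nfg.
have e2 : 0 < e / 2%:R by rewrite divr_gt0.
have [d1 d10 Hf] := uf _ e2; have [d2 d20 Hg] := ug _ e2.
have small_fg s l : small X (Num.min d1 d2) s ->
    (forall y, inl y l -> exists2 x, inl x s & y = f x \/ y = g x) -> small Y e l.
  move=> ss Hl y yl; split.
    by have [x /ss[Xx _] [->|->]] := Hl y yl; [apply: fY|apply: gY].
  move=> y' y'l; have [x xs xy] := Hl y yl; have [x' xs' xy'] := Hl y' y'l.
  have [Xx /(_ _ xs') nx] := ss x xs; have [Xx' _] := ss x' xs'.
  have nf : near (e / 2%:R) (f x) (f x').
    by apply: Hf => //; apply: near_mono nx; rewrite ge_min lexx.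
  have ng : near (e / 2%:R) (g x) (g x').
    by apply: Hg => //; apply: near_mono nx; rewrite ge_min lexx orbT.
  have le2 : e / 2%:R <= e by rewrite ler_pdivrMr ?ltr0n // ler_peMr ?ler1n // ltW.
  case: xy => ->; case: xy' => ->.
  - exact: near_mono nf.
  - by rewrite [e]splitr; apply: near_tri nf (nfg _ _).
  - rewrite [e]splitr; apply: near_tri nf; exact/near_sym/nfg.
  - exact: near_mono ng.
exists (prism f g c); split=> //.
  exists (Num.min d1 d2); first by rewrite lt_min d10.
  move=> s ss sn k kK; have [k' k'K fk] := efg k kK.
  case: s ss sn => [|x0 s] ss sn //; set s0 := x0 :: s in ss sn *.
  rewrite (@prism_map _ _ f g k k'); last by move=> x /ss[Xx _]; apply: fk.
  apply: prism_ext => l Hl sl; apply: (proj1 (He l (small_fg _ _ ss Hl))) => //.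
  by rewrite sl sn; case: n sn {ci cc He}.
exists (Num.min d1 d2); first by rewrite lt_min d10.
move=> s ss sn; rewrite del_prism.
have -> : prism f g (del c) s = prism f g (fun=> false) s.
  apply: prism_ext => l Hl sl; apply: (proj2 (He l (small_fg _ _ ss Hl))).
  by rewrite sl sn.
have -> : prism f g (fun=> false) s = false by elim: s {ss sn} => //= x s ->.
by [].
Qed.
End Pull.

(** * Deformation by small equivariant moves *)

Section Deform.
Variables (R : realType) (M : uspace R).
Implicit Types (X Y : M -> Prop) (K : seq (M -> M)) (f g : M -> M).

Definition good K X f := [/\ ucont X f, forall x, X x -> X (f x) &
  forall k, inl k K -> forall x, X x -> f (k x) = k (f x)].

Inductive linked K X (e : R) : (M -> M) -> Prop :=
| linked_id : linked K X e id
| linked_step f g : linked K X e f -> good K X g ->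
    (forall x, X x -> near e (f x) (g x)) -> linked K X e g.

(** This plays the role of a deformation retraction. The chain of moves may depend on the scale, and
    the moves may disturb [Y]. *)
Definition deform K X Y := (forall x, Y x -> X x) /\
  forall e, 0 < e -> exists2 f, linked K X e f & forall x, X x -> Y (f x).

Lemma good_id K X : good K X id.
Proof. by split=> // e e0; exists e. Qed.

Lemma linked_good K X e f : linked K X e f -> good K X f.
Proof. by case=> //; apply: good_id. Qed.

Lemma good_comp K X f g : good K X f -> good K X g -> good K X (f \o g).
Proof.
move=> [uf fX fK] [ug gX gK]; split=> [e e0|x /gX/fX //|k kK x Xx] /=; last first.
  by rewrite gK // fK //; apply: gX.
have [d d0 Hf] := uf e e0; have [d' d'0 Hg] := ug d d0; exists d' => // x y Xx Xy nxy.
by apply: Hf; [apply: gX|apply: gX|apply: Hg].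
Qed.

Lemma linked_iter K X e g n : good K X g -> (forall x, X x -> near e x (g x)) ->
  linked K X e (iter n g).
Proof.
move=> gg ng; elim: n => [|n IH]; first exact: linked_id.
have gI : good K X (iter n g) := linked_good IH.
apply: linked_step IH _ _; first exact: (good_comp gg gI).
by move=> x Xx; apply: ng; case: gI => _ + _; apply.
Qed.

(** Each link of the chain preserves the class of [c] by [homotopy], so [c] is cohomologous to its
    pullback along a map into [Y], and that pullback is exact. *)
Lemma exact_deform K X Y n (c : seq M -> bool) :
  deform K X Y -> cocyc K X n c -> exact K Y n c -> exact K X n c.
Proof.
move=> [YX df] Hc HY; have [e e0 He] := @homotopy _ _ _ K _ X _ _ _ Hc.
have [f lf fY] := df e e0.
have Hf : exact K X n (cadd c (fun s => c (map f s))).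
  elim: lf {fY} => [|f' g lf IH gg ng].
    by apply: exact_eqf (exact0 K X n) => s _; rewrite /cadd map_id addbb.
  apply: exact_trans IH _; have [uf fX fK] := linked_good lf; have [ug gX gK] := gg.
  by apply: He => // k kK; exists k => // x Xx; rewrite fK // gK.
apply: exact_cancel Hf _; have [uf fX fK] := linked_good lf.
by apply: (exact_pull uf fY _ HY) => k kK; exists k => // x Xx; rewrite fK.
Qed.
End Deform.

Section Comb.
Variables (R : realType) (M : uspace R).
Variables (eps : M -> bool) (e_ : nat -> seq M -> bool) (rho : nat).
Implicit Types (X A : M -> Prop) (K : seq (M -> M)) (psi : nat -> bool).

(* The class [\sum_(b < rho, b < n) psi_b h^(n-1-b) e_b]. *)
Fixpoint comb n psi : seq M -> bool :=
  if n is m.+1 then cadd (hst eps (comb m psi)) (fun s => (psi m && (m < rho)%N) && e_ m s)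
  else fun=> false.

Lemma comb_ext n psi phi : (forall b, (b < n)%N -> psi b = phi b) -> comb n psi = comb n phi.
Proof.
elim: n => //= n IH H; rewrite IH => [|b bn]; last by rewrite H // ltnS ltnW.
by rewrite H.
Qed.

Lemma cocyc_comb K X n psi : sgnf K X eps ->
  (forall b, cocyc K X b.+1 (e_ b)) -> cocyc K X n (comb n psi).
Proof.
move=> He e_c; elim: n => [|n IH] /=; first exact: cocyc0.
by apply: cocyc_add; [apply: cocyc_hst|apply: cocyc_scale].
Qed.

Definition basis K X J :=
  (forall n c, cocyc K X n.+1 c -> exists psi, exact K X n.+1 (cadd c (comb n.+1 psi))) /\
  (forall n psi, exact K X n (comb n psi) ->
     forall b, (b < n)%N -> (b < rho)%N -> (n <= b + J)%N -> psi b = false).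

(** For a sphere with the antipodal action this is the cohomology of the projective space of
    dimension [rho - 1]. *)
Definition fbasis K A :=
  (forall n c, cocyc K A n.+1 c -> exists kp : bool,
     exact K A n.+1 (cadd c (fun s => (kp && (n < rho)%N) && e_ n s))) /\
  (forall n, (n < rho)%N -> ~ exact K A n.+1 (e_ n)).

Lemma basis_deform K X Y J : sgnf K X eps -> (forall b, cocyc K X b.+1 (e_ b)) ->
  deform K X Y -> basis K Y J -> basis K X J.
Proof.
move=> He e_c dXY [Sp In]; split=> [n c Hc|n psi Hn].
  have [psi Hpsi] := Sp n c (cocyc_sub (proj1 dXY) Hc); exists psi.
  by apply: exact_deform dXY _ Hpsi; apply: cocyc_add Hc _; apply: cocyc_comb.
exact: In (exact_sub (proj1 dXY) Hn).
Qed.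

Lemma fbasis_deform K X Y : (forall b, cocyc K X b.+1 (e_ b)) ->
  deform K X Y -> fbasis K Y -> fbasis K X.
Proof.
move=> e_c dXY [Sp In]; split=> [n c Hc|n nr Hn].
  have [kp Hkp] := Sp n c (cocyc_sub (proj1 dXY) Hc); exists kp.
  by apply: exact_deform dXY _ Hkp; apply: cocyc_add Hc _; apply: cocyc_scale.
exact: In nr (exact_sub (proj1 dXY) Hn).
Qed.
End Comb.

(** * Mayer-Vietoris for two halves exchanged by an involution *)

Section Step.
Variables (R : realType) (M : uspace R).
Variables (eps : M -> bool) (e_ : nat -> seq M -> bool) (rho J : nat).
Variables (K : seq (M -> M)) (sg : M -> M) (X A : M -> Prop).
Let G := sg :: K.
Let I x := A x /\ A (sg x).
Hypothesis KA : forall k, inl k K -> forall x, X x -> (A (k x) <-> A x).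
Hypothesis isoS : isom sg.
Hypothesis SX : forall x, X x -> X (sg x).
Hypothesis SS : forall x, X x -> sg (sg x) = x.
Hypothesis SK : forall k, inl k K -> forall x, X x -> sg (k x) = k (sg x).
Hypothesis AX : forall x, A x -> X x.
Hypothesis cover : ev X (fun s => (forall x, inl x s -> A x) \/ (forall x, inl x s -> A (sg x))).
Hypothesis epsS : forall x, X x -> eps (sg x) = ~~ eps x.
Hypothesis epsK : invf K X eps.
Hypothesis e_c : forall b, cocyc G X b.+1 (e_ b).

Local Lemma IX x : I x -> X x. Proof. by case=> /AX. Qed.
Local Lemma IA x : I x -> A x. Proof. by case. Qed.
Local Lemma SI x : I x -> I (sg x).
Proof. by move=> [Ax Asx]; split=> //; rewrite SS //; apply: AX. Qed.
Local Lemma KI k x : inl k K -> X x -> (I (k x) <-> I x).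
Proof.
move=> kK Xx; rewrite /I SK //.
by split=> -[a b]; split; apply/(KA kK) => //; apply: SX.
Qed.

Lemma map_SS s : (forall x, inl x s -> X x) -> map sg (map sg s) = s.
Proof.
elim: s => //= x s IH Xs; rewrite IH ?SS //; first by apply: Xs; left.
by move=> y ys; apply: Xs; right.
Qed.

Lemma map_SK k s : inl k K -> (forall x, inl x s -> X x) ->
  map sg (map k s) = map k (map sg s).
Proof.
move=> kK; elim: s => //= x s IH Xs; rewrite IH ?SK //; first by apply: Xs; left.
by move=> y ys; apply: Xs; right.
Qed.

Lemma all_map (Y Z : M -> Prop) k s : (forall x, Y x -> Z (k x)) ->
  (forall x, inl x s -> Y x) -> forall x, inl x (map k s) -> Z x.
Proof. by move=> YZ Ys x xs; have [y ys ->] := inl_map xs; apply/YZ/Ys. Qed.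

Lemma sgn_eps : sgnf G X eps.
Proof.
move=> k [<-|kK] x y Xx Xy; last by rewrite !epsK.
by rewrite !epsS // addNb addbN negbK.
Qed.

Lemma inv_tr n v : inv K A n v -> inv G I n (fun s => v s (+) v (map sg s)).
Proof.
move=> iv; have iv2 : ev I (fun s => size s = n ->
   forall k, inl k K -> v (map k (map sg s)) = v (map sg s)).
  have := ev_map isoS (fun x (Ix : I x) => IA (SI Ix)) iv.
  by apply: ev_imp => s _ H sn; apply: H; rewrite size_map.
move: (ev_sub IA iv) iv2; apply: ev_imp2 => s Is H1 H2 sn k [<-|kK].
  rewrite map_SS; last by move=> x /Is/IX.
  exact: addbC.
rewrite map_SK //; last by move=> x /Is/IX.
by congr (_ (+) _); [apply: H1|apply: H2].
Qed.

Lemma inv_del (L : seq (M -> M)) (Y : M -> Prop) n c : inv L Y n c -> inv L Y n.+1 (del c).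
Proof.
move/ev_faces; apply: ev_imp => s _ H sn k kL; rewrite del_map.
by apply: del_ext => l ls sl; apply: H => //; move: sl; rewrite sn => -[].
Qed.

Lemma ev_restrict (Y Z : M -> Prop) (P : seq M -> Prop) : ev Y P -> ev Z (fun s => (forall x, inl x s -> Y x) -> P s).
Proof.
move=> [e e0 H]; exists e => // s ss Ys; apply: H => x xs.
by split; [apply: Ys|case: (ss x xs)].
Qed.

Lemma asbool_iff (P Q : Prop) : (P <-> Q) -> `[< P >] = `[< Q >].
Proof. by move=> PQ; apply/asboolP/asboolP => /PQ. Qed.

(** Invariant cochains on [A] and [sg A] together amount to [K]-invariant cochains on [A]. So the
    Mayer-Vietoris sequence runs from [X] (group [G]) to [A] (group [K]), by the transfer [v + sg v]
    to [I] (group [G]), and back to [X]; on classes that extend to [X] the last map is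
    multiplication by [h]. This gains one power of [h]. *)
Lemma step : fbasis e_ rho K A -> basis eps e_ rho G I J -> basis eps e_ rho G X J.+1.
Proof.
move=> [SpA InA] [SpI InI]; split.
  move=> n c Hc.
  have [kp [v [v0 vi vc]]] := SpA n c (cocyc_sub AX (cocyc_consr Hc)).
  (* Removing the class seen on [A] leaves a cocycle [u] which is the coboundary of [v] on [A] and,
     by invariance, of the translate of [v] on [sg A]. *)
  pose u := cadd c (fun s => (kp && (n < rho)%N) && e_ n s).
  have Hu : cocyc G X n.+1 u by apply: cocyc_add => //; apply: cocyc_scale.
  have vcu : eqg A n.+1 u (del v) := vc.
  suff [psi Hpsi] : exists psi, exact G X n.+1 (cadd u (hst eps (comb eps e_ rho n psi))).
    exists (fun b => if b == n then kp else psi b).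
    apply: exact_eqf Hpsi => s _ /=; rewrite eqxx.
    rewrite (@comb_ext _ _ _ _ _ n _ psi) => [|b bn]; last by rewrite ltn_eqF.
    by rewrite /u /cadd -addbA (addbC (hst _ _ _)).
  move: vc u Hu vcu => _ u Hu vc; clear Hc.
  case: n v vi u Hu vc v0 => [|m] v vi u Hu vc v0.
    (* In degree 0, [v] is read only at the empty tuple, where it is false. So [u] vanishes on [A]
       and by invariance on [X]. *)
    exists (fun=> false); exists (fun=> false); split=> //; first by apply: ev_all.
    case: Hu => _ ui _; move: (ev_and cover ui) => H.
    have vcS : ev X (fun s => (forall x, inl x s -> A (sg x)) -> size s = 1%N -> u (map sg s) = del v (map sg s)).
      have := ev_map isoS SX (@ev_restrict A X _ vc); apply: ev_imp => s _ E As sn.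
      apply: E; rewrite ?size_map //.
      by move=> x xs; have [y ys ->] := inl_map xs; apply: As.
    move: (ev_and H vcS) (@ev_restrict A X _ vc).
    apply: ev_imp2 => -[|x [|y s]] Xs [[cov iu] E1] E2 // _.
    have d0 : del (fun=> false) [:: x] = false by [].
    rewrite /cadd /= addbF.
    case: cov => As; first by rewrite E2 // /= v0.
    by rewrite -(iu erefl sg (or_introl erefl)) E1 //= v0.
  (* The two primitives differ on [I] by the cocycle [w], whose class is represented by a cochain
     [C] that exists on all of [X]. *)
  pose w := fun s => v s (+) v (map sg s).
  have ui : inv G X m.+2 u by case: Hu.
  have vcS : ev I (fun s => size s = m.+2 -> u (map sg s) = del v (map sg s)).
    have := ev_map isoS (fun x (Ix : I x) => IA (SI Ix)) vc.
    by apply: ev_imp => s _ H sn; apply: H; rewrite size_map.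
  have Hw : cocyc G I m.+1 w.
    split; [by rewrite /w /= v0|exact: inv_tr|].
    move: (ev_and (ev_sub IA vc) (ev_sub IX ui)) vcS.
    apply: ev_imp2 => s Is [vc' ui'] vcS' sn.
    have -> : del w s = del (cadd v (fun l => v (map sg l))) s by apply: del_ext.
    rewrite del_add -del_map -vcS' // -vc' //.
    by rewrite (ui' sn sg (or_introl erefl)) addbb.
  have [psi [y [y0 yi yc]]] := SpI m w Hw.
  exists psi; set C := comb eps e_ rho m.+1 psi in yc *.
  have HC : cocyc G X m.+1 C by apply: cocyc_comb => //; apply: sgn_eps.
  have [C0 Ci Cc] := HC.
  (* As [sg] negates [eps], adding translates turns [eps C] into [C] and [eps y] into [y]. Hence on
     [I] the sum of [v2] and its translate is [w + del y + C = 0], and the two glue to [V]. Outside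
     [I], [yb] is extended by 0. *)
  pose yb s := `[< forall x, inl x s -> I x >] && hmul eps y s.
  pose v2 := cadd (cadd v (del yb)) (hmul eps C).
  pose V s := if `[< forall x, inl x s -> A x >] then v2 s else v2 (map sg s).
  have ybi : inv K A m yb.
    have := @ev_restrict I A _ yi; apply: ev_imp => s As H sn k kK.
    have E : (forall x, inl x (map k s) -> I x) <-> (forall x, inl x s -> I x).
      split=> H1 x xs.
        by apply/(KI kK); [apply/AX/As|apply/H1/map_inl].
      by have [z zs ->] := inl_map xs; apply/KI; [|apply/AX/As|apply: H1].
    rewrite /yb (asbool_iff E); case: asboolP => //= Is.
    have := H Is sn k (or_intror kK); case: s As {H sn E} Is => //= x s As Is ->.
    by rewrite epsK //; apply/AX/As; left.
  have v2i : inv K A m.+1 v2.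
    apply: inv_add; first by apply: inv_add => //; apply: inv_del.
    apply: inv_hmul; first by move=> k kK x Ax; apply: epsK (AX Ax).
    exact: inv_sub AX (inv_consr Ci).
  have sym : ev I (fun s => size s = m.+1 -> v2 (map sg s) = v2 s).
    move: (ev_and yc (ev_sub IX Ci)) (ev_faces yi).
    apply: ev_imp2 => s Is [yc' Ci'] yi' sn.
    suff E : v2 s (+) v2 (map sg s) = false by case: (v2 s) (v2 (map sg s)) E => -[].
    have Ey : del yb s (+) del yb (map sg s) = del y s.
      rewrite del_map -del_add; apply: del_ext => l ls sl; rewrite /cadd /yb.
      have Il : forall x, inl x l -> I x by move=> x /ls/Is.
      rewrite asboolT // asboolT; last by apply: all_map Il; apply: SI.
      have E : y (map sg l) = y l.
        by apply: (yi' l ls _ sg (or_introl erefl)); move: sl; rewrite sn => -[].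
      case: l ls sl Il E => [|x l] ls sl Il /= E; first by rewrite y0.
      rewrite E epsS; first by case: (eps x); rewrite /= ?addbF.
      by apply/IX/Il; left.
    have EC : hmul eps C s (+) hmul eps C (map sg s) = C s.
      have := Ci' sn sg (or_introl erefl).
      case: s Is sn {yc' Ci' yi' Ey} => // x s Is sn; rewrite /hmul /= => ->.
      rewrite epsS; first by case: (eps x); rewrite /= ?addbF.
      by apply/IX/Is; left.
    have := yc' sn; rewrite -Ey /w /v2 /cadd -EC.
    move: (v s) (v (map sg s)) (hmul eps C s) (hmul eps C (map sg s)) (del yb s) (del yb (map sg s)).
    by do 6!case.
  have symX := @ev_restrict I X _ sym.
  have v2iX := @ev_restrict A X _ v2i.
  have v2iS := ev_map isoS SX v2iX.
  have Vi : inv G X m.+1 V.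
    move: (ev_and cover symX) (ev_and v2iX v2iS).
    apply: ev_imp2 => s Xs [cov sy] [vi1 vi2] sn k [<-|kK].
      rewrite /V; case: asboolP => [Ass|nAss]; case: asboolP => [As|nAs] //.
      - apply: sy => // x xs; split; first exact: As.
        by apply: Ass; apply: map_inl.
      - by rewrite map_SS.
      - case: cov => // As; exfalso; apply: nAss => x xs.
        by have [z zs ->] := inl_map xs; apply: As.
    have E : (forall x, inl x (map k s) -> A x) <-> (forall x, inl x s -> A x).
      split=> H1 x xs.
        by apply/(KA kK); [apply/Xs|apply/H1/map_inl].
      by have [z zs ->] := inl_map xs; apply/KA; [|apply/Xs|apply: H1].
    rewrite /V (asbool_iff E); case: asboolP => As; first exact: vi1.
    rewrite map_SK // vi2 ?size_map // => x xs.
    case: cov => // As'; have [z zs ->] := inl_map xs; exact: As'.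
  exists V; split=> //.
    by rewrite /V asboolT // /v2 /cadd v0.
  have HL : cocyc G X m.+2 (cadd u (hst eps C)).
    by apply: cocyc_add => //; apply: cocyc_hst => //; apply: sgn_eps.
  have main : ev X (fun s => (forall x, inl x s -> A x) -> size s = m.+2 ->
       cadd u (hst eps C) s = del V s).
    move: (@ev_restrict A X _ vc) Cc; apply: ev_imp2 => s Xs vc' Cc' As sn.
    have -> : del V s = del v2 s.
      by apply: del_ext => l ls _; rewrite /V asboolT // => x /ls/As.
    rewrite /v2 !del_add del_del del_hmul // addbF -vc' //.
    rewrite /cadd; congr (_ (+) _).
    by case: s Xs As sn {vc'} Cc' => // x s _ _ sn Cc'; rewrite /hmul Cc' // andbF addbF.
  move: (ev_and cover main) (ev_and (ev_map isoS SX main) (ev_and (inv_del Vi) (let: And3 _ a _ := HL in a))).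
  apply: ev_imp2 => s Xs [cov m1] [m2 [Vi' Li]] sn.
  case: cov => As; first exact: m1.
  rewrite -(Li sn sg (or_introl erefl)) -(Vi' sn sg (or_introl erefl)).
  apply: m2; last by rewrite size_map.
  by move=> x xs; have [z zs ->] := inl_map xs; apply: As.
(* For independence, restrict to [A] first: there [eps] is invariant under [K], multiples of [h]
   die, and only the coefficient of [e_ m] is left. *)
move=> [|m] psi [V [V0 Vi Vc]] b //.
set C := comb eps e_ rho m psi.
have HC : cocyc G X m C by apply: cocyc_comb => //; apply: sgn_eps.
have psim : psi m && (m < rho)%N = false.
  apply/negP => /andP[pm mr]; apply: (InA m mr).
  have H1 : exact K A m.+1 (comb eps e_ rho m.+1 psi).
    by apply: (exact_sub AX); apply: (@exact_consr _ _ sg); exists V.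
  have H2 : exact K A m.+1 (hst eps C).
    apply: exact_hst_inv; first by move=> k kK x Ax; apply: epsK (AX Ax).
    exact: cocyc_sub AX (cocyc_consr HC).
  apply: exact_eqf (exact_add H1 H2) => s _; rewrite /cadd /= /cadd pm mr /=.
  by rewrite addbC addbA addbb.
rewrite ltnS leq_eqVlt => /orP[/eqP->|bm] br; first by rewrite br andbT in psim.
rewrite addnS ltnS => mbJ.
case: m @C HC psim bm mbJ Vi Vc => // m C HC psim bm mbJ Vi Vc.
have [C0 Ci Cc] := HC.
(* Now [h C = del V], so [eps C + V] is a [K]-cocycle on [A]. Adding its translate on [I] cancels
   the invariant terms [V] and [e_ m] and leaves [C], which is therefore exact on [I]. *)
have [kp [y [y0 yi yc]]] : exists kp : bool, exact K A m.+1 (cadd (cadd (hmul eps C) V) (fun s => (kp && (m < rho)%N) && e_ m s)).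
  apply: SpA; split; first by rewrite /cadd V0.
    apply: inv_add; last exact: inv_sub AX (inv_consr Vi).
    apply: inv_hmul; first by move=> k kK x Ax; apply: epsK (AX Ax).
    exact: inv_sub AX (inv_consr Ci).
  move: (ev_sub AX Vc) (ev_sub AX Cc); apply: ev_imp2 => s As Vc' Cc' sn.
  rewrite del_add del_hmul // -Vc' //.
  have -> : comb eps e_ rho m.+2 psi s = hst eps C s.
    transitivity (hst eps C s (+) ((psi m.+1 && (m.+1 < rho)%N) && e_ m.+1 s)) => //.
    by rewrite psim andFb addbF.
  have -> : hmul eps (del C) s = false.
    by case: s As sn Vc' Cc' => // x s As sn Vc' Cc'; rewrite /hmul Cc' ?andbF.
  by rewrite addbF addbb.
apply: (InI m.+1 psi) => //.
exists (fun s => y s (+) y (map sg s)); split; [by rewrite /= y0|exact: inv_tr|].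
have [_ ei _] := e_c m.
have ycS := ev_map isoS (fun x (Ix : I x) => IA (SI Ix)) yc.
move: (ev_and (ev_sub IA yc) ycS) (ev_and (ev_sub IX ei) (ev_and (ev_sub IX Vi) (ev_sub IX Ci))).
apply: ev_imp2 => s Is [yc1 yc2] [ei' [Vi' Ci']] sn.
have -> : del (fun s0 => y s0 (+) y (map sg s0)) s = del (cadd y (fun l => y (map sg l))) s by apply: del_ext.
rewrite del_add -del_map -yc1 // -yc2 ?size_map //.
rewrite /cadd (ei' sn sg (or_introl erefl)) (Vi' sn sg (or_introl erefl)).
have := Ci' sn sg (or_introl erefl).
case: s Is sn {yc1 yc2 ei' Vi' Ci'} => // x s Is sn /= => ->; rewrite epsS; last by apply/IX/Is; left.
rewrite -[LHS]/(C (x :: s)).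
move: (C _) (V _) (e_ _ _) (kp && _) (eps x); bsolve.
Qed.
End Step.

(** * Bundles over a sphere *)

Section Cube.
Variables (R : realType) (q : nat).
Implicit Types (x : 'rV[R]_q) (e d t : R).

Definition vnear e x x' := forall i, `|x 0 i - x' 0 i| < e.

(* The unit sphere of the sup norm on the span of the first [J] coordinates. *)
Definition cube J x := [/\ forall i, `|x 0 i| <= 1, exists i, `|x 0 i| = 1 &
  forall i : 'I_q, (J <= i)%N -> x 0 i = 0].

Lemma cubeN J x : cube J x -> cube J (- x).
Proof.
case=> x1 [i xi] x0; split=> [j||j Jj]; first by rewrite mxE normrN.
  by exists i; rewrite mxE normrN.
by rewrite mxE x0 // oppr0.
Qed.

Lemma cube_le J J' x : (J <= J')%N -> cube J x -> cube J' x.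
Proof. by move=> JJ' [x1 xi x0]; split=> // i Ji; apply/x0/(leq_trans JJ'). Qed.

(** Soft thresholding. It is odd and nonexpansive, and on a bounded interval finitely many
    iterations reach 0 exactly. *)
Definition shr d t : R := if d < t then t - d else if t < - d then t + d else 0.

Lemma shrN d t : 0 < d -> shr d (- t) = - shr d t.
Proof. rewrite /shr => d0; case: (ltP d (- t)); case: (ltP d t); case: (ltP (- t) (- d)); case: (ltP t (- d)); lra. Qed.

Lemma shr_lip d s t : 0 < d -> `|shr d s - shr d t| <= `|s - t|.
Proof.
rewrite /shr => d0.
have := ler_norm (s - t); have := ler_norm (- (s - t)); rewrite normrN => a b.
rewrite ler_norml.
case: (ltP d s); case: (ltP d t); case: (ltP s (- d)); case: (ltP t (- d)) => *; apply/andP; split; lra.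
Qed.

Lemma shr_near d t : 0 < d -> `|shr d t - t| <= d.
Proof. move=> d0; rewrite /shr ler_norml; case: (ltP d t); case: (ltP t (- d)) => *; apply/andP; split; lra. Qed.

Lemma shr_le d t b : 0 < d -> 0 <= b -> `|t| <= b + d -> `|shr d t| <= b.
Proof. move=> d0 b0; rewrite /shr !ler_norml => /andP[]; case: (ltP d t); case: (ltP t (- d)) => *; apply/andP; split; lra. Qed.

Lemma shr_le1 d t : 0 < d -> `|t| <= 1 -> `|shr d t| <= 1.
Proof. by move=> d0 t1; apply: shr_le => //; lra. Qed.

Lemma shr0 d : 0 < d -> shr d 0 = 0.
Proof. rewrite /shr => d0; case: ltP; case: ltP; lra. Qed.

Lemma iter_shr d n t : 0 < d -> `|t| <= n%:R * d -> iter n (shr d) t = 0.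
Proof.
move=> d0; elim: n t => [|n IH] t; first by rewrite mul0r normr_le0 => /eqP.
move=> tn; rewrite iterSr IH //; apply: shr_le => //.
  by rewrite mulr_ge0 // ltW.
by move: tn; rewrite -natr1 mulrDl mul1r.
Qed.

Definition rais d t : R := Num.min 1 (t + d).

Lemma rais_lip d s t : `|rais d s - rais d t| <= `|s - t|.
Proof.
have := ler_norm (s - t); have := ler_norm (- (s - t)); rewrite normrN => a b.
rewrite ler_norml /rais; case: (leP 1 (s + d)); case: (leP 1 (t + d)) => *; apply/andP; split; lra.
Qed.

Lemma iter_rais d n t : 0 < d -> t <= 1 -> iter n (rais d) t = Num.min 1 (t + n%:R * d).
Proof.
move=> d0 t1; elim: n => [|n IH]; first by rewrite mul0r addr0 /= /Num.min; case: ltP => //; lra.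
rewrite iterS IH -natr1 mulrDl mul1r /rais.
move: (n%:R * d) => a; case: (leP 1 (t + a)) => h; case: (leP 1 (t + (a + d))) => h'.
- by case: (leP 1 _) => h''; lra.
- lra.
- by case: (leP 1 _) => h''; lra.
- by case: (leP 1 _) => h''; lra.
Qed.

Definition coordmap (P : pred 'I_q) (f : R -> R) x : 'rV[R]_q :=
  \row_i if P i then f (x 0 i) else x 0 i.

Lemma iter_coordmap P f n x : iter n (coordmap P f) x = coordmap P (iter n f) x.
Proof.
elim: n => [|n IH]; apply/rowP=> i; first by rewrite mxE if_same.
by rewrite iterS IH /coordmap !mxE; case: (P i).
Qed.

Definition nonexp (f : 'rV[R]_q -> 'rV[R]_q) := forall e x x', vnear e x x' -> vnear e (f x) (f x').

Lemma coordmap_nonexp P f : (forall s t, `|f s - f t| <= `|s - t|) -> nonexp (coordmap P f).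
Proof.
by move=> lf e x x' nx i; rewrite !mxE; case: ifP => _ //; apply: le_lt_trans (lf _ _) (nx i).
Qed.

Lemma archi_ex (d b : R) : 0 < d -> exists n, b <= n%:R * d.
Proof.
move=> d0; exists (Num.bound `|b / d|); rewrite -ler_pdivrMr //.
by apply: le_trans (ler_norm _) (ltW (archi_boundP (normr_ge0 _))).
Qed.
End Cube.

Section Total.
Variables (R : realType) (q : nat) (Y : uspace R).

Definition tnear (e : R) (m m' : 'rV[R]_q * Y) := vnear e m.1 m'.1 /\ near e m.2 m'.2.

Lemma tnear_refl e m : 0 < e -> tnear e m m.
Proof. by move=> e0; split=> [i|]; [rewrite subrr normr0|apply: near_refl]. Qed.
Lemma tnear_sym e m m' : tnear e m m' -> tnear e m' m.
Proof. by move=> [a b]; split=> [i|]; [rewrite distrC|apply: near_sym]. Qed.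
Lemma tnear_tri e e' m1 m2 m3 : tnear e m1 m2 -> tnear e' m2 m3 -> tnear (e + e') m1 m3.
Proof.
move=> [a b] [a' b']; split=> [i|]; last exact: near_tri b b'.
by apply: le_lt_trans (ler_distD (m2.1 0 i) _ _) _; apply: ltrD.
Qed.
Lemma tnear_mono e e' m m' : e <= e' -> tnear e m m' -> tnear e' m m'.
Proof. by move=> ee [a b]; split=> [i|]; [apply: lt_le_trans (a i) ee|apply: near_mono b]. Qed.
Definition tot := Uspace tnear_refl tnear_sym tnear_tri tnear_mono.

Variables (X : tot -> Prop) (sY : Y -> Y) (KY : seq (Y -> Y)).
Definition tsg (m : tot) : tot := (- m.1, sY m.2).
Definition fibmap (k : Y -> Y) (m : tot) : tot := (m.1, k m.2).
Definition tK := map fibmap KY.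

Definition over (D : 'rV[R]_q -> Prop) (m : tot) := X m /\ D m.1.

Hypothesis XB : forall m, X m -> cube q m.1.
Hypothesis isoY : isom sY.
Hypothesis XS : forall m, X m -> X (tsg m).
Hypothesis XK : forall k, inl k KY -> forall m, X m -> X (fibmap k m).
Hypothesis sYK : forall y, sY (sY y) = y.
Hypothesis sYC : forall k, inl k KY -> forall y, sY (k y) = k (sY y).

(* Small base motions lift to the total space. *)
Hypothesis lift : forall e : R, 0 < e -> exists2 d : R, 0 < d &
  forall (D : 'rV[R]_q -> Prop) phi, nonexp phi -> (forall x, D x -> cube q x) ->
    (forall x, D x -> D (phi x)) -> (forall x, D x -> vnear d (phi x) x) ->
    exists Phi : tot -> Y, let F := fun m => (phi m.1, Phi m) : tot in
    [/\ forall m, over D m -> X (F m), @ucont _ tot tot (over D) F,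
        forall k, inl k KY -> forall m, over D m -> F (fibmap k m) = fibmap k (F m),
        forall m, over D m -> near e m (F m) &
        forall m, over D m -> D (- m.1) -> phi (- m.1) = - phi m.1 -> F (tsg m) = tsg (F m)].

(** A small nonexpansive base motion is lifted one iteration at a time. The flag [sym] selects
    between the full group and the subgroup acting inside the fibres, which is all that preserves a
    hemisphere. *)
Lemma deform_base (sym : bool) (D D' : 'rV[R]_q -> Prop) :
  (forall x, D' x -> D x) -> (forall x, D x -> cube q x) ->
  (sym -> forall x, D x -> D (- x)) ->
  (forall d : R, 0 < d -> exists phi, [/\ nonexp phi, forall x, D x -> D (phi x),
     forall x, D x -> vnear d (phi x) x,
     sym -> forall x, D x -> phi (- x) = - phi x &
     exists n, forall x, D x -> D' (iter n phi x)]) ->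
  @deform _ tot (if sym then tsg :: tK else tK) (over D) (over D').
Proof.
move=> D'D DB symD Hphi; split=> [m [Xm /D'D]|e e0] //.
have [d d0 /(_ D) Hd] := lift e0; have [phi [nphi phiD phin phis [n phiD']]] := Hphi d d0.
have [Phi /= [FX uF FK nF FS]] := Hd phi nphi DB phiD phin.
set F := fun m => _ in FX uF FK nF FS.
have FD m : over D m -> over D (F m) by move=> Dm; split; [apply: FX|apply: phiD; case: Dm].
have gF : good (if sym then tsg :: tK else tK) (over D) F.
  split=> // k kK m Dm.
  have {kK} [[Es ->]|kK] : (sym /\ k = tsg) \/ inl k tK.
    by case: (sym) kK => [[<-|]|]; [left|right|right].
    by have [_ Dm2] := Dm; exact: (FS m Dm (symD Es _ Dm2) (phis Es _ Dm2)).
  by have [k' k'K ->] := inl_map kK; exact: (FK k' k'K m Dm).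
exists (iter n F); first exact: linked_iter.
move=> m Dm.
have E k : (iter k F m).1 = iter k phi m.1.
  by elim: k => //= k <-.
split; last by rewrite E; apply: phiD'; case: Dm.
suff : over D (iter n F m) by case.
by elim: n {phiD' E} => //= n IH; apply: FD.
Qed.

Variables (eps : tot -> bool) (e_ : nat -> seq tot -> bool) (rho : nat).
Hypothesis epsS : forall m, X m -> eps (tsg m) = ~~ eps m.
Hypothesis epsK : invf tK X eps.
Hypothesis e_c : forall b, cocyc (tsg :: tK) X b.+1 (e_ b).

Lemma overX D m : over D m -> X m. Proof. by case. Qed.

Lemma eps_sgn D : sgnf (tsg :: tK) (over D) eps.
Proof.
move=> k [<-|kK] x y [Xx _] [Xy _]; last by rewrite !epsK.
by rewrite !epsS // addNb addbN negbK.
Qed.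

Lemma e_cO D b : cocyc (tsg :: tK) (over D) b.+1 (e_ b).
Proof. by apply: cocyc_sub (e_c b); apply: overX. Qed.

(** Raising [x_j] alone stays on the sup norm sphere: some coordinate keeps modulus one, because
    [x_j = -1] is ruled out. On a cubical sphere all motions act coordinatewise in this way. *)
Lemma deform_pole (j : 'I_q) :
  deform tK (over (fun x => cube j.+1 x /\ - (1 / 2%:R) < x 0 j))
            (over (fun x => cube j.+1 x /\ x 0 j = 1)).
Proof.
apply: (@deform_base false) => // [x [Bx ->]|x [Bx _]|d d0]; first by split=> //; lra.
  exact: cube_le Bx.
exists (coordmap (pred1 j) (rais (d / 2%:R))); have d2 : 0 < d / 2%:R by rewrite divr_gt0.
split=> //.
- by apply: coordmap_nonexp => s t; apply: rais_lip.
- move=> x [[x1 [i xi] x0] xj]; have := x1 j; rewrite ler_norml => /andP[xj1 xj2].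
  split; last first.
    by rewrite mxE /= eqxx /rais; case: (leP 1 _) => ?; lra.
  split=> [k||k jk].
  + rewrite mxE /=; case: eqP => [->|_]; last exact: x1.
    by rewrite /rais ler_norml; case: (leP 1 _) => ?; apply/andP; split; lra.
  + exists i; rewrite mxE /=; case: eqP => [E|//]; subst i.
    have xj3 : x 0 j = 1.
      by move: xi; case: (ger0P (x 0 j)) => ? ?; lra.
    by rewrite xj3 /rais; case: (leP 1 _) => ?; [rewrite normr1|lra].
  + by rewrite mxE /=; case: eqP => [E|_]; [rewrite E ltnn in jk|apply: x0].
- move=> x [[x1 _ _] _] i; rewrite mxE /=; case: eqP => [->|_]; last by rewrite subrr normr0.
  have := x1 j; rewrite ler_norml => /andP[xj1 xj2].
  by rewrite /rais ltr_norml; case: (leP 1 _) => ?; apply/andP; split; lra.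
have [n nd] := archi_ex 2%:R d2; exists n => x [Bx xj].
rewrite iter_coordmap; have [x1 [i xi] x0] := Bx.
have := x1 j; rewrite ler_norml => /andP[xj1 xj2].
have E : iter n (rais (d / 2%:R)) (x 0 j) = 1.
  by rewrite iter_rais //; case: (leP 1 _) => // ?; lra.
split; last by rewrite mxE /= eqxx.
split=> [k||k jk].
- by rewrite mxE /=; case: eqP => [->|_]; [rewrite E normr1|].
- by exists j; rewrite mxE /= eqxx E normr1.
- by rewrite mxE /=; case: eqP => [E'|_]; [rewrite E' ltnn in jk|apply: x0].
Qed.

Lemma deform_pole2 (j : 'I_q) :
  deform tK (over (fun x => cube j.+1 x /\ x 0 j = 1)) (over (fun x => x = delta_mx 0 j)).
Proof.
apply: (@deform_base false) => // [x ->|x [Bx _]|d d0].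
- split; last by rewrite mxE !eqxx.
  split=> [i||i ji]; first by rewrite mxE eqxx; case: eqP => _; rewrite ?normr0 ?normr1.
    by exists j; rewrite mxE !eqxx normr1.
  by rewrite mxE eqxx; case: eqP => [E|//]; rewrite E ltnn in ji.
- exact: cube_le Bx.
have d2 : 0 < d / 2%:R by rewrite divr_gt0.
exists (coordmap (predC1 j) (shr (d / 2%:R))).
split=> //.
- by apply: coordmap_nonexp => s t; apply: shr_lip.
- move=> x [[x1 _ x0] xj]; split; last by rewrite mxE /= eqxx.
  split=> [k||k jk].
  + by rewrite mxE /=; case: eqP => _ /=; [apply: x1|apply: shr_le1].
  + by exists j; rewrite mxE /= eqxx /= xj normr1.
  + by rewrite mxE /= x0 // shr0 // if_same.
- move=> x _ i; rewrite mxE /=; case: eqP => _ /=; first by rewrite subrr normr0.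
  by apply: le_lt_trans (shr_near _ d2) _; lra.
have [n nd] := archi_ex 1 d2; exists n => x [[x1 _ x0] xj].
rewrite iter_coordmap; apply/rowP=> i; rewrite !mxE /=.
case: eqP => [->|_] /=; first by rewrite xj.
by rewrite iter_shr // (le_trans (x1 i)).
Qed.

(** In the band the coordinate of modulus one is not [x_j], so [x_j] can be shrunk to 0; the motion
    is odd and hence compatible with [tsg]. *)
Lemma deform_band (j : 'I_q) :
  deform (tsg :: tK) (over (fun x => cube j.+1 x /\ `|x 0 j| < 1 / 2%:R)) (over (cube j)).
Proof.
apply: (@deform_base true) => // [x Bx|x [Bx _]|_ x [Bx xj]|d d0].
- split; first exact: cube_le Bx.
  by have [_ _ ->] := Bx; rewrite ?normr0 //; lra.
- exact: cube_le Bx.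
- by split; [apply: cubeN|rewrite mxE normrN].
have d2 : 0 < d / 2%:R by rewrite divr_gt0.
exists (coordmap (pred1 j) (shr (d / 2%:R))); split.
- by apply: coordmap_nonexp => s t; apply: shr_lip.
- move=> x [[x1 [i xi] x0] xj]; split; last first.
    by rewrite mxE /= eqxx; apply: le_lt_trans xj; have := @shr_lip _ _ (x 0 j) 0 d2; rewrite shr0 // !subr0.
  split=> [k||k jk].
  + by rewrite mxE /=; case: eqP => _; [apply: shr_le1|apply: x1].
  + exists i; rewrite mxE /=; case: eqP => [E|//].
    by move: xj; rewrite -E xi => ?; lra.
  + by rewrite mxE /= x0 // shr0 // if_same.
- move=> x _ i; rewrite mxE /=; case: eqP => _ /=; last by rewrite subrr normr0.
  by apply: le_lt_trans (shr_near _ d2) _; lra.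
- by move=> _ x _; apply/rowP=> i; rewrite !mxE /=; case: eqP => // _; rewrite shrN.
have [n nd] := archi_ex 1 d2; exists n => x [[x1 [i xi] x0] xj].
rewrite iter_coordmap; split=> [k||k jk].
- rewrite mxE /=; case: eqP => _ //; rewrite iter_shr ?normr0 //.
  by apply: le_trans (x1 k) _.
- exists i; rewrite mxE /=; case: eqP => [E|//].
  by move: xj; rewrite -E xi => ?; lra.
- rewrite mxE /=; case: eqP => [->|/eqP E].
    by rewrite iter_shr // (le_trans (x1 j)).
  by apply: x0; rewrite ltn_neqAle eq_sym E.
Qed.

(** Induction on [J] by [step], with [A] the part over [x_j > -1/2]. It deforms to the fibre over a
    pole, and its overlap with its image under [tsg] deforms to the part over the previous sphere.
    The induction starts from the empty set. *)
Theorem cube_basis :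
  (forall j : 'I_q, fbasis e_ rho tK (over (fun x => x = delta_mx 0 j))) ->
  forall J, (J <= q)%N -> basis eps e_ rho (tsg :: tK) (over (cube J)) J.
Proof.
move=> Hf; elim=> [_|J IH Jq].
  have B0 m : ~ over (cube 0) m.
    by case=> _ [_ [i xi] x0]; move: xi; rewrite x0 // normr0 => ?; lra.
  have ev0 P : ev (over (cube 0)) (fun s => size s <> 0%N -> P s).
    by apply: ev_all => -[|m s] Xs // _; case: (B0 m); apply: Xs; left.
  split=> [n c Hc|n psi _ b bn _].
    exists (fun=> false); apply: (@exact_eq _ _ _ _ _ (fun=> false)); last exact: exact0.
    by apply: ev_imp (ev0 (fun s => false = cadd c (comb eps e_ rho n.+1 (fun=> false)) s)) => s _ H sn; apply: H; rewrite sn.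
  by rewrite addn0 leqNgt bn.
pose j := Ordinal Jq; have {}IH := IH (ltnW Jq).
pose A := over (fun x => cube j.+1 x /\ - (1 / 2%:R) < x 0 j).
have isoT : isom (tsg : tot -> tot).
  by move=> e x y [a b]; split=> [i|]; [rewrite !mxE -opprD normrN; apply: a|apply: isoY].
apply: (@step _ tot eps e_ rho J tK tsg (over (cube J.+1)) A).
- move=> k kK; have [k' k'K ->] := inl_map kK => x [Xx Bx]; rewrite /A /over /=.
  by split=> -[_ ?]; split=> //; apply: (XK k'K).
- by [].
- by move=> x [Xx Bx]; split; [apply: XS|apply: cubeN].
- by move=> [x y] _; rewrite /tsg /= opprK sYK.
- by move=> k kK; have [k' k'K ->] := inl_map kK => -[x y] _; rewrite /tsg /fibmap /= sYC.
- by move=> x [Xx [Bx _]].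
- exists (1 / 2%:R); first by lra.
  move=> [|m s] ss; first by left.
  have Xs x : inl x (m :: s) -> X x /\ cube J.+1 x.1 by move=> /ss[[]].
  have nx x : inl x (m :: s) -> `|m.1 0 j - x.1 0 j| < 1 / 2%:R.
    by move=> xs; have [_ /(_ x xs) [/(_ j)]] := ss m (or_introl erefl).
  case: (leP 0 (m.1 0 j)) => h; [left|right] => x xs; have := nx x xs; rewrite ltr_norml => /andP[a b].
    by have [Xx Bx] := Xs x xs; split=> //=; split=> //; lra.
  have [Xx Bx] := Xs x xs; split; first exact: XS.
  by split; [apply: cubeN|rewrite mxE; lra].
- by move=> m [Xm _]; apply: epsS.
- by move=> k kK x [Xx _]; apply: epsK.
- exact: e_cO.
- have eK b D : cocyc tK (over D) b.+1 (e_ b) by apply: cocyc_consr (e_cO _ _).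
  apply: fbasis_deform (deform_pole j) _ => [b|]; first exact: eK.
  by apply: fbasis_deform (deform_pole2 j) _ => [b|]; [exact: eK|exact: Hf].
have -> : (fun x => A x /\ A (tsg x)) = over (fun x => cube j.+1 x /\ `|x 0 j| < 1 / 2%:R).
  apply/funext => m; apply/propext; rewrite /A /over /= ltr_norml mxE; split.
    by move=> [[Xm [Bm m1]] [_ [_ m2]]]; do 2!split=> //; apply/andP; split; lra.
  move=> [Xm [Bm /andP[m1 m2]]]; split; split=> //; first exact: XS.
  by split; [apply: cubeN|lra].
by apply: basis_deform (deform_band j) IH; [exact: eps_sgn|move=> b; exact: e_cO].
Qed.
End Total.

(** * Products of degree one classes *)

Section Powers.
Variables (R : realType) (M : uspace R).
Implicit Types (X : M -> Prop) (K : seq (M -> M)) (c b : seq M -> bool)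
  (e h : M -> bool) (n m : nat).

Definition one : seq M -> bool := fun s => size s == 1%N.

Lemma cocyc_one K X : cocyc K X 1 one.
Proof.
split=> //; apply: ev_all => s _; first by move=> _ k _; rewrite /one size_map.
by case: s => [|x [|y [|]]].
Qed.

Lemma hst_add e c b : hst e (cadd c b) = cadd (hst e c) (hst e b).
Proof. by apply/funext => -[|x [|y s]] //; rewrite /hst /cadd andb_addr. Qed.

Lemma hst_addl e h c : hst (fun x => e x (+) h x) c = cadd (hst e c) (hst h c).
Proof.
apply/funext => -[|x [|y s]] //; rewrite /hst /cadd.
move: (e x) (e y) (h x) (h y) (c _); bsolve.
Qed.

Lemma hst0 e : hst e (fun=> false) = fun=> false.
Proof. by apply/funext => -[|x [|y s]] //; rewrite /hst andbF. Qed.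

Lemma hst_scale e (k : bool) c : hst e (fun s => k && c s) = fun s => k && hst e c s.
Proof. by case: k => //; rewrite hst0. Qed.

Lemma iter_hst_add e c b n :
  iter n (hst e) (cadd c b) = cadd (iter n (hst e) c) (iter n (hst e) b).
Proof. by elim: n => //= n ->; rewrite hst_add. Qed.

Lemma cocyc_iter K X e n m c : sgnf K X e -> cocyc K X m c ->
  cocyc K X (n + m) (iter n (hst e) c).
Proof. by move=> He Hc; elim: n => //= n IH; apply: cocyc_hst. Qed.

Lemma exact_iter K X e n m c : sgnf K X e -> exact K X m c ->
  exact K X (n + m) (iter n (hst e) c).
Proof. by move=> He Hc; elim: n => //= n IH; apply: exact_hst. Qed.

Definition eqsgn K X e h := forall k, inl k K -> forall x, X x ->
  e (k x) (+) h (k x) = e x (+) h x.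

Lemma iter_sgn K X e h n m c : sgnf K X e -> sgnf K X h -> eqsgn K X e h ->
  cocyc K X m c -> exact K X (n + m) (cadd (iter n (hst e) c) (iter n (hst h) c)).
Proof.
move=> He Hh Heh Hc; elim: n => [|n IH].
  by apply: exact_eqf (exact0 K X _) => s _; rewrite /cadd addbb.
apply: (@exact_trans _ _ _ _ _ _ (hst e (iter n (hst h) c))).
  by have := exact_hst He IH; rewrite hst_add.
by apply: exact_hst_sgn => //; apply: cocyc_iter.
Qed.

Lemma iter_hstC K X e h n m c : sgnf K X e -> sgnf K X h -> cocyc K X m c ->
  exact K X (n + m).+1 (cadd (hst h (iter n (hst e) c)) (iter n (hst e) (hst h c))).
Proof.
move=> He Hh Hc; elim: n => [|n IH].
  by apply: exact_eqf (exact0 K X _) => s _; rewrite /cadd addbb.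
apply: (@exact_trans _ _ _ _ _ _ (hst e (hst h (iter n (hst e) c)))).
  by apply: exact_hstC => //; apply: cocyc_iter.
by have := exact_hst He IH; rewrite hst_add.
Qed.

Definition hprod (es : seq (M -> bool)) c := foldr (fun e => hst e) c es.

(** Each factor is evaluated as a difference along some edge of the tuple, and the difference of a
    constant function is 0. *)
Lemma hprod_const es c e s : inl e es ->
  (forall x y, inl x s -> inl y s -> e x = e y) -> hprod es c s = false.
Proof.
elim: es s => //= h es IH s [->|ees] Hs.
  case: s Hs => [|x [|y s]] Hs //; rewrite /hst (Hs x y) ?addbb //; first by left.
  by right; left.
case: s Hs => [|x [|y s]] Hs //; rewrite /hst IH ?andbF //.
by move=> z z' zs zs'; apply: Hs; right.
Qed.

Definition fcont X (phi : M -> R) := forall e : R, 0 < e -> exists2 d : R, 0 < d &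
  forall x y, X x -> X y -> near d x y -> `|phi x - phi y| < e.

Definition character K X (phi : M -> R) e := forall k, inl k K -> forall x, X x ->
  (phi (k x) = phi x /\ e (k x) = e x) \/ (phi (k x) = - phi x /\ e (k x) = ~~ e x).

(* If functions transforming under given characters have no common zero, the product of the
   corresponding degree one classes vanishes. *)
Lemma hprod_exact K X (ps : seq ((M -> R) * (M -> bool))) n c :
  (forall pr, inl pr ps -> [/\ fcont X pr.1, sgnf K X pr.2 & character K X pr.1 pr.2]) ->
  (exists2 a : R, 0 < a & forall x, X x -> exists2 pr, inl pr ps & a <= `|pr.1 x|) ->
  cocyc K X n c -> exact K X (size ps + n) (hprod (map snd ps) c).
Proof.
move=> Hps [a a0 Ha] Hc.
(* [th] is the sign of the function, completed by [pr.2] on its zeros. It has the character of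
   [pr.2], hence gives the same class, and it is constant on small tuples at a point where the
   function has modulus at least [a]. *)
pose th (pr : (M -> R) * (M -> bool)) x := if pr.1 x == 0 then pr.2 x else pr.1 x < 0.
have sth pr : inl pr ps -> sgnf K X (th pr) /\ eqsgn K X pr.2 (th pr).
  move=> prs; have [_ sg2 ch] := Hps pr prs; have Hk k : inl k K -> forall x, X x ->
      (th pr (k x) = th pr x /\ pr.2 (k x) = pr.2 x) \/ (th pr (k x) = ~~ th pr x /\ pr.2 (k x) = ~~ pr.2 x).
    move=> kK x Xx; rewrite /th; case: (ch k kK x Xx) => -[-> ->]; first by left.
    by right; rewrite oppr_eq0 oppr_lt0; case: ltgtP.
  split.
    move=> k kK x y Xx Xy.
    have Hs := sg2 k kK x y Xx Xy.
    by case: (Hk k kK x Xx) (Hk k kK y Xy) Hs => -[-> ->] [] [-> ->] //;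
      rewrite ?addbN ?addNb ?negbK //; do 2!case: (_ (+) _).
  by move=> k kK x Xx; case: (Hk k kK x Xx) => -[-> ->] //; rewrite addNb addbN negbK.
have E0 : exact K X (size ps + n) (hprod (map th ps) c).
  have small0 : ev X (fun s => hprod (map th ps) c s = false).
    have Hd : exists2 d : R, 0 < d & forall pr, inl pr ps -> forall x y, X x -> X y -> near d x y -> `|pr.1 x - pr.1 y| < a.
      elim: (ps) Hps {sth Ha} => [|pr ps' IH] Hps; first by exists 1.
      have [|d d0 Hd] := IH; first by move=> pr' pr's; apply: Hps; right.
      have [/(_ a a0)[d' d'0 Hd'] _ _] := Hps pr (or_introl erefl).
      exists (Num.min d d'); first by rewrite lt_min d0.
      move=> pr' [<-|pr's] x y Xx Xy nxy.
        by apply: Hd' => //; apply: near_mono nxy; rewrite ge_min lexx orbT.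
      by apply: Hd => //; apply: near_mono nxy; rewrite ge_min lexx.
    have [d d0 {}Hd] := Hd; exists d => // -[|x s] ss; first by have [c0 _ _] := Hc; case: (ps).
    have [Xx nx] := ss x (or_introl erefl).
    have [pr prs apr] := Ha x Xx.
    apply: (@hprod_const _ _ (th pr)); first exact: map_inl.
    suff H y : inl y (x :: s) -> th pr y = (pr.1 x < 0) by move=> y z ys zs; rewrite !H.
    move=> ys; have [Xy _] := ss y ys; have := Hd pr prs x y Xx Xy (nx y ys).
    rewrite /th => h; have y0 : pr.1 y != 0.
      by apply/eqP => y0; move: h; rewrite y0 subr0; lra.
    rewrite (negPf y0); move: apr h; rewrite ltr_norml => + /andP[h1 h2].
    case: (ltrP (pr.1 y) 0) => hy; case: (ltrP (pr.1 x) 0) => hx //.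
      by rewrite ger0_norm // => h3; exfalso; lra.
    by rewrite ltr0_norm // => h3; exfalso; lra.
  by apply: exact_eq (exact0 K X _); apply: ev_imp small0 => s _ ->.
apply: exact_cancel E0; elim: ps Hps sth {Ha} => [|pr ps IH] Hps sth.
  by apply: exact_eqf (exact0 K X _) => s _; rewrite /cadd addbb.
have {}IH : exact K X (size ps + n) (cadd (hprod (map snd ps) c) (hprod (map th ps) c)).
  by apply: IH => pr' pr's; [apply: Hps|apply: sth]; right.
have [_ s1 _] := Hps pr (or_introl erefl); have [s2 s12] := sth pr (or_introl erefl).
have Hc' : cocyc K X (size ps + n) (hprod (map th ps) c).
  elim: (ps) Hps sth {IH} => //= pr' ps' IH Hps sth.
  apply: cocyc_hst; first by case: (sth pr' (or_intror (or_introl erefl))).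
  by apply: IH => pr'' [<-|pr's]; [apply: Hps; left|apply: Hps; right; right|apply: sth; left|apply: sth; right; right].
apply: (@exact_trans _ _ _ _ _ _ (hst pr.2 (hprod (map th ps) c))).
  by have := exact_hst s1 IH; rewrite hst_add.
exact: exact_hst_sgn.
Qed.
End Powers.

(** * Spheres *)

(** The fibre classes of a point: the unit and nothing else, whence [rho = 1] in its uses. *)
Definition pt_class (R : realType) (M : uspace R) (b : nat) : seq M -> bool :=
  if b == 0%N then @one R M else fun=> false.

Section Point.
Variables (R : realType) (M : uspace R) (p : M).
Let P x := x = p.

Lemma cocyc_pt_class (N : uspace R) K (X : N -> Prop) b : cocyc K X b.+1 (@pt_class R N b).
Proof. by rewrite /pt_class; case: eqP => [->|_]; [apply: cocyc_one|apply: cocyc0]. Qed.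

Lemma seq_pt (s : seq M) : (forall x, inl x s -> P x) -> s = nseq (size s) p.
Proof.
elim: s => //= x s IH H; rewrite -IH; first by rewrite (H x) //; left.
by move=> y ys; apply: H; right.
Qed.

Lemma del_const (k : bool) (s : seq M) : del (fun=> k) s = k && odd (size s).
Proof. by elim: s => [|x s IH] /=; [rewrite andbF|rewrite IH; case: (odd _); case: (k)]. Qed.

Lemma fbasis_pt : fbasis (@pt_class R M) 1 [::] P.
Proof.
split=> [n c [c0 _ cc]|[|n] // _ [b [b0 _ [e e0 H]]]]; last first.
  have := H [:: p]; rewrite /= b0; move=> H1; suff: true = false by [].
  by apply: H1 => // x [<-|//]; split=> // y [<-|//]; apply: near_refl.
case: n cc => [|n] cc.
  exists (c [:: p]); apply: exact_eq (exact0 _ _ _).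
  apply: ev_all => s Ps sn; rewrite (seq_pt Ps) sn /cadd /=.
  by rewrite andbT andbT addbb.
exists false; pose k := c (nseq n.+2 p).
have I (x : M) m : inl x (nseq m p) -> x = p by elim: m => //= m IH [].
(* All tuples are constant, so [del] alternates between 0 and the identity: a cocycle of positive
   degree is 0 or the coboundary of the constant [k]. *)
have parity : k && odd n.+3 = false.
  case: cc => e e0 H; rewrite -(size_nseq n.+3 p) -del_const -(H (nseq n.+3 p)).
  - apply: del_ext => l Hl sl; rewrite /k [in RHS](@seq_pt l).
      by move: sl; rewrite size_nseq => -[->].
    by move=> x /Hl; apply: I.
  - by move=> x /I ->; split=> // y /I ->; apply: near_refl.
  - by rewrite size_nseq.
exists (fun s => k && (0 < size s)%N); split; first by rewrite andbF.
  by apply: ev_all => s _ _ k' [].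
apply: ev_all => s Ps sn; rewrite /cadd /= addbF.
have -> : del (fun l => k && (0 < size l)%N) s = del (fun=> k) s.
  by apply: del_ext => l _; rewrite sn => -[->]; rewrite andbT.
rewrite del_const sn [in LHS](seq_pt Ps) sn -/k.
by move: parity => /=; case: (odd n) => /=; rewrite ?andbT // => ->.
Qed.
End Point.

Section CombLemmas.
Variables (R : realType) (M : uspace R) (eps : M -> bool) (e_ : nat -> seq M -> bool) (rho : nat).

Lemma comb_shift n k psi :
  comb eps e_ rho (k + n) (fun b => (b < n)%N && psi b) = iter k (hst eps) (comb eps e_ rho n psi).
Proof.
elim: k => [|k IH]; first by apply: comb_ext => b ->.
apply/funext => s; rewrite addSn /= -IH /cadd ltnNge leq_addl /=.
by rewrite addbF.
Qed.

Lemma comb_lone n psi : (0 < rho)%N ->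
  (forall b, (0 < b)%N -> (b <= n)%N -> (b < rho)%N -> psi b = false) ->
  comb eps e_ rho n.+1 psi = fun s => psi 0%N && iter n (hst eps) (e_ 0%N) s.
Proof.
move=> r0; elim: n => [|n IH] H.
  by apply/funext => s; rewrite /= hst0 /cadd /= r0 andbT.
have -> : comb eps e_ rho n.+2 psi = cadd (hst eps (comb eps e_ rho n.+1 psi)) (fun=> false).
  apply/funext => s; rewrite [LHS]/= /cadd /=; congr (_ (+) _).
  by case: (ltnP n.+1 rho) => h; rewrite ?andbF // H.
rewrite IH ?hst_scale; first by apply/funext => s; rewrite /cadd addbF.
by move=> b b0 bn; apply: H => //; apply: leqW.
Qed.
End CombLemmas.

Lemma comb_one (R : realType) (M : uspace R) (eps : M -> bool) n psi :
  comb eps (@pt_class R M) 1 n.+1 psi = fun s => psi 0%N && iter n (hst eps) (@one R M) s.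
Proof. by rewrite comb_lone // => -[]. Qed.

Section Sphere.
Variables (R : realType) (q : nat).

Definition usp : uspace R :=
  @Uspace R unit (fun _ _ _ => True) (fun _ _ _ => I) (fun _ _ _ => id)
    (fun _ _ _ _ _ _ _ => I) (fun _ _ _ _ _ => id).

Definition sph := tot q usp.
Definition sphX (m : sph) : Prop := cube q m.1.
Definition sphS : sph -> sph := @tsg R q usp id.

(** With a point as fibre, [cube_basis] computes the cohomology of the projective space of dimension
    [q - 1], generated by [h]. *)
Lemma sph_basis (eps : sph -> bool) : (forall m, sphX m -> eps (sphS m) = ~~ eps m) ->
  basis eps (@pt_class R sph) 1 [:: sphS] sphX q.
Proof.
move=> epsS.
have -> : sphX = over sphX (cube q).
  by apply/funext => m; apply/propext; split=> [|[]] //; split.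
apply: (@cube_basis R q usp sphX id [::]) => //.
- by move=> m; apply: cubeN.
- move=> e e0; exists e => // D phi nphi DB Dphi Hphi; exists (fun=> tt); split=> //.
  + by move=> m [_ Dm]; apply/DB/Dphi.
  + move=> e' e'0; exists e' => // x y _ _ [nxy _]; split=> //; exact: nphi.
  + by move=> m [_ Dm]; split=> // i; rewrite distrC; apply: Hphi.
  + by move=> m Dm DNm E; rewrite /tsg /= E.
- by move=> b; apply: cocyc_pt_class.
move=> j; have -> : over sphX (fun x => x = delta_mx 0 j) = (fun m => m = (delta_mx 0 j, tt)).
  apply/funext => -[x []]; apply/propext; split; first by case=> _ /= ->.
  case=> ->; split=> //; split=> [i||i]; last by rewrite leqNgt ltn_ord.
    by rewrite mxE eqxx; case: eqP => _; rewrite ?normr0 ?normr1.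
  by exists j; rewrite mxE !eqxx normr1.
exact: fbasis_pt.
Qed.

(* A form of the Borsuk-Ulam theorem. *)
Lemma sph_pow (eps : sph -> bool) n : (forall m, sphX m -> eps (sphS m) = ~~ eps m) ->
  (n < q)%N -> ~ exact [:: sphS] sphX n.+1 (iter n (hst eps) (@one R sph)).
Proof.
move=> epsS nq Hn; have [_ In] := sph_basis epsS.
have := In n.+1 (fun b => b == 0%N) _ 0%N isT isT nq; rewrite comb_one /= => H.
by have := H Hn.
Qed.

Lemma sph_sgn (eps : sph -> bool) : (forall m, sphX m -> eps (sphS m) = ~~ eps m) ->
  sgnf [:: sphS] sphX eps.
Proof. by move=> epsS k [<-|//] x y Xx Xy; rewrite !epsS // addNb addbN negbK. Qed.

(** The [q] coordinates are odd functions without a common zero. *)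
Lemma sph_pow0 (eps : sph -> bool) : (forall m, sphX m -> eps (sphS m) = ~~ eps m) ->
  exact [:: sphS] sphX q.+1 (iter q (hst eps) (@one R sph)).
Proof.
move=> epsS.
pose ps := [seq ((fun m : sph => m.1 0 i), eps) | i <- enum 'I_q].
have sps : size ps = q by rewrite size_map size_enum_ord.
have -> : iter q (hst eps) (@one R sph) = hprod (map snd ps) (@one R sph).
  have E (l : seq 'I_q) : hprod (map snd [seq ((fun m : sph => m.1 0 i), eps) | i <- l]) (@one R sph)
      = iter (size l) (hst eps) (@one R sph) by elim: l => //= i l ->.
  by rewrite /ps E size_enum_ord.
have -> : q.+1 = (size ps + 1)%N by rewrite sps addn1.
have inps i : inl ((fun m : sph => m.1 0 i), eps) ps.
  rewrite /ps; have := mem_enum 'I_q i; rewrite inE.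
  by elim: (enum _) => //= j s IH; rewrite in_cons => /orP[/eqP->|/IH]; [left|right].
apply: hprod_exact; last exact: cocyc_one.
  move=> pr prs; have [i _ ->] := inl_map prs; split; [|exact: sph_sgn|].
    by move=> e e0; exists e => // x y _ _ [nxy _]; apply: nxy.
  by move=> k [<-|//] x Xx; right; rewrite /= mxE epsS.
by exists 1 => // m [_ [i mi] _]; exists ((fun m : sph => m.1 0 i), eps); [exact: inps|rewrite /= mi].
Qed.
End Sphere.

Section Transfer.
Variables (R : realType) (N : uspace R) (rho : nat) (F : N -> Prop).
Variables (ta : N -> N) (eta : N -> bool) (f : N -> sph R rho) (g : sph R rho -> N).
Hypothesis etaT : forall x, F x -> eta (ta x) = ~~ eta x.
Hypothesis uf : ucont F f.
Hypothesis fF : forall x, F x -> sphX (f x).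
Hypothesis fT : forall x, F x -> f (ta x) = sphS (f x).
Hypothesis ug : ucont (@sphX R rho) g.
Hypothesis gF : forall m, sphX m -> F (g m).
Hypothesis gT : forall m, sphX m -> g (sphS m) = ta (g m).
Hypothesis gf : forall e x, 0 < e -> F x -> near e x (g (f x)).

(** By [gf], [g \o f] cannot be told from the identity at any scale, so a class on [F] is recovered
    from its pullback to the sphere. Nontriviality of the powers of [eta] is tested by pulling back
    along [g]. *)
Lemma fbasis_sphere : fbasis (fun b => iter b (hst eta) (@one R N)) rho [:: ta] F.
Proof.
pose eps := eta \o g.
have epsS m : sphX m -> eps (sphS m) = ~~ eps m.
  by move=> Xm; rewrite /eps /= gT // etaT //; apply: gF.
have ef : equiv [:: ta] [:: @sphS R rho] F f.
  by move=> k [<-|//]; exists (@sphS R rho); [left|].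
have eg : equiv [:: @sphS R rho] [:: ta] (@sphX R rho) g.
  by move=> k [<-|//]; exists ta; [left|].
have s1 : sgnf [:: ta] F eta.
  by move=> k [<-|//] x y Fx Fy; rewrite !etaT // addNb addbN negbK.
have s2 : sgnf [:: ta] F (eps \o f).
  move=> k [<-|//] x y Fx Fy; rewrite /= !fT // !epsS //; try exact: fF.
  by rewrite addNb addbN negbK.
have s12 : eqsgn [:: ta] F (eps \o f) eta.
  move=> k [<-|//] x Fx; rewrite /= fT // epsS ?etaT // ?addNb ?addbN ?negbK //; exact: fF.
have one_map (A B : uspace R) (h : A -> B) : (fun s => one (map h s)) = @one R A.
  by apply/funext => s; rewrite /one size_map.
have iter_map (A B : uspace R) (h : A -> B) (e : B -> bool) n :
    (fun s => iter n (hst e) (@one R B) (map h s)) = iter n (hst (e \o h)) (@one R A).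
  elim: n => [|n IH]; first exact: one_map.
  by apply/funext => s; rewrite /= hst_map IH.
have pw n : exact [:: ta] F n.+1 (cadd (iter n (hst (eps \o f)) (@one R N)) (iter n (hst eta) (@one R N))).
  by rewrite -addn1; apply: iter_sgn => //; apply: cocyc_one.
split=> [n c Hc|n nr Hn].
  have Hcg : cocyc [:: @sphS R rho] (@sphX R rho) n.+1 (fun s => c (map g s)).
    exact: (cocyc_pull ug gF eg Hc).
  have [psi] := (sph_basis epsS).1 n _ Hcg; rewrite comb_one => Hpsi.
  have H1 := exact_pull uf fF ef Hpsi.
  have [e e0 He] := @homotopy _ _ _ [:: ta] _ F _ _ _ Hc.
  have H2 : exact [:: ta] F n.+1 (cadd (fun s => c (map id s)) (fun s => c (map (g \o f) s))).
    apply: He => //.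
    - by move=> e' e'0; exists e'.
    - move=> e' e'0; have [d d0 Hd] := ug e'0; have [d' d'0 Hd'] := uf d0.
      by exists d' => // x y Fx Fy nxy; apply: Hd; [apply: fF|apply: fF|apply: Hd'].
    - by move=> x Fx; apply/gF/fF.
    - move=> k [<-|//]; exists ta; first by left.
      by move=> x Fx; rewrite /= fT // gT //; apply: fF.
    - by move=> x Fx; apply: gf.
  have H3 : exact [:: ta] F n.+1 (cadd c (fun s => psi 0%N && iter n (hst eta) (@one R N) s)).
    apply: exact_trans (exact_trans (exact_eqf _ H2) (exact_eqf _ H1)) (exact_eqf _ (exact_scale (psi 0%N) (pw n))).
    - by move=> s _; rewrite /cadd map_id.
    - move=> s _; rewrite /cadd -map_comp; congr (_ (+) _).
    - by move=> s _; rewrite /cadd andb_addr -[in LHS]iter_map.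
  have [nr|nr] := ltnP n rho.
    by exists (psi 0%N); apply: exact_eqf H3 => s _; rewrite /cadd andbT.
  exists false; apply: exact_eqf (exact_cancel H3 _) => [s _|]; first by rewrite /cadd addbF.
  apply: exact_scale; apply: exact_cancel (exact_sym (pw n)) _.
  rewrite -iter_map; apply: (exact_pull uf fF ef).
  rewrite -(subnK nr) iterD -addnS; apply: exact_iter; first exact: sph_sgn.
  exact: sph_pow0.
apply: (sph_pow epsS nr).
have := exact_pull ug gF eg Hn.
by rewrite iter_map.
Qed.
End Transfer.

Lemma iter_hst_scale (R : realType) (M : uspace R) (e : M -> bool) (k : bool) (c : seq M -> bool) n :
  iter n (hst e) (fun s => k && c s) = fun s => k && iter n (hst e) c s.
Proof. by elim: n => //= n ->; rewrite hst_scale. Qed.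

(** * Relations in the cohomology of the cone bundle *)

Section Contradiction.
Variables (R : realType) (p q rho : nat) (N : uspace R) (X : N -> Prop).
Variables (sg ta : N -> N) (eps eta : N -> bool) (sec : sph R q -> N).
Let G := [:: sg; ta].
Hypotheses (pq : (p < q)%N) (rho1 : (1 < rho)%N).
Hypothesis SX : forall x, X x -> X (sg x).
Hypothesis TX : forall x, X x -> X (ta x).
Hypothesis isoT : isom ta.
Hypothesis epsS : forall x, X x -> eps (sg x) = ~~ eps x.
Hypothesis epsT : forall x, X x -> eps (ta x) = eps x.
Hypothesis etaS : forall x, X x -> eta (sg x) = eta x.
Hypothesis etaT : forall x, X x -> eta (ta x) = ~~ eta x.
Hypothesis Hbasis : basis eps (fun b => iter b (hst eta) (@one R N)) rho G X q.
Hypothesis Hp : exact G X p.+2 (hst (fun x => eps x (+) eta x) (iter p (hst eta) (@one R N))).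
Hypothesis Hq : exact G X q.+1 (iter q (hst eta) (@one R N)).
Hypothesis usec : ucont (@sphX R q) sec.
Hypothesis secX : forall m, sphX m -> X (sec m).
Hypothesis secS : forall m, sphX m -> sec (sphS m) = sg (ta (sec m)).

(* With [h], [t] the two degree one classes, [t^(p+1) = h t^p] and [t^q = 0] force [t^p = 0]
   by the freeness of the cohomology; along the section both classes become [h]. *)
Lemma top_contradiction : False.
Proof.
pose t n := iter n (hst eta) (@one R N).
pose h n (c : seq N -> bool) := iter n (hst eps) c.
have se : sgnf G X eps.
  by move=> k [<-|[<-|//]] x y Xx Xy; rewrite ?epsS ?epsT // addNb addbN negbK.
have st : sgnf G X eta.
  by move=> k [<-|[<-|//]] x y Xx Xy; rewrite ?etaS ?etaT // addNb addbN negbK.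
have c1 : cocyc G X 1 (@one R N) := cocyc_one _ _.
have ct n : cocyc G X n.+1 (t n) by rewrite -addn1; apply: cocyc_iter.
have F1 : exact G X p.+2 (cadd (t p.+1) (hst eps (t p))).
  by move: Hp; rewrite hst_addl; apply: exact_eqf => s _; rewrite /cadd addbC.
(* Iterating [F1] gives [t^(k+p) = h^k t^p]. *)
have F2 k : exact G X (k + p).+1 (cadd (t (k + p)%N) (h k (t p))).
  elim: k => [|k IH]; first by apply: exact_eqf (exact0 _ _ _) => s _; rewrite /cadd addbb.
  apply: (@exact_trans _ _ _ _ _ _ (hst eta (h k (t p)))).
    by have := exact_hst st IH; rewrite hst_add.
  apply: (@exact_trans _ _ _ _ _ _ (h k (hst eta (t p)))).
    by have := iter_hstC k se st (ct p); rewrite addnS.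
  have := exact_iter k se F1; rewrite iter_hst_add /h -[iter k (hst eps) (hst eps _)]iterSr.
  by rewrite addnS addnS.
have [k qk] : exists k, q = (k.+1 + p)%N.
  by exists (q - p.+1)%N; rewrite addSn -addnS subnK.
have F3 : exact G X q.+1 (h k.+1 (t p)).
  have := F2 k.+1; rewrite -qk => /exact_sym H; exact: exact_cancel H Hq.
have [Sp In] := Hbasis.
have [psi Hpsi] := Sp p (t p) (ct p).
have F4 : exact G X q.+1 (comb eps (fun b => iter b (hst eta) (@one R N)) rho (k.+1 + p.+1) (fun b => (b < p.+1)%N && psi b)).
  rewrite comb_shift; have := exact_iter k.+1 se Hpsi; rewrite iter_hst_add addnS -qk.
  by move=> /exact_sym H; apply: exact_cancel H _.
(* Expand [t^p] as the sum of [psi_b h^(p-b) t^b]. As [h^(k+1) t^p = 0], independence kills every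
   coefficient whose exponent of [h] after multiplication, [q - b], is below [q]; only [psi 0]
   survives. *)
have psi0 b : (0 < b)%N -> (b <= p)%N -> (b < rho)%N -> psi b = false.
  move=> b0 bp br; rewrite qk -addnS in F4.
  have := In _ _ F4 b; rewrite ltnS bp /=; apply=> //.
    by rewrite addnS ltnS (leq_trans bp) // leq_addl.
  by rewrite addnS -qk -add1n leq_add2r.
rewrite comb_lone // in Hpsi; last exact: ltnW.
set kp := psi 0%N in Hpsi.
have F6 : exact G X p.+2 (fun s => kp && cadd (h p (t 1%N)) (h p.+1 (@one R N)) s).
  have A1 := exact_hst st Hpsi; have A2 := exact_hst se Hpsi.
  rewrite hst_add hst_scale /= in A1; rewrite hst_add hst_scale /= in A2.
  have A3 : exact G X p.+2 (fun s => kp && cadd (hst eta (h p (@one R N))) (h p (t 1%N)) s).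
    by apply: exact_scale; rewrite -(addn1 p); apply: iter_hstC.
  have := exact_add (exact_add A1 A2) (exact_add A3 F1).
  apply: exact_eqf => s _; rewrite /cadd /= /t /=.
  move: (hst eta (iter p (hst eta) _) s) (hst eps (iter p (hst eta) _) s) (hst eta (iter p (hst eps) _) s).
  by move: (hst eps _ s) (h p _ s) => [] [] [] [] []; case: (kp).
(* If [t^p = h^p], then [t^(p+1) = h t^p] reads [h^p t = h^(p+1)]. The class [t] is a basis element
   since [rho > 1], and its exponent [p] is below [q]. *)
have kp0 : kp = false.
  have F6' : exact G X (p + 2) (comb eps (fun b => iter b (hst eta) (@one R N)) rho (p + 2) (fun b => (b < 2)%N && kp)).
    rewrite comb_shift addn2; apply: exact_eqf F6 => s _.
    have -> : comb eps (fun b => iter b (hst eta) (@one R N)) rho 2 (fun=> kp) =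
        fun s => kp && cadd (t 1%N) (hst eps (@one R N)) s.
      apply/funext => l; rewrite /= hst0 /cadd /= rho1 (ltnW rho1) !andbT.
      have -> : hst eps (fun s0 => false (+) kp && one s0) l = kp && hst eps (@one R N) l.
        exact: (congr1 (fun c => c l) (hst_scale eps kp (@one R N))).
      by rewrite andb_addr addbC.
    by rewrite iter_hst_scale iter_hst_add /h [in LHS]iterSr.
  have := In _ _ F6' 1%N; rewrite /=; apply=> //; first by rewrite addn2.
  by rewrite addn2 add1n ltnS.
have F7 : exact G X p.+1 (t p).
  by apply: exact_eqf Hpsi => s _; rewrite kp0 /cadd addbF.
(* The section is equivariant for the product of the involutions only, so the action is restricted
   to it. *)
have F8 : exact [:: sg \o ta] X p.+1 (t p).
  have [b [b0 bi bc]] := F7; exists b; split=> //.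
  move: bi (ev_map isoT TX bi); apply: ev_imp2 => s _ H1 H2 sn k' [<-|//].
  rewrite map_comp H2 ?size_map //; last by left.
  by apply: H1 => //; right; left.
have eqs : equiv [:: @sphS R q] [:: sg \o ta] (@sphX R q) sec.
  by move=> k' [<-|//]; exists (sg \o ta); [left|].
have := exact_pull usec secX eqs F8.
have -> : (fun s => t p (map sec s)) = iter p (hst (eta \o sec)) (@one R (sph R q)).
  rewrite /t; elim: (p) => [|n IH]; first by apply/funext => s; rewrite /= /one size_map.
  by apply/funext => s; rewrite [LHS](hst_map eta sec (iter n (hst eta) (@one R N)) s) IH.
apply: sph_pow => // m Xm.
by rewrite /= secS // etaS ?etaT //; [apply: secX|apply/TX/secX].
Qed.
End Contradiction.

(** * Cone bundles *)

Section Norm1.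
Variable R : realType.

Definition N1 m (y : 'rV[R]_m) : R := \sum_i `|y 0 i|.

Lemma N1_ge0 m (y : 'rV[R]_m) : 0 <= N1 y.
Proof. by apply: sumr_ge0 => i _; apply: normr_ge0. Qed.

Lemma N1_coord m (y : 'rV[R]_m) i : `|y 0 i| <= N1 y.
Proof. by rewrite /N1 (bigD1 i) //= lerDl; apply: sumr_ge0. Qed.

Lemma N1_eq0 m (y : 'rV[R]_m) : N1 y = 0 -> y = 0.
Proof.
move=> y0; apply/rowP=> i; rewrite mxE; apply/eqP; rewrite -normr_le0 -y0.
exact: N1_coord.
Qed.

Lemma N1_gt0 m (y : 'rV[R]_m) : y != 0 -> 0 < N1 y.
Proof. by move=> y0; rewrite lt_def N1_ge0 andbT; apply: contra y0 => /eqP/N1_eq0->. Qed.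

Lemma N10 m : N1 (0 : 'rV[R]_m) = 0.
Proof. by rewrite /N1 big1 // => i _; rewrite mxE normr0. Qed.

Lemma N1D m (y z : 'rV[R]_m) : N1 (y + z) <= N1 y + N1 z.
Proof. by rewrite /N1 -big_split; apply: ler_sum => i _; rewrite mxE ler_normD. Qed.

Lemma N1Z m a (y : 'rV[R]_m) : N1 (a *: y) = `|a| * N1 y.
Proof. by rewrite /N1 mulr_sumr; apply: eq_bigr => i _; rewrite mxE normrM. Qed.

Lemma N1N m (y : 'rV[R]_m) : N1 (- y) = N1 y.
Proof. by rewrite -scaleN1r N1Z normrN1 mul1r. Qed.

Lemma N1B m (y z : 'rV[R]_m) : N1 y - N1 z <= N1 (y - z).
Proof. by rewrite lerBlDr -{1}(subrK z y) N1D. Qed.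

Lemma mul_coord_bound m n (B : 'M[R]_(m, n)) C (y : 'rV[R]_m) j : (forall i j, `|B i j| <= C) ->
  `|(y *m B) 0 j| <= C * N1 y.
Proof.
move=> BC; rewrite mxE; apply: le_trans (ler_norm_sum _ _ _) _; rewrite /N1 mulr_sumr.
by apply: ler_sum => i _; rewrite normrM mulrC ler_wpM2r.
Qed.

Lemma N1_mul m n (B : 'M[R]_(m, n)) C (y : 'rV[R]_m) : (forall i j, `|B i j| <= C) ->
  N1 (y *m B) <= n%:R * C * N1 y.
Proof.
move=> BC; apply: le_trans (ler_sum _ (fun j _ => mul_coord_bound y j BC)) _.
by rewrite sumr_const card_ord -mulrA mulr_natl.
Qed.

Lemma N1_large m (y : 'rV[R]_m) : y != 0 -> exists i, N1 y <= m%:R * `|y 0 i|.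
Proof.
move=> y0; have m0 : (0 < m)%N by case: m y y0 => // y; rewrite thinmx0 eqxx.
case: (@Order.TotalTheory.arg_maxP _ _ 'I_m (Ordinal m0) predT (fun i => `|y 0 i|)) => // i _ Hi.
exists i; rewrite /N1 -[m in m%:R]card_ord mulr_natl -sumr_const.
by apply: ler_sum => k _; apply: Hi.
Qed.

Definition n2 m (y : 'rV[R]_m) : R := (y *m y^T) 0 0.

Lemma n2E m (y : 'rV[R]_m) : n2 y = \sum_i (y 0 i) ^+ 2.
Proof. by rewrite /n2 mxE; apply: eq_bigr => i _; rewrite mxE expr2. Qed.

Definition qf m (B : 'M[R]_m) (y : 'rV[R]_m) : R := (y *m B *m y^T) 0 0.

Lemma qf_bound m (B : 'M[R]_m) C y : (forall i j, `|B i j| <= C) -> `|qf B y| <= C * N1 y ^+ 2.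
Proof.
move=> BC; rewrite /qf mxE; apply: le_trans (ler_norm_sum _ _ _) _.
rewrite expr2 mulrA [X in _ <= _ * X]/N1 mulr_sumr; apply: ler_sum => i _.
by rewrite normrM [y^T _ _]mxE ler_wpM2r // mul_coord_bound.
Qed.

Lemma qfZ m (B : 'M[R]_m) a y : qf B (a *: y) = a ^+ 2 * qf B y.
Proof. by rewrite /qf -scalemxAl -scalemxAl linearZ -scalemxAr !mxE mulrA expr2. Qed.

Lemma qfN m (B : 'M[R]_m) y : qf B (- y) = qf B y.
Proof. by rewrite -scaleN1r qfZ sqrrN expr1n mul1r. Qed.

Lemma qfB m (B : 'M[R]_m) y : B^T = B -> forall s : R,
  qf B (y - s *: (y *m B)) = qf B y - 2%:R * s * n2 (y *m B) + s ^+ 2 * qf B (y *m B).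
Proof.
move=> BT s; rewrite -(qfZ B s) /qf /n2.
have E (u v : 'rV[R]_m) : ((u - v) *m B *m (u - v)^T) 0 0 =
    (u *m B *m u^T) 0 0 - 2%:R * (u *m B *m v^T) 0 0 + (v *m B *m v^T) 0 0.
  have sym : (v *m B *m u^T) 0 0 = (u *m B *m v^T) 0 0.
    have -> : v *m B *m u^T = (u *m B *m v^T)^T by rewrite !trmx_mul trmxK BT mulmxA.
    by rewrite mxE.
  rewrite linearB /= !mulmxBl !mulmxBr.
  have -> (a b c d : 'M[R]_1) : (a - b - (c - d)) 0 0 = a 0 0 - b 0 0 - (c 0 0 - d 0 0) by rewrite !mxE.
  by rewrite sym; ring.
rewrite E; congr (_ - _ + _).
by rewrite linearZ -scalemxAr mxE; ring.
Qed.

Definition unitv m (y : 'rV[R]_m) : 'rV[R]_m := (N1 y)^-1 *: y.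

Lemma N1_unitv m (y : 'rV[R]_m) : y != 0 -> N1 (unitv y) = 1.
Proof.
move=> y0; rewrite N1Z ger0_norm ?invr_ge0 ?N1_ge0 // mulVf //.
by rewrite gt_eqF // N1_gt0.
Qed.

Lemma unitvZ m a (y : 'rV[R]_m) : 0 < a -> unitv (a *: y) = unitv y.
Proof.
move=> a0; rewrite /unitv N1Z gtr0_norm // invfM scalerA.
by rewrite mulrAC mulVf ?gt_eqF // mul1r.
Qed.

Lemma unitvN m (y : 'rV[R]_m) : unitv (- y) = - unitv y.
Proof. by rewrite /unitv N1N scalerN. Qed.

Lemma unitv_lip m (y z : 'rV[R]_m) a e : 0 < a -> a <= N1 y -> N1 (y - z) <= e ->
  N1 (unitv y - unitv z) <= 2%:R * e / a.
Proof.
move=> a0 ay yz; have y0 : 0 < N1 y by apply: lt_le_trans ay.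
have e0 : 0 <= e by apply: le_trans (N1_ge0 _) yz.
have [z0|z0] := eqVneq z 0.
  rewrite z0 /unitv scaler0 subr0 -/(unitv y) N1_unitv; last first.
    by apply: contraTneq y0 => ->; rewrite N10 ltxx.
  rewrite ler_pdivlMr // mul1r; apply: le_trans ay _.
  by move: yz; rewrite z0 subr0; lra.
have z0' := N1_gt0 z0.
have -> : unitv y - unitv z = (N1 y)^-1 *: (y - z) + ((N1 z - N1 y) / (N1 y * N1 z)) *: z.
  apply/rowP=> i; rewrite !mxE; field.
  by rewrite !gt_eqF.
apply: le_trans (N1D _ _) _; rewrite !N1Z.
have -> : `|(N1 z - N1 y) / (N1 y * N1 z)| * N1 z = `|N1 z - N1 y| / N1 y.
  rewrite normrM normfV (gtr0_norm (mulr_gt0 y0 z0')); field.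
  by rewrite !gt_eqF.
have h : `|N1 z - N1 y| <= e.
  have := N1B y z; have := N1B z y; rewrite -(N1N (z - y)) opprB ler_norml => h1 h2.
  by apply/andP; split; lra.
rewrite gtr0_norm ?invr_gt0 // mulrC -mulrDl.
apply: (@le_trans _ _ (2%:R * e / N1 y)).
  by rewrite ler_pM2r ?invr_gt0 //; lra.
by rewrite ler_wpM2l ?lef_pV2 //; lra.
Qed.
End Norm1.

Section Ray.
Variables (R : realType).

(** Points of a cone are compared up to positive scaling: a fibre then behaves like its compact
    link, while maps on it stay linear. *)
Definition rnear m (e : R) (y z : 'rV[R]_m) := N1 (unitv y - unitv z) < e.

Lemma rnear_refl m e (y : 'rV[R]_m) : 0 < e -> rnear e y y.
Proof. by rewrite /rnear subrr N10. Qed.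
Lemma rnear_sym m e (y z : 'rV[R]_m) : rnear e y z -> rnear e z y.
Proof. by rewrite /rnear -N1N opprB. Qed.
Lemma rnear_tri m e e' (x y z : 'rV[R]_m) : rnear e x y -> rnear e' y z -> rnear (e + e') x z.
Proof.
rewrite /rnear => h h'; have -> : unitv x - unitv z = (unitv x - unitv y) + (unitv y - unitv z).
  by rewrite addrA subrK.
by apply: le_lt_trans (N1D _ _) _; apply: ltrD.
Qed.
Lemma rnear_mono m e e' (x y : 'rV[R]_m) : e <= e' -> rnear e x y -> rnear e' x y.
Proof. by move=> ee; rewrite /rnear => /lt_le_trans; apply. Qed.
Definition ray m := Uspace (@rnear_refl m) (@rnear_sym m) (@rnear_tri m) (@rnear_mono m).

Definition mcont q (Q : 'rV[R]_q -> Prop) m n (B : 'rV[R]_q -> 'M[R]_(m, n)) :=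
  forall e : R, 0 < e -> exists2 d : R, 0 < d & forall x x', Q x -> Q x' -> vnear d x x' ->
    forall i j, `|B x i j - B x' i j| <= e.

Lemma unitv_mul m n (B : 'M[R]_(m, n)) y : y != 0 -> unitv (y *m B) = unitv (unitv y *m B).
Proof. by move=> y0; rewrite {3}/unitv -scalemxAl unitvZ // invr_gt0 N1_gt0. Qed.

Lemma unitv_mul_unif q (Q : 'rV[R]_q -> Prop) m n (B : 'rV[R]_q -> 'M[R]_(m, n)) (C : R) :
  (forall x, Q x -> forall i j, `|B x i j| <= C) -> mcont Q B -> forall e : R, 0 < e ->
  exists2 d : R, 0 < d & forall x x' y y', Q x -> Q x' -> y' != 0 -> vnear d x x' -> rnear d y y' ->
    N1 (unitv y *m B x - unitv y' *m B x') <= e.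
Proof.
move=> BC Bc e e0; pose K := n%:R * Num.max C 0 + n%:R + 1.
have C0 : 0 <= Num.max C 0 by rewrite le_max lexx orbT.
have K0 : 0 < K by rewrite /K ltr_wpDl // addr_ge0 // mulr_ge0.
have eta0 : 0 < e / K by rewrite divr_gt0.
have [d d0 Hd] := Bc _ eta0; exists (Num.min d (e / K)); first by rewrite lt_min d0.
move=> x x' y y' Qx Qx' y0' nx ny.
have nx' : vnear d x x' by move=> i; apply: lt_le_trans (nx i) _; rewrite ge_min lexx.
have ny' : N1 (unitv y - unitv y') <= e / K.
  by apply: le_trans (ltW ny) _; rewrite ge_min lexx orbT.
have -> : unitv y *m B x - unitv y' *m B x' =
    (unitv y - unitv y') *m B x + unitv y' *m (B x - B x').
  by rewrite mulmxBl mulmxBr addrA subrK.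
apply: le_trans (N1D _ _) _.
have h1 : N1 ((unitv y - unitv y') *m B x) <= n%:R * Num.max C 0 * N1 (unitv y - unitv y').
  by apply: N1_mul => i j; apply: le_trans (BC x Qx i j) _; rewrite le_max lexx.
have h2 : N1 (unitv y' *m (B x - B x')) <= n%:R * (e / K) * N1 (unitv y').
  by apply: N1_mul => i j; rewrite !mxE; apply: Hd.
rewrite N1_unitv // mulr1 in h2.
apply: (@le_trans _ _ (n%:R * Num.max C 0 * (e / K) + n%:R * (e / K))).
  by apply: lerD => //; apply: le_trans h1 _; rewrite ler_wpM2l // mulr_ge0.
by rewrite -mulrDl mulrA ler_pdivrMr // mulrC ler_wpM2l ?(ltW e0) // lerDl.
Qed.

(** Where the maps are bounded below on the given vectors, normalization costs a constant factor
    only, so the induced maps of rays are uniformly continuous. *)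
Lemma rnear_lin q (Q : 'rV[R]_q -> Prop) m n (B : 'rV[R]_q -> 'M[R]_(m, n)) (C a : R)
  (Dom : 'rV[R]_q -> 'rV[R]_m -> Prop) :
  0 < a -> (forall x, Q x -> forall i j, `|B x i j| <= C) -> mcont Q B ->
  (forall x y, Dom x y -> [/\ Q x, y != 0 & a * N1 y <= N1 (y *m B x)]) ->
  forall e : R, 0 < e -> exists2 d : R, 0 < d &
    forall x x' y y', Dom x y -> Dom x' y' -> vnear d x x' -> rnear d y y' ->
      rnear e (y *m B x) (y' *m B x').
Proof.
move=> a0 BC Bc HD e e0; have e1 : 0 < e * a / 4%:R by rewrite divr_gt0 // mulr_gt0.
have [d d0 Hd] := unitv_mul_unif BC Bc e1; exists d => // x x' y y' Dxy Dxy' nx ny.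
have [Qx y0 ay] := HD _ _ Dxy; have [Qx' y0' ay'] := HD _ _ Dxy'.
rewrite /rnear (unitv_mul _ y0) (unitv_mul _ y0').
have aB : a <= N1 (unitv y *m B x).
  have N0 := N1_gt0 y0; rewrite /unitv -scalemxAl N1Z ger0_norm ?invr_ge0 ?N1_ge0 //.
  by rewrite mulrC ler_pdivlMr.
apply: le_lt_trans (unitv_lip a0 aB (Hd _ _ _ _ Qx Qx' y0' nx ny)) _.
have -> : 2%:R * (e * a / 4%:R) / a = e / 2%:R by field; rewrite gt_eqF.
by rewrite ltr_pdivrMr // ltr_pMr // ltr1n.
Qed.
End Ray.

Section Sup.
Variable R : realType.

Definition nsup m (v : 'rV[R]_m) : R := \big[Num.max/0]_i `|v 0 i|.

Lemma nsup_ge m (v : 'rV[R]_m) i : `|v 0 i| <= nsup v.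
Proof. by rewrite /nsup; apply: le_bigmax. Qed.

Lemma nsup_ge0 m (v : 'rV[R]_m) : 0 <= nsup v.
Proof. exact: bigmax_ge_id. Qed.

Lemma nsup_le m (v : 'rV[R]_m) a : 0 <= a -> (forall i, `|v 0 i| <= a) -> nsup v <= a.
Proof. by move=> a0 H; apply/bigmax_leP; split. Qed.

Lemma nsup_ex m (v : 'rV[R]_m) : v != 0 -> exists2 i, nsup v = `|v 0 i| & 0 < `|v 0 i|.
Proof.
move=> v0; have m0 : (0 < m)%N by case: m v v0 => // y; rewrite thinmx0 eqxx.
case: (@Order.TotalTheory.arg_maxP _ _ 'I_m (Ordinal m0) predT (fun i => `|v 0 i|)) => // i _ Hi.
have E : nsup v = `|v 0 i|.
  by apply/eqP; rewrite eq_le nsup_ge andbT; apply: nsup_le => // k; apply: Hi.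
exists i => //; rewrite lt_def normr_ge0 andbT; apply: contra v0 => /eqP vi.
by apply/eqP/rowP=> k; rewrite mxE; apply/eqP; rewrite -normr_le0 -vi; apply: Hi.
Qed.

Lemma nsup_gt0 m (v : 'rV[R]_m) : v != 0 -> 0 < nsup v.
Proof. by move=> /nsup_ex[i ->]. Qed.

Lemma nsupZ m a (v : 'rV[R]_m) : 0 < a -> nsup (a *: v) = a * nsup v.
Proof.
move=> a0; apply/eqP; rewrite eq_le; apply/andP; split.
  apply: nsup_le => [|i]; last by rewrite mxE normrM gtr0_norm // ler_wpM2l ?nsup_ge // ltW.
  by rewrite mulr_ge0 ?nsup_ge0 // ltW.
rewrite mulrC -ler_pdivlMr //; apply: nsup_le => [|i].
  by rewrite divr_ge0 ?nsup_ge0 // ltW.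
by rewrite ler_pdivlMr // mulrC; have := nsup_ge (a *: v) i; rewrite mxE normrM gtr0_norm.
Qed.

Lemma nsup_N1 m (v w : 'rV[R]_m) : `|nsup v - nsup w| <= N1 (v - w).
Proof.
have H (a b : 'rV[R]_m) : nsup a <= nsup b + N1 (a - b).
  apply: nsup_le => [|i]; first by rewrite addr_ge0 ?N1_ge0 // nsup_ge0.
  rewrite -[a 0 i](subrK (b 0 i)) addrC; apply: le_trans (ler_normD _ _) _.
  by apply: lerD; [apply: nsup_ge|have := N1_coord (a - b) i; rewrite !mxE].
have := H v w; have := H w v; rewrite -(N1N (w - v)) opprB ler_norml => h1 h2.
by apply/andP; split; lra.
Qed.

Lemma N1_nsup m (v : 'rV[R]_m) : N1 v <= m%:R * nsup v.
Proof.
rewrite /N1 -[m in m%:R]card_ord mulr_natl -sumr_const.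
by apply: ler_sum => k _; apply: nsup_ge.
Qed.

Lemma cube_nsup m (v : 'rV[R]_m) : v != 0 -> cube m ((nsup v)^-1 *: v).
Proof.
move=> v0; have n0 := nsup_gt0 v0; split=> [i||i]; last by rewrite leqNgt ltn_ord.
  by rewrite mxE normrM gtr0_norm ?invr_gt0 // mulrC ler_pdivrMr // mul1r nsup_ge.
have [i E i0] := nsup_ex v0; exists i.
by rewrite mxE normrM gtr0_norm ?invr_gt0 // -E mulVf // gt_eqF.
Qed.

Lemma cube_delta q (j : 'I_q) : cube q (delta_mx 0 j : 'rV[R]_q).
Proof.
split=> [i||i]; last by rewrite leqNgt ltn_ord.
  by rewrite mxE eqxx; case: eqP => _; rewrite ?normr0 ?normr1.
by exists j; rewrite mxE !eqxx normr1.
Qed.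

Lemma mx_bounded m n (B : 'M[R]_(m, n)) : exists2 C : R, 0 < C & forall i j, `|B i j| <= C.
Proof.
exists (\sum_i \sum_j `|B i j| + 1).
  by rewrite ltr_wpDl //; apply: sumr_ge0 => i _; apply: sumr_ge0.
move=> i j; apply: ler_wpDr => //; rewrite (bigD1 i) //= (bigD1 j) //= -addrA lerDl addr_ge0 //.
  by apply: sumr_ge0.
by apply: sumr_ge0 => k _; apply: sumr_ge0.
Qed.
End Sup.

(** * The fibre over a pole *)

Section PoleFiber.
Variables (R : realType) (q m rho : nat) (e0 : 'rV[R]_q) (A : 'M[R]_m).
Variables (P : 'M[R]_(m, rho)) (U : 'M[R]_(rho, m)) (c : R).
Let N := tot q (ray R m).
Let fv (x : N) : 'rV[R]_m := x.2.
Variable (F : N -> Prop) (eta : N -> bool).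
Let ta : N -> N := @fibmap R q (ray R m) -%R.
Hypothesis FE : forall x, F x <-> [/\ x.1 = e0, (fv x) != 0 & qf A (fv x) <= 0].
Hypothesis UP : U *m P = 1%:M.
Hypothesis Uneg : forall u, qf A (u *m U) <= 0.
Hypothesis retr : forall y (s : R), 0 <= s -> s <= 1 -> qf A y <= 0 ->
  qf A (y - s *: (y - y *m P *m U)) <= 0.
Hypotheses (c0 : 0 < c) (Plow : forall y, qf A y <= 0 -> c * N1 y <= N1 (y *m P)).
Hypothesis etaT : forall x, F x -> eta (ta x) = ~~ eta x.

Let F1 (x : N) := F x /\ (fv x) = (fv x) *m P *m U.

Lemma PU_fix (y : 'rV[R]_m) (s : R) : (y - s *: (y - y *m P *m U)) *m P = y *m P.
Proof. by rewrite mulmxBl -scalemxAl mulmxBl -(mulmxA _ U) UP mulmx1 subrr scaler0 subr0. Qed.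

(** The component [y *m P] does not change along the retraction, by [PU_fix], and it is bounded
    below on the cone; so the retraction avoids 0 uniformly. *)
Lemma retr_low : exists2 a, 0 < a & forall y (s : R), qf A y <= 0 ->
  a * N1 y <= N1 (y - s *: (y - y *m P *m U)).
Proof.
have [CP CP0 HP] := mx_bounded P.
exists (c / (rho.+1%:R * CP)); first by rewrite divr_gt0 // mulr_gt0 // ltr0n.
move=> y s /Plow cy; rewrite mulrAC ler_pdivrMr; last by rewrite mulr_gt0 // ltr0n.
apply: le_trans cy _; have := N1_mul (y - s *: (y - y *m P *m U)) HP.
rewrite PU_fix => /le_trans; apply.
by rewrite mulrC ler_wpM2l ?N1_ge0 // ler_wpM2r ?(ltW CP0) // ler_nat.
Qed.

(** The straight retraction onto the range of [U] is cut into equal steps, so many that each moves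
    every ray by less than [e]. *)
Lemma deform_F1 : deform [:: ta] F F1.
Proof.
split=> [x []//|e e_gt0].
have [a a0 Ha] := retr_low.
pose f (s : R) (x : N) : N := (x.1, (fv x) - s *: ((fv x) - (fv x) *m P *m U)).
pose B s := 1%:M - s *: (1%:M - P *m U).
have fB s (y : 'rV[R]_m) : y - s *: (y - y *m P *m U) = y *m B s.
  by rewrite /B mulmxBr mulmx1 -scalemxAr mulmxBr mulmx1 mulmxA.
have gf s : 0 <= s -> s <= 1 -> good [:: ta] F (f s).
  move=> s0 s1; split.
  - move=> d d0; have [C _ BC] := mx_bounded (B s).
    have [||x y|d' d'0 Hd'] := @rnear_lin R q (fun=> True) _ _ (fun=> B s) C a
        (fun x y => y != 0 /\ qf A y <= 0) a0 _ _ _ d d0.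
    + by move=> x _.
    + by move=> e' e'0; exists 1 => // x x' _ _ _ i j; rewrite subrr normr0 ltW.
    + by case=> y0 yA; split=> //; rewrite -fB; apply: Ha.
    exists (Num.min d d'); first by rewrite lt_min d0.
    move=> x y /FE[_ x0 xA] /FE[_ y0 yA] [nxy1 nxy2]; split.
      by move=> i; apply: lt_le_trans (nxy1 i) _; rewrite ge_min lexx.
    rewrite /f /= !fB; apply: (Hd' x.1 y.1) => //.
      by move=> i; apply: lt_le_trans (nxy1 i) _; rewrite ge_min lexx orbT.
    by apply: rnear_mono nxy2; rewrite ge_min lexx orbT.
  - move=> x /FE[xe x0 xA]; apply/FE; split=> //=; last exact: retr.
    apply/eqP => E; have := Ha _ s xA; rewrite E N10 leNgt => /negP; apply.
    by rewrite mulr_gt0 // N1_gt0.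
  - move=> k [<-|//] x _; rewrite /f /ta /fibmap /fv /=; congr (_, _).
    by rewrite !fB mulNmx.
have [CB CB0 HB] := mx_bounded (1%:M - P *m U).
(* A step of length [1 / (n+1)] moves a ray by at most [2 m CB / ((n+1) a)]; the factor 4 leaves
   room for a strict inequality. *)
have [n Hn] := @archi_ex R (a * e / 4%:R) (m%:R * CB) (divr_gt0 (mulr_gt0 a0 e_gt0) (ltr0n _ 4)).
have n0 : (0 : R) < n.+1%:R by rewrite ltr0n.
have lk k : (k <= n.+1)%N -> linked [:: ta] F e (f (k%:R / n.+1%:R)).
  elim: k => [_|k IH kn].
    suff -> : f (0%:R / n.+1%:R) = id by apply: linked_id.
    by apply/funext => -[x y]; rewrite /f mul0r scale0r subr0.
  apply: linked_step (IH (ltnW kn)) _ _.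
    by apply: gf; [rewrite divr_ge0 // ltW|rewrite ler_pdivrMr // mul1r ler_nat].
  move=> x /FE[_ x0 xA]; split=> [i|]; first by rewrite subrr normr0.
  rewrite /= /rnear; have N0 := N1_gt0 x0.
  have h : N1 (((fv x) - (k%:R / n.+1%:R) *: ((fv x) - (fv x) *m P *m U)) -
     ((fv x) - (k.+1%:R / n.+1%:R) *: ((fv x) - (fv x) *m P *m U))) <= n.+1%:R^-1 * (m%:R * CB * N1 (fv x)).
    have -> (v y z : 'rV[R]_m) : (v - y) - (v - z) = z - y by apply/rowP=> i; rewrite !mxE; ring.
    rewrite -scalerBl.
    have -> : k.+1%:R / n.+1%:R - k%:R / n.+1%:R = n.+1%:R^-1 :> R.
      by rewrite -mulrBl -natrB // subSnn mul1r.
    rewrite N1Z gtr0_norm ?invr_gt0 // ler_pM2l ?invr_gt0 //.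
    have -> : (fv x) - (fv x) *m P *m U = (fv x) *m (1%:M - P *m U) by rewrite mulmxBr mulmx1 mulmxA.
    exact: N1_mul.
  apply: le_lt_trans (unitv_lip _ (Ha _ _ xA) h) _; first by rewrite mulr_gt0.
  have -> : 2%:R * (n.+1%:R^-1 * (m%:R * CB * N1 (fv x))) / (a * N1 (fv x)) =
      2%:R * (m%:R * CB) / (n.+1%:R * a).
    by move: (n.+1%:R) n0 => k1 k10; field; rewrite !gt_eqF.
  rewrite ltr_pdivrMr ?mulr_gt0 //.
  have : n%:R * (a * e / 4%:R) < n.+1%:R * (a * e / 4%:R) by rewrite ltr_pM2r ?ltr_nat // divr_gt0 // mulr_gt0.
  have : 0 < n.+1%:R * (a * e / 4%:R) by rewrite mulr_gt0 // divr_gt0 // mulr_gt0.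
  have -> : e * (n.+1%:R * a) = 4%:R * (n.+1%:R * (a * e / 4%:R)).
    by move: (n.+1%:R : R) => z; field.
  move: Hn; move: (n%:R * _) (n.+1%:R * _) (m%:R * CB) => u v z; lra.
exists (f 1); first by have := lk n.+1 (leqnn _); rewrite divff // gt_eqF.
move=> x Fx; have [_ fF _] := gf 1 ler01 (lexx _); split; first exact: fF.
by rewrite /f /= scale1r opprB addrCA subrr addr0 -!mulmxA (mulmxA U) UP mul1mx.
Qed.

(** After the retraction the fibre consists of the nonzero vectors [u *m U]. Their rays are those of
    a space of dimension [rho], and scaling [u] to sup norm one identifies them with the cubical
    sphere. *)
Lemma pole_fbasis : fbasis (fun b => iter b (hst eta) (@one R N)) rho [:: ta] F.
Proof.
have sgn_eta : sgnf [:: ta] F eta.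
  by move=> k [<-|//] x y Fx Fy; rewrite !etaT // addNb addbN negbK.
apply: fbasis_deform deform_F1 _ => [b|].
  by rewrite -addn1; apply: cocyc_iter => //; apply: cocyc_one.
have [CP CP0 HP] := mx_bounded P; have [CU CU0 HU] := mx_bounded U.
pose f (x : N) : sph R rho := ((nsup ((fv x) *m P))^-1 *: ((fv x) *m P), tt).
pose g (u : sph R rho) : N := (e0, u.1 *m U).
have xP0 x : F x -> (fv x) *m P != 0.
  move=> /FE[_ x0 xA]; apply/eqP => E; have := Plow xA; rewrite E N10 leNgt => /negP; apply.
  by rewrite mulr_gt0 // N1_gt0.
have uU (u : 'rV_rho) : N1 u <= rho%:R * CP * N1 (u *m U).
  by rewrite -{1}(mulmx1 u) -UP mulmxA; apply: N1_mul.
have cubeN1 (u : 'rV[R]_rho) : cube rho u -> 1 <= N1 u.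
  by case=> _ [i <-] _; apply: N1_coord.
have uU0 (u : 'rV_rho) : cube rho u -> u *m U != 0.
  move=> /cubeN1 u1; apply/eqP => E; have := uU u; rewrite E N10 mulr0 => ?; lra.
apply: (@fbasis_sphere _ _ _ _ _ _ f g).
- by move=> x [Fx _]; apply: etaT.
- move=> e e_gt0; have e1 : 0 < e / (4%:R * rho.+1%:R).
    by rewrite divr_gt0 // mulr_gt0 // ltr0n.
  have [||x y|d' d'0 Hd'] := @rnear_lin R q (fun=> True) _ _ (fun=> P) CP c
        (fun x y => y != 0 /\ qf A y <= 0) c0 _ _ _ _ e1.
  + by [].
  + by move=> e' e'0; exists 1 => // x x' _ _ _ i j; rewrite subrr normr0 ltW.
  + by case=> y0 yA; split=> //; apply: Plow.
  exists d' => // x y [Fx _] [Fy _] [nxy1 nxy2]; split=> // i.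
  have /FE[_ x0 xA] := Fx; have /FE[_ y0 yA] := Fy.
  have := Hd' _ _ _ _ (conj x0 xA) (conj y0 yA) nxy1 nxy2; rewrite /rnear.
  have scal (v : 'rV[R]_rho) : v != 0 -> (nsup v)^-1 *: v = (nsup (unitv v))^-1 *: unitv v.
    move=> v0; have h := N1_gt0 v0; rewrite /unitv nsupZ ?invr_gt0 // scalerA invfM invrK.
    by rewrite mulrAC divff ?mul1r // gt_eqF.
  rewrite /f /= (scal _ (xP0 x Fx)) (scal _ (xP0 y Fy)).
  have := N1_unitv (xP0 x Fx); have := N1_unitv (xP0 y Fy).
  move: (unitv _) (unitv _) => v w w1 v1 vw.
  have v0 : v != 0 by apply/eqP => E; move: v1; rewrite E N10 => /eqP; rewrite eq_sym oner_eq0.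
  have w0 : w != 0 by apply/eqP => E; move: w1; rewrite E N10 => /eqP; rewrite eq_sym oner_eq0.
  have nv := nsup_gt0 v0; have nw := nsup_gt0 w0.
  rewrite !mxE.
  have -> : (nsup v)^-1 * v 0 i - (nsup w)^-1 * w 0 i =
     (nsup v)^-1 * ((v 0 i - w 0 i) + (nsup w)^-1 * w 0 i * (nsup w - nsup v)).
    by field; rewrite !gt_eqF.
  rewrite normrM gtr0_norm ?invr_gt0 // mulrC ltr_pdivrMr //.
  apply: le_lt_trans (ler_normD _ _) _.
  have h1 : `|v 0 i - w 0 i| <= N1 (v - w) by have := N1_coord (v - w) i; rewrite !mxE.
  have h2 : `|(nsup w)^-1 * w 0 i * (nsup w - nsup v)| <= N1 (v - w).
    rewrite normrM -[X in _ <= X]mul1r; apply: ler_pM => //.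
      by rewrite normrM gtr0_norm ?invr_gt0 // mulrC ler_pdivrMr // mul1r nsup_ge.
    by rewrite distrC; apply: nsup_N1.
  have h3 : 1 <= rho.+1%:R * nsup v.
    by have := N1_nsup v; rewrite v1 => /le_trans; apply; rewrite ler_wpM2r ?nsup_ge0 // ler_nat.
  have r0 : (0 : R) < rho.+1%:R by rewrite ltr0n.
  apply: le_lt_trans (lerD h1 h2) _; move: vw; rewrite ltr_pdivlMr ?mulr_gt0 //.
  by move: (N1 (v - w)) (N1_ge0 (v - w)) (rho.+1%:R) r0 (nsup v) nv h3 => a ? b ? d ? ? ?; nra.
- by move=> x [Fx _]; apply: cube_nsup; apply: xP0.
- move=> x [Fx _]; rewrite /f /sphS /tsg /= mulNmx.
  have -> : nsup (- ((fv x) *m P)) = nsup ((fv x) *m P).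
    by rewrite /nsup; apply: eq_bigr => i _; rewrite mxE normrN.
  by rewrite scalerN.
- move=> e e_gt0; have K0 : 0 < rho.+1%:R * CP by rewrite mulr_gt0 // ltr0n.
  have K1 : 0 < m.+1%:R * CU * rho.+1%:R by rewrite !mulr_gt0 // ltr0n.
  exists (e / (4%:R * (rho.+1%:R * CP) * (m.+1%:R * CU * rho.+1%:R))).
    by rewrite divr_gt0 // !mulr_gt0 // ltr0n.
  move=> u v Xu Xv [nuv _]; split=> [i|]; first by rewrite subrr normr0.
  rewrite /= /rnear.
  have low : (rho.+1%:R * CP)^-1 <= N1 (u.1 *m U).
    rewrite -[_^-1]mul1r ler_pdivrMr // mulrC; apply: le_trans (cubeN1 _ Xu) _.
    by apply: le_trans (uU _) _; rewrite ler_wpM2r ?N1_ge0 // ler_wpM2r ?(ltW CP0) // ler_nat.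
  have h : N1 (u.1 *m U - v.1 *m U) <= e / (4%:R * (rho.+1%:R * CP)).
    rewrite -mulmxBl; apply: le_trans (N1_mul _ HU) _.
    have h' : N1 (u.1 - v.1) <= rho%:R * (e / (4%:R * (rho.+1%:R * CP) * (m.+1%:R * CU * rho.+1%:R))).
      apply: le_trans (N1_nsup _) _; rewrite ler_wpM2l //; apply: nsup_le => [|i].
        by rewrite ltW // divr_gt0 // !mulr_gt0 // ltr0n.
      by rewrite !mxE ltW.
    apply: le_trans (ler_wpM2l _ h') _; first by rewrite mulr_ge0 // ltW.
    have -> : e / (4%:R * (rho.+1%:R * CP)) =
       (m.+1%:R * CU * rho.+1%:R) * (e / (4%:R * (rho.+1%:R * CP) * (m.+1%:R * CU * rho.+1%:R))).
      have r0 : (0 : R) < rho.+1%:R by rewrite ltr0n.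
      have m0 : (0 : R) < m.+1%:R by rewrite ltr0n.
      by move: (rho.+1%:R) (m.+1%:R) r0 m0 => r1 m1 r10 m10; field; rewrite !gt_eqF.
    have E0 : 0 <= e / (4%:R * (rho.+1%:R * CP) * (m.+1%:R * CU * rho.+1%:R)).
      by rewrite ltW // divr_gt0 // !mulr_gt0 // ltr0n.
    move: (e / _) E0 => E E0; rewrite [leLHS]mulrA; apply: ler_wpM2r => //.
    apply: ler_pM => //; first by rewrite mulr_ge0 // ltW.
      by apply: ler_wpM2r; rewrite ?ler_nat // ltW.
    by rewrite ler_nat.
  apply: le_lt_trans (unitv_lip _ low h) _; first by rewrite invr_gt0.
  have -> : 2%:R * (e / (4%:R * (rho.+1%:R * CP))) / (rho.+1%:R * CP)^-1 = e / 2%:R.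
    have r0 : (0 : R) < rho.+1%:R by rewrite ltr0n.
    by move: (rho.+1%:R) r0 => r1 r10; field; rewrite !gt_eqF.
  by rewrite ltr_pdivrMr // ltr_pMr // ltr1n.
- move=> u Xu; split; first by apply/FE; split=> //; [exact: uU0|exact: Uneg].
  by rewrite /= -!mulmxA (mulmxA U) UP mul1mx.
- by move=> u Xu; rewrite /g /sphS /tsg /ta /fibmap /= mulNmx.
- move=> e x e_gt0 [Fx xPU]; have /FE[xe x0 xA] := Fx; split=> [i|].
    by rewrite /= xe subrr normr0.
  rewrite /= /rnear -scalemxAl -xPU unitvZ ?subrr ?N10 //.
  by rewrite invr_gt0 nsup_gt0 // xP0.
Qed.
End PoleFiber.

Section Sign.
Variable R : realType.

(** The sign of the first nonzero coordinate, negated by [-1] on nonzero vectors. It jumps, which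
    [hst] permits. *)
Definition lexneg m (v : 'rV[R]_m) : bool :=
  [exists i : 'I_m, (v 0 i < 0) && [forall j : 'I_m, (j < i)%N ==> (v 0 j == 0)]].

Lemma lexneg_first m (v : 'rV[R]_m) (i : 'I_m) : v 0 i != 0 ->
  (forall j : 'I_m, (j < i)%N -> v 0 j = 0) -> lexneg v = (v 0 i < 0).
Proof.
move=> vi Hi; apply/existsP/idP => [[k /andP[vk /forallP Hk]]|h]; last first.
  by exists i; rewrite h; apply/forallP => j; apply/implyP => /Hi ->.
have [ki|ik|/ord_inj<- //] := ltngtP k i; first by move: vk; rewrite Hi // ltxx.
by move: (Hk i) vi; rewrite ik /= => ->.
Qed.

Lemma lexnegN m (v : 'rV[R]_m) : v != 0 -> lexneg (- v) = ~~ lexneg v.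
Proof.
move=> v0; have [i0 vi0] : exists i, v 0 i != 0.
  apply/existsP; rewrite -negb_forall; apply: contra v0 => /forallP H.
  by apply/eqP/rowP=> i; rewrite mxE; apply/eqP.
case: (@arg_minnP _ i0 (fun i => v 0 i != 0) (@nat_of_ord m) vi0) => i vi Hi.
have Hj (j : 'I_m) : (j < i)%N -> v 0 j = 0.
  by move=> ji; apply/eqP; apply: contraTT ji => /Hi; rewrite -leqNgt.
rewrite (lexneg_first vi Hj) (@lexneg_first _ (- v) i).
- by rewrite mxE oppr_lt0; case: ltgtP vi.
- by rewrite mxE oppr_eq0.
- by move=> j /Hj; rewrite mxE => ->; rewrite oppr0.
Qed.
End Sign.

(** * The cone bundle over the sphere *)

Section Cone.
Variables (R : realType) (p q rho : nat).
Variable A : 'rV[R]_q -> 'M[R]_(p + 1).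
Variable w : 'rV[R]_q -> 'M[R]_(p + 1, q).
Let N := tot q (ray R (p + 1)).
Let fv (x : N) : 'rV[R]_(p + 1) := x.2.
(** The action of [sigma] on the fibre coordinates [(z, mu)]. *)
Definition flip : 'M[R]_(p + 1) := block_mx 1%:M 0 0 (- 1%:M).

Hypotheses (pq : (p < q)%N) (rho1 : (1 < rho)%N).
Hypothesis AT : forall x, (A x)^T = A x.
Hypothesis AN : forall x, cube q x -> A (- x) = A x.
Hypothesis AD : forall x, cube q x -> flip *m A x = A x *m flip.
Hypothesis Ac : mcont (cube q) A.
Hypothesis Abd : exists2 C : R, 0 < C & forall x, cube q x -> forall i j, `|A x i j| <= C.
Hypothesis Ainv : exists2 c : R, 0 < c & forall x y, cube q x -> c * N1 y ^+ 2 <= n2 (y *m A x).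
Hypothesis Amu : forall x, cube q x -> A x (rshift p 0) (rshift p 0) <= 0.
Hypothesis wD : forall x, cube q x -> flip *m w (- x) = w x.
Hypothesis wc : mcont (cube q) w.
Hypothesis wbd : exists2 C : R, 0 < C & forall x, cube q x -> forall i j, `|w x i j| <= C.
Hypothesis wlow : exists2 c : R, 0 < c & forall x (y : 'rV[R]_(p + 1)), cube q x -> y != 0 -> qf (A x) y <= 0 ->
  exists i, c * N1 y <= `|(y *m w x) 0 i|.
Hypothesis pole : forall j : 'I_q, exists P : 'M[R]_(p + 1, rho), exists U : 'M[R]_(rho, p + 1),
  exists c : R, [/\ U *m P = 1%:M, forall u, qf (A (delta_mx 0 j)) (u *m U) <= 0,
    forall y (s : R), 0 <= s -> s <= 1 -> qf (A (delta_mx 0 j)) y <= 0 ->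
      qf (A (delta_mx 0 j)) (y - s *: (y - y *m P *m U)) <= 0, 0 < c &
    forall y, qf (A (delta_mx 0 j)) y <= 0 -> c * N1 y <= N1 (y *m P)].

Definition coneX (x : N) := [/\ cube q x.1, fv x != 0 & qf (A x.1) (fv x) <= 0].

Let sY (y : ray R (p + 1)) : ray R (p + 1) := y *m flip.
Let opp : ray R (p + 1) -> ray R (p + 1) := -%R.

Lemma mul_flip (y : 'rV[R]_(p + 1)) : y *m flip = row_mx (lsubmx y) (- rsubmx y).
Proof. by rewrite -{1}(hsubmxK y) mul_row_block mulmx1 !mulmx0 addr0 add0r mulmxN mulmx1. Qed.

Lemma flip2 : flip *m flip = 1%:M.
Proof.
rewrite /flip mulmx_block !mulmx1 !mul1mx !mulmx0 !mul0mx !addr0 add0r mulNmx mulmxN mulmx1 opprK.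
by rewrite -scalar_mx_block.
Qed.

Lemma trflip : flip^T = flip.
Proof. by rewrite /flip tr_block_mx !trmx0 linearN /= !trmx1. Qed.

Lemma N1_flip (y : 'rV[R]_(p + 1)) : N1 (y *m flip) = N1 y.
Proof.
rewrite mul_flip /N1 !big_split_ord /=; congr (_ + _).
  by apply: eq_bigr => i _; rewrite row_mxEl mxE.
by apply: eq_bigr => i _; rewrite row_mxEr !mxE normrN.
Qed.

Lemma unitv_flip (y : 'rV[R]_(p + 1)) : unitv (y *m flip) = unitv y *m flip.
Proof. by rewrite /unitv N1_flip scalemxAl. Qed.

Lemma qf_flip x (y : 'rV[R]_(p + 1)) : cube q x -> qf (A (- x)) (y *m flip) = qf (A x) y.
Proof.
move=> Qx; rewrite /qf AN // trmx_mul trflip -(mulmxA y) AD // mulmxA -mulmxA (mulmxA flip).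
by rewrite flip2 mul1mx.
Qed.

Lemma flip_neq0 (y : 'rV[R]_(p + 1)) : y != 0 -> y *m flip != 0.
Proof. by apply: contra => /eqP E; rewrite -(mulmx1 y) -flip2 mulmxA E mul0mx. Qed.

Lemma cone_sg x : coneX x -> coneX (tsg sY x).
Proof.
move=> [Qx x0 xA]; split; [exact: cubeN|exact: flip_neq0|].
by rewrite /fv /sY /= qf_flip //.
Qed.

Lemma cone_ta x : coneX x -> coneX (fibmap opp x).
Proof. by move=> [Qx x0 xA]; split; rewrite /fv /fibmap /= ?oppr_eq0 ?qfN. Qed.

(** The lift is a gradient step for the form at the new base point. The base motion raises the form
    by at most [s c N1^2], the step lowers it by at least [2 s c N1^2] to first order, and the
    second order term is at most [s c N1^2]; so the cone is preserved. Equivariance holds because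
    [A] is even and commutes with [flip]. *)
Lemma cone_lift (e : R) : 0 < e -> exists2 d : R, 0 < d &
  forall (D : 'rV[R]_q -> Prop) phi, nonexp phi -> (forall x, D x -> cube q x) ->
    (forall x, D x -> D (phi x)) -> (forall x, D x -> vnear d (phi x) x) ->
    exists Phi : N -> ray R (p + 1), let F := fun m => (phi m.1, Phi m) : N in
    [/\ forall m, over coneX D m -> coneX (F m), ucont (over coneX D) F,
        forall k, inl k [:: opp] -> forall m, over coneX D m -> F (fibmap k m) = fibmap k (F m),
        forall m, over coneX D m -> near e m (F m) &
        forall m, over coneX D m -> D (- m.1) -> phi (- m.1) = - phi m.1 -> F (tsg sY m) = tsg sY (F m)].
Proof.
move=> e_gt0; have [C C0 AC] := Abd; have [c c0 Hc] := Ainv.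
have [L L0 AL] : exists2 L : R, 0 < L & forall x (y : 'rV[R]_(p + 1)), cube q x -> N1 (y *m A x) <= L * N1 y.
  exists ((p + 1)%:R * C); first by rewrite mulr_gt0 // ltr0n addn1.
  by move=> x y Qx; apply: N1_mul => i j; apply: AC.
have CL0 : 0 < C * L ^+ 2 by rewrite mulr_gt0 // exprn_gt0.
(* The bounds on [s] make the step keep half of the norm, move rays by less than [e], and have a
   second order term that the first order gain absorbs. The base radius is chosen afterwards, for
   the error [s c]. *)
have [s [s0 sL sLe sc]] : exists s : R, [/\ 0 < s, s * L <= 1 / 2%:R, s * L <= e / 4%:R & s * (C * L ^+ 2) <= c].
  have L2 : 0 < 2%:R * L by rewrite mulr_gt0.
  have L4 : 0 < 4%:R * L by rewrite mulr_gt0.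
  exists (Num.min (1 / (2%:R * L)) (Num.min (e / (4%:R * L)) (c / (C * L ^+ 2)))).
  set s := Num.min _ _; split.
  - by rewrite /s !lt_min (divr_gt0 c0 CL0) (divr_gt0 e_gt0 L4) (divr_gt0 ltr01 L2).
  - have : s <= 1 / (2%:R * L) by rewrite ge_min lexx.
    by rewrite ler_pdivlMr // => h; lra.
  - have : s <= e / (4%:R * L) by rewrite !ge_min lexx !orbT.
    by rewrite ler_pdivlMr // => h; lra.
  - have : s <= c / (C * L ^+ 2) by rewrite !ge_min lexx !orbT.
    by rewrite ler_pdivlMr.
have [d d0 Hd] := Ac (mulr_gt0 s0 c0); exists (Num.min d e); first by rewrite lt_min d0.
move=> D phi nphi DQ Dphi nearphi.
exists (fun m => fv m - s *: (fv m *m A (phi m.1))).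
pose B x := 1%:M - s *: A (phi x).
have FB m : fv m - s *: (fv m *m A (phi m.1)) = fv m *m B m.1.
  by rewrite /B mulmxBr mulmx1 scalemxAr.
have low (y : 'rV[R]_(p + 1)) x : D x -> 1 / 2%:R * N1 y <= N1 (y - s *: (y *m A (phi x))).
  move=> Dx; have := N1B y (s *: (y *m A (phi x))); rewrite N1Z gtr0_norm //.
  have h1 : s * N1 (y *m A (phi x)) <= s * L * N1 y.
    by rewrite -mulrA ler_pM2l //; apply/AL/DQ/Dphi.
  have h2 : s * L * N1 y <= 1 / 2%:R * N1 y by rewrite ler_wpM2r // N1_ge0.
  by move=> h3; lra.
split.
- move=> [x y] [[Qx y0 yA] Dx]; have Qp := DQ _ (Dphi _ Dx); split=> //.
    apply/eqP => E; have := low y x Dx; rewrite /fv /= in E; rewrite E N10.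
    by have := N1_gt0 y0; rewrite /fv /=; lra.
  rewrite /fv /= qfB //.
  have h1 : qf (A (phi x)) y <= s * c * N1 y ^+ 2.
    have -> : qf (A (phi x)) y = qf (A x) y + qf (A (phi x) - A x) y.
      by rewrite /qf mulmxBr mulmxBl [X in _ = _ + X]mxE [X in _ = _ + (_ + X)]mxE; lra.
    have : `|qf (A (phi x) - A x) y| <= s * c * N1 y ^+ 2.
      apply: qf_bound => i j; rewrite !mxE; apply: Hd => // k.
      by apply: lt_le_trans (nearphi _ Dx k) _; rewrite ge_min lexx.
    by move=> /(le_trans (ler_norm _)); move: yA; rewrite /fv /=; lra.
  have h2 := Hc (phi x) y Qp.
  have h3 : qf (A (phi x)) (y *m A (phi x)) <= C * L ^+ 2 * N1 y ^+ 2.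
    apply: le_trans (ler_norm _) _; apply: le_trans (qf_bound _ (AC _ Qp)) _.
    rewrite -mulrA; apply: ler_wpM2l; first exact: ltW.
    rewrite -exprMn; apply: lerXn2r; last exact: AL.
      by rewrite nnegrE N1_ge0.
    by rewrite nnegrE mulr_ge0 ?N1_ge0 // ltW.
  have h4 : s * (s * (C * L ^+ 2) * N1 y ^+ 2) <= s * (c * N1 y ^+ 2).
    by rewrite ler_pM2l // ler_wpM2r // sqr_ge0.
  have h5 : s ^+ 2 * qf (A (phi x)) (y *m A (phi x)) <= s * (c * N1 y ^+ 2).
    apply: le_trans h4; rewrite expr2 -mulrA ler_pM2l // -mulrA ler_pM2l //.
  have h6 : s * (c * N1 y ^+ 2) <= s * n2 (y *m A (phi x)) by rewrite ler_pM2l.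
  move: h1; rewrite -mulrA; lra.
- move=> e1 e10; have [C' C'0 BC'] : exists2 C' : R, 0 < C' & forall x, D x -> forall i j, `|B x i j| <= C'.
    exists (1 + s * C); first by rewrite addr_gt0 // mulr_gt0.
    move=> x Dx i j; rewrite !mxE; apply: le_trans (ler_normB _ _) _; apply: lerD.
      by case: (i == j); rewrite ?normr0 ?normr1.
    by rewrite normrM gtr0_norm // ler_pM2l //; apply/AC/DQ/Dphi.
  have half0 : (0 : R) < 1 / 2%:R by rewrite divr_gt0.
  have [||x y|d' d'0 Hd'] := @rnear_lin R q D _ _ B C' (1 / 2%:R)
        (fun x (y : 'rV[R]_(p + 1)) => [/\ D x, cube q x & y != 0]) half0 _ _ _ _ e10.
  + exact: BC'.
  + move=> e' e'0; have [d1 d10 Hd1] := Ac (divr_gt0 e'0 s0); exists d1 => // x x' Dx Dx' nx i j.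
    rewrite !mxE; have -> (a b b' : R) : a - s * b - (a - s * b') = s * (b' - b) by ring.
    rewrite normrM gtr0_norm // mulrC -ler_pdivlMr // distrC.
    by apply: Hd1; [apply/DQ/Dphi|apply/DQ/Dphi|apply: nphi].
  + case=> Dx Qx y0; split=> //; rewrite -(FB (x, y)); exact: low.
  exists (Num.min e1 d'); first by rewrite lt_min e10.
  move=> x y [[Qx x0 _] Dx] [[Qy y0 _] Dy] [nx ny]; split.
    by apply: nphi => i; apply: lt_le_trans (nx i) _; rewrite ge_min lexx.
  rewrite /= !FB; apply: Hd' => //.
    by move=> i; apply: lt_le_trans (nx i) _; rewrite ge_min lexx orbT.
  by apply: rnear_mono ny; rewrite ge_min lexx orbT.
- by move=> k [<-|//] m _; rewrite /fibmap /opp /fv /=; congr (_, _); rewrite mulNmx scalerN opprD.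
- move=> [x y] [[Qx y0 yA] Dx]; split=> [i|].
    by rewrite distrC; apply: lt_le_trans (nearphi _ Dx i) _; rewrite ge_min lexx orbT.
  rewrite /= /rnear /fv /=; have N0 := N1_gt0 y0; rewrite /fv /= in N0.
  have h : N1 (y - (y - s *: (y *m A (phi x)))) <= s * L * N1 (y : 'rV_(p + 1)).
    rewrite opprB addrCA subrr addr0 N1Z gtr0_norm // -mulrA ler_pM2l //.
    by apply/AL/DQ/Dphi.
  apply: le_lt_trans (unitv_lip N0 (lexx _) h) _.
  by rewrite mulrA mulfK ?gt_eqF //; lra.
- move=> [x y] [[Qx y0 yA] Dx] DNx E; rewrite /tsg /fv /= E; congr (_, _).
  rewrite /sY /= AN; last exact/DQ/Dphi.
  by rewrite mulmxBl -scalemxAl -!mulmxA AD //; apply/DQ/Dphi.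
Qed.

Lemma cube_neq0 (x : 'rV[R]_q) : cube q x -> x != 0.
Proof. by case=> _ [i xi] _; apply/eqP => x0; move: xi; rewrite x0 mxE normr0 => /esym/eqP; rewrite oner_eq0. Qed.

Let eps (x : N) : bool := lexneg x.1.
(** On [z = 0] the sign of [mu] is negated by both involutions. Adding the sign of [x], negated by
    [sigma] alone, leaves a function that only [tau] negates. *)
Let eta (x : N) : bool :=
  if lsubmx (fv x) == 0 then lexneg x.1 (+) (fv x 0 (rshift p 0) < 0) else lexneg (lsubmx (fv x)).
Let G : seq (N -> N) := [:: @tsg R q (ray R (p + 1)) sY; @fibmap R q (ray R (p + 1)) opp].

Lemma mu_neq0 (y : 'rV[R]_(p + 1)) : y != 0 -> lsubmx y = 0 -> y 0 (rshift p 0) != 0.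
Proof.
move=> y0 yl; apply: contra y0 => /eqP yr; rewrite -(hsubmxK y) yl.
suff -> : rsubmx y = 0 by rewrite row_mx0.
by apply/rowP=> i; rewrite !mxE ord1.
Qed.

Lemma flip_l (y : 'rV[R]_(p + 1)) i : (y *m flip) 0 (lshift 1 i) = y 0 (lshift 1 i).
Proof. by rewrite mul_flip row_mxEl mxE. Qed.

Lemma flip_r (y : 'rV[R]_(p + 1)) : (y *m flip) 0 (rshift p 0) = - y 0 (rshift p 0).
Proof. by rewrite mul_flip row_mxEr !mxE. Qed.

Lemma lsub_flip (y : 'rV[R]_(p + 1)) : lsubmx (y *m flip) = lsubmx y.
Proof. by apply/rowP=> i; rewrite !mxE -flip_l mxE. Qed.

Lemma eps_sg x : coneX x -> eps (tsg sY x) = ~~ eps x.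
Proof. by move=> [Qx _ _]; rewrite /eps lexnegN // cube_neq0. Qed.

Lemma eps_ta x : eps (fibmap opp x) = eps x.
Proof. by []. Qed.

Lemma eta_sg x : coneX x -> eta (tsg sY x) = eta x.
Proof.
move=> [Qx x0 _]; rewrite /eta /fv /sY /= lsub_flip flip_r; case: eqP => // xl.
rewrite lexnegN ?cube_neq0 // oppr_lt0 addNb.
have := mu_neq0 x0 xl; rewrite /fv /=.
by case: ltgtP => //= _ _; rewrite ?addbT ?addbF ?negbK.
Qed.

Lemma eta_ta x : coneX x -> eta (fibmap opp x) = ~~ eta x.
Proof.
move=> [Qx x0 _]; rewrite /eta /fv /opp /= linearN /= oppr_eq0; case: eqP => xl; last first.
  by rewrite lexnegN //; apply/eqP.
have := mu_neq0 x0 xl; rewrite /fv /= mxE oppr_lt0.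
by case: ltgtP => //= _ _; rewrite ?addbT ?addbF ?negbK.
Qed.

Lemma isoY : isom sY.
Proof.
move=> e y z; rewrite /= /rnear /sY !unitv_flip -mulmxBl N1_flip; exact.
Qed.

Lemma isoK : isom (fibmap opp : N -> N).
Proof.
move=> e x y [nx ny]; split=> //; move: ny; rewrite /= /rnear /opp !unitvN -opprD N1N; exact.
Qed.

Lemma sgn_cone_eps : sgnf G coneX eps.
Proof. by move=> k [<-|[<-|//]] x y Xx Xy; rewrite ?eps_sg ?eps_ta // addNb addbN negbK. Qed.

Lemma sgn_cone_eta : sgnf G coneX eta.
Proof. by move=> k [<-|[<-|//]] x y Xx Xy; rewrite ?eta_sg ?eta_ta // addNb addbN negbK. Qed.

Lemma cone_basis : basis eps (fun b => iter b (hst eta) (@one R N)) rho G coneX q.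
Proof.
have -> : coneX = over coneX (cube q).
  by apply/funext => x; apply/propext; split=> [Xx|[]] //; split=> //; case: Xx.
apply: (@cube_basis R q (ray R (p + 1)) coneX sY [:: opp] isoY) => //.
- exact: cone_sg.
- by move=> k [<-|//]; exact: cone_ta.
- by move=> y; rewrite /sY -mulmxA flip2 mulmx1.
- by move=> k [<-|//] y; rewrite /sY /opp mulNmx.
- exact: cone_lift.
- exact: eps_sg.
- by move=> k [<-|//] x _; apply: eps_ta.
- by move=> b; rewrite -(addn1 b); apply: cocyc_iter; [exact: sgn_cone_eta|exact: cocyc_one].
move=> j; have [P [U [c [UP Un Ur c0 Pl]]]] := pole j.
apply: (@pole_fbasis R q (p + 1) rho (delta_mx 0 j) (A (delta_mx 0 j)) P U c) => //.
  move=> [x y]; split; first by case=> -[Qx y0 yA] /= E; rewrite E in yA.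
  by move=> /= [-> y0 yA]; split=> //; split=> //; apply: cube_delta.
by move=> x [Xx _]; apply: eta_ta.
Qed.

Lemma fcont_coord i : fcont coneX (fun x => unitv (fv x) 0 i).
Proof.
move=> e e0; exists e => // x y _ _ [_ nxy].
by apply: le_lt_trans nxy; have := N1_coord (unitv (fv x) - unitv (fv y)) i; rewrite !mxE.
Qed.

Lemma fcont_w i : fcont coneX (fun x => (unitv (fv x) *m w x.1) 0 i).
Proof.
move=> e e0; have [C _ wC] := wbd.
have [d d0 Hd] := unitv_mul_unif wC wc (divr_gt0 e0 (ltr0n R 2)); exists d => //.
move=> x y [Qx _ _] [Qy y0 _] [nx ny]; apply: (@le_lt_trans _ _ (e / 2%:R)); last by lra.
apply: le_trans (Hd _ _ _ _ Qx Qy y0 nx ny).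
by have := N1_coord (unitv (fv x) *m w x.1 - unitv (fv y) *m w y.1) i; rewrite !mxE.
Qed.

Lemma unitvE (y : 'rV[R]_(p + 1)) i : unitv y 0 i = (N1 y)^-1 * y 0 i.
Proof. by rewrite mxE. Qed.

(** For normalized [y] the [q] coordinates of [y *m w x] are fixed by [sigma], because of [wD], and
    negated by [tau]; [wlow] keeps them from vanishing together. *)
Lemma wfun_exact : exact G coneX q.+1 (iter q (hst eta) (@one R N)).
Proof.
pose F i (x : N) : R := (unitv (fv x) *m w x.1) 0 i.
pose ps := [seq (F i, eta) | i <- enum 'I_q].
have sps : size ps = q by rewrite size_map size_enum_ord.
have -> : iter q (hst eta) (@one R N) = hprod (map snd ps) (@one R N).
  have E (l : seq 'I_q) : hprod (map snd [seq (F i, eta) | i <- l]) (@one R N)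
      = iter (size l) (hst eta) (@one R N) by elim: l => //= i l ->.
  by rewrite /ps E size_enum_ord.
have -> : q.+1 = (size ps + 1)%N by rewrite sps addn1.
have inps i : inl (F i, eta) ps.
  rewrite /ps; have := mem_enum 'I_q i; rewrite inE.
  by elim: (enum _) => //= j s IH; rewrite in_cons => /orP[/eqP->|/IH]; [left|right].
apply: hprod_exact; last exact: cocyc_one.
  move=> pr prs; have [i _ ->] := inl_map prs; split; [exact: fcont_w|exact: sgn_cone_eta|].
  move=> k [<-|[<-|//]] x Xx; [left|right]; have [Qx _ _] := Xx.
    by rewrite /F /fv /sY /= unitv_flip -mulmxA wD // eta_sg.
  by rewrite /F /fv /opp /= unitvN mulNmx mxE eta_ta.
have [c c0 Hc] := wlow; exists c => // x [Qx x0 xA].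
have [i Hi] := Hc _ _ Qx x0 xA; exists (F i, eta); first exact: inps.
have N0 := N1_gt0 x0.
rewrite /F /= /unitv -scalemxAl mxE normrM gtr0_norm ?invr_gt0 // mulrC ler_pdivlMr //.
Qed.

(** The coordinates of [z] have the character of [eta]. The last coordinate [mu] is negated by both
    involutions and so has that of [eps (+) eta]. *)
Lemma zfun_exact : exact G coneX p.+2 (hst (fun x => eps x (+) eta x) (iter p (hst eta) (@one R N))).
Proof.
pose F i (x : N) : R := unitv (fv x) 0 (lshift 1 i).
pose F0 (x : N) : R := unitv (fv x) 0 (rshift p 0).
pose ee x := eps x (+) eta x.
pose ps := (F0, ee) :: [seq (F i, eta) | i <- enum 'I_p].
have sps : size ps = p.+1 by rewrite /= size_map size_enum_ord.
have -> : hst (fun x => eps x (+) eta x) (iter p (hst eta) (@one R N)) = hprod (map snd ps) (@one R N).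
  have E (l : seq 'I_p) : hprod (map snd [seq (F i, eta) | i <- l]) (@one R N)
      = iter (size l) (hst eta) (@one R N) by elim: l => //= i l ->.
  by rewrite /ps [RHS]/= -/(hprod _ _) E size_enum_ord.
have -> : p.+2 = (size ps + 1)%N by rewrite sps addn1.
have inps i : inl (F i, eta) ps.
  right; have := mem_enum 'I_p i; rewrite inE.
  by elim: (enum _) => //= j s IH; rewrite in_cons => /orP[/eqP->|/IH]; [left|right].
apply: hprod_exact; last exact: cocyc_one.
  move=> pr [<-|prs].
    split; [exact: fcont_coord| |].
      move=> k kG x y Xx Xy; have := sgn_cone_eps kG Xx Xy; have := sgn_cone_eta kG Xx Xy.
      rewrite /ee /=; move: (eps _) (eps _) (eps _) (eps _) (eta _) (eta _) (eta _) (eta _).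
      by do 8!case.
    move=> k [<-|[<-|//]] x Xx; right; rewrite /ee /F0 /fv /sY /opp /=.
      by rewrite unitv_flip flip_r eps_sg // eta_sg // addNb.
    by rewrite unitvN mxE eps_ta eta_ta // addbN.
  have [i _ ->] := inl_map prs; split; [exact: fcont_coord|exact: sgn_cone_eta|].
  move=> k [<-|[<-|//]] x Xx; [left|right]; rewrite /F /fv /sY /opp /=.
    by rewrite unitv_flip flip_l eta_sg.
  by rewrite unitvN mxE eta_ta.
exists (p + 1)%:R^-1; first by rewrite invr_gt0 ltr0n addn1.
move=> x [Qx x0 xA]; have N0 := N1_gt0 x0; have [i Hi] := N1_large x0.
have pp : (0 : R) < (p + 1)%:R by rewrite ltr0n addn1.
have Hi' : (p + 1)%:R^-1 <= `|unitv (fv x) 0 i|.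
  rewrite unitvE normrM gtr0_norm ?invr_gt0 // mulrC ler_pdivlMr // mulrC.
  by rewrite ler_pdivrMr // mulrC.
case: (split_ordP i) Hi' => j -> Hi'; first by exists (F j, eta); [exact: inps|].
by exists (F0, ee); [left|rewrite /= /F0; move: Hi'; rewrite ord1].
Qed.

Theorem cone_contradiction : False.
Proof.
pose lst : 'rV[R]_(p + 1) := delta_mx 0 (rshift p 0).
pose sec (m : sph R q) : N := (m.1, lst).
have lst0 : lst != 0.
  by apply/eqP => /rowP/(_ (rshift p 0)); rewrite !mxE !eqxx => /eqP; rewrite oner_eq0.
have qfl x : qf (A x) lst = A x (rshift p 0) (rshift p 0).
  by rewrite /qf -rowE /lst trmx_delta -colE !mxE.
apply: (@top_contradiction R p q rho N coneX (tsg sY) (fibmap opp) eps eta sec) => //.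
- exact: cone_ta.
- exact: isoK.
- exact: eps_sg.
- exact: eta_sg.
- exact: eta_ta.
- exact: cone_basis.
- exact: zfun_exact.
- exact: wfun_exact.
- move=> e e0; exists e => // x y _ _ [nxy _]; split=> //=; exact: rnear_refl.
- by move=> m Qm; split=> //=; rewrite /fv /= qfl; apply: Amu.
(* [sigma] turns the fibre coordinate 1 of the section into -1, and [tau] turns it back. *)
move=> m Qm; rewrite /sec /tsg /fibmap /sY /opp /=; congr (_, _).
apply/rowP=> i; rewrite mulNmx [RHS]mxE; case: (split_ordP i) => j ->.
  by rewrite flip_l /lst !mxE eq_lrshift andbF oppr0.
by rewrite ord1 flip_r opprK.
Qed.
End Cone.

(** * Compactness *)

Section Compactness.
Local Open Scope classical_set_scope.
Variable R : realType.

Lemma nbhs_vnear N (x : 'rV[R]_N) (S : set 'rV[R]_N) :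
  nbhs x S <-> exists2 d : R, 0 < d & forall x', vnear d x x' -> S x'.
Proof.
split=> [/nbhs_ballP[d d0 H]|[d d0 H]]; last (apply/nbhs_ballP); exists d => // x' H'; apply: H.
  by split=> // i j; rewrite ord1 /ball /=; apply: H'.
by move=> i; case: H' => _ /(_ 0 i).
Qed.

Definition vopen N (U : 'rV[R]_N -> Prop) :=
  forall x, U x -> exists2 d : R, 0 < d & forall x', vnear d x x' -> U x'.

(** Compactness of the box, for properties that weaken as the constant decreases: constants valid
    locally combine into one. In the local hypothesis [d] is both the radius and the constant. *)
Lemma local_global N (K : 'rV[R]_N -> Prop) (P : R -> 'rV[R]_N -> Prop) :
  (forall x, K x -> forall i, `|x 0 i| <= 1) -> vopen (fun x => ~ K x) ->
  (forall c c' x, c' <= c -> P c x -> P c' x) ->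
  (forall x, K x -> exists2 d, 0 < d & forall x', vnear d x x' -> K x' -> P d x') ->
  exists2 c, 0 < c & forall x, K x -> P c x.
Proof.
move=> K1 Kc Pa PL.
pose B := [set v : 'rV[R]_N | forall i, `[-1, 1] (v ord0 i)].
have cB : compact B by apply: (@rV_compact R N (fun=> `[-1, 1])) => i; apply: segment_compact.
have H x : B x -> \forall x' \near x & c \near 0^'+, K x' -> P c x'.
  have [d d0 Hd] : exists2 d, 0 < d & forall x', vnear d x x' -> K x' -> P d x'.
    have [Kx|/Kc[d d0 Hd]] := pselect (K x); first exact: PL.
    by exists d => // x' /Hd nK /nK.
  move=> _; exists ([set x' | vnear d x x'], [set c | c <= d]) => /=.
    by split; [apply/nbhs_vnear; exists d|exact: nbhs_right_le].
  by move=> [x' c] [/= nx cd] /(Hd _ nx); apply: Pa.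
have {}H := (compact_near_coveringP _).1 cB _ (0^'+) (fun c x => K x -> P c x) _ H.
near (0 : R)^'+ => c; exists c; first by near: c; exact: nbhs_right_gt.
move=> x Kx; have h : B `<=` fun x => K x -> P c x by near: c; exact: H.
by apply: h => //; rewrite /B /= => i; rewrite in_itv /= -ler_norml; apply: K1.
Unshelve. all: by end_near.
Qed.

Lemma continuousPe N (x : 'rV[R]_N) (f : 'rV[R]_N -> R) :
  {for x, continuous f} <-> forall e : R, 0 < e ->
    exists2 d : R, 0 < d & forall x', vnear d x x' -> `|f x - f x'| <= e.
Proof.
split=> [/cvgrPdist_le H e e0|H]; first by apply/nbhs_vnear; apply: H.
by apply/(@cvgrPdist_le _ _ _ _ (nbhs_filter x)) => e /H h; apply/nbhs_vnear.
Qed.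

Lemma vnear_mono N (d d' : R) (x x' : 'rV[R]_N) : d <= d' -> vnear d x x' -> vnear d' x x'.
Proof. by move=> dd nx i; apply: lt_le_trans (nx i) dd. Qed.

Lemma fin_delta (I : finType) N (x : 'rV[R]_N) (S : I -> 'rV[R]_N -> Prop) :
  (forall i, exists2 d : R, 0 < d & forall x', vnear d x x' -> S i x') ->
  exists2 d : R, 0 < d & forall x', vnear d x x' -> forall i, S i x'.
Proof.
move=> H; have {}H i : nbhs x (S i) by apply/nbhs_vnear; apply: H.
apply/nbhs_vnear; exact: (@filter_forall _ _ S (nbhs x) (nbhs_filter x) H).
Qed.

Definition mctn N (x : 'rV[R]_N) m n (B : 'rV[R]_N -> 'M[R]_(m, n)) :=
  forall i j, {for x, continuous (fun z => B z i j)}.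

Lemma mctn_eps N (x : 'rV[R]_N) m n (B : 'rV[R]_N -> 'M[R]_(m, n)) : mctn x B ->
  forall e : R, 0 < e ->
    exists2 d : R, 0 < d & forall x', vnear d x x' -> forall i j, `|B x i j - B x' i j| <= e.
Proof.
move=> Bc e e0; have [|d d0 Hd] := @fin_delta ('I_m * 'I_n)%type N x
    (fun ij x' => `|B x ij.1 ij.2 - B x' ij.1 ij.2| <= e).
  by move=> [i j] /=; have /continuousPe := Bc i j; apply.
by exists d => // x' /Hd + i j => /(_ (i, j)).
Qed.

Lemma mctn_mcont N (K : 'rV[R]_N -> Prop) m n (B : 'rV[R]_N -> 'M[R]_(m, n)) :
  (forall x, K x -> forall i, `|x 0 i| <= 1) -> vopen (fun x => ~ K x) ->
  (forall x, K x -> mctn x B) -> mcont K B.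
Proof.
move=> K1 Kc Bc e e0.
have [|x Kx|c c0 Hc] := @local_global N K (fun c x =>
    forall x', K x' -> vnear c x x' -> forall i j, `|B x i j - B x' i j| <= e) K1 Kc.
- by move=> c c' x cc H x' Kx' nx; apply: H => //; apply: vnear_mono nx.
- have [d d0 Hd] := mctn_eps (Bc _ Kx) (divr_gt0 e0 (ltr0n R 2)).
  exists (d / 2%:R); first by rewrite divr_gt0.
  move=> x' nx Kx' x'' Kx'' nx' i j.
  have h1 : `|B x i j - B x' i j| <= e / 2%:R.
    by apply: Hd; apply: vnear_mono nx; lra.
  have h2 : `|B x i j - B x'' i j| <= e / 2%:R.
    apply: Hd => k; have := nx k; have := nx' k.
    have := ler_normD (x 0 k - x' 0 k) (x' 0 k - x'' 0 k); rewrite addrA subrK; lra.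
  have := ler_normB (B x i j - B x'' i j) (B x i j - B x' i j).
  have -> : B x i j - B x'' i j - (B x i j - B x' i j) = B x' i j - B x'' i j by ring.
  lra.
by exists c => // x x' Kx Kx' nx; apply: Hc.
Qed.

Lemma mctn_bounded N (K : 'rV[R]_N -> Prop) m n (B : 'rV[R]_N -> 'M[R]_(m, n)) :
  (forall x, K x -> forall i, `|x 0 i| <= 1) -> vopen (fun x => ~ K x) ->
  (forall x, K x -> mctn x B) -> exists2 C : R, 0 < C & forall x, K x -> forall i j, `|B x i j| <= C.
Proof.
move=> K1 Kc Bc.
have [|x Kx|c c0 Hc] := @local_global N K (fun c x =>
    forall i j, c * `|B x i j| <= 1) K1 Kc.
- by move=> c c' x cc H i j; apply: le_trans (H i j); rewrite ler_wpM2r.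
- have [d d0 Hd] := mctn_eps (Bc _ Kx) ltr01; have [C C0 HC] := mx_bounded (B x).
  exists (Num.min d (C + 1)^-1); first by rewrite lt_min d0 invr_gt0; lra.
  move=> x' nx Kx' i j.
  have h : `|B x' i j| <= C + 1.
    have := ler_normB (B x i j) (B x i j - B x' i j); have := HC i j.
    have : `|B x i j - B x' i j| <= 1 by apply: Hd; apply: vnear_mono nx; rewrite ge_min lexx.
    have -> : B x i j - (B x i j - B x' i j) = B x' i j by ring.
    lra.
  apply: (@le_trans _ _ ((C + 1)^-1 * `|B x' i j|)).
    by rewrite ler_wpM2r // ge_min lexx orbT.
  by rewrite mulrC ler_pdivrMr ?mul1r //; lra.
exists c^-1; first by rewrite invr_gt0.
by move=> x Kx i j; rewrite -[c^-1]mul1r ler_pdivlMr // mulrC; apply: Hc.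
Qed.

Section Closure.
Variables (N : nat) (x : 'rV[R]_N).

Lemma mctn_cst m n (B : 'M[R]_(m, n)) : mctn x (fun=> B).
Proof. by move=> i j; apply: cst_continuous. Qed.

Lemma mctn_id : mctn x id.
Proof. by move=> i j; apply: coord_continuous. Qed.

Lemma mctn_tr m n (B : 'rV[R]_N -> 'M[R]_(m, n)) : mctn x B -> mctn x (fun z => (B z)^T).
Proof.
move=> Bc i j; rewrite (_ : (fun z => _) = fun z => B z j i) ?Bc //.
by apply/funext => z; rewrite mxE.
Qed.

Lemma mctnD m n (B C : 'rV[R]_N -> 'M[R]_(m, n)) :
  mctn x B -> mctn x C -> mctn x (fun z => B z + C z).
Proof.
move=> Bc Cc i j; rewrite (_ : (fun z => _) = (fun z => B z i j) \+ (fun z => C z i j)).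
  by apply: continuousD; [apply: Bc|apply: Cc].
by apply/funext => z; rewrite mxE.
Qed.

Lemma mctnZ m n (f : 'rV[R]_N -> R) (B : 'rV[R]_N -> 'M[R]_(m, n)) :
  {for x, continuous f} -> mctn x B -> mctn x (fun z => f z *: B z).
Proof.
move=> fc Bc i j; rewrite (_ : (fun z => _) = f \* (fun z => B z i j)).
  by apply: continuousM => //; apply: Bc.
by apply/funext => z; rewrite mxE.
Qed.

Lemma mctnN m n (B : 'rV[R]_N -> 'M[R]_(m, n)) : mctn x B -> mctn x (fun z => - B z).
Proof.
move=> Bc; rewrite (_ : (fun z => _) = fun z => (-1) *: B z); last first.
  by apply/funext => z; rewrite scaleN1r.
by apply: mctnZ => //; apply: cst_continuous.
Qed.

Lemma continuous_sumr (I : Type) (r : seq I) (F : I -> 'rV[R]_N -> R) :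
  (forall i, {for x, continuous (F i)}) -> {for x, continuous (fun z => \sum_(i <- r) F i z)}.
Proof.
move=> Fc; elim: r => [|i r IH].
  rewrite (_ : (fun z => _) = fun=> 0); first exact: cst_continuous.
  by apply/funext => z; rewrite big_nil.
rewrite (_ : (fun z => _) = F i \+ (fun z => \sum_(i <- r) F i z)); first exact: continuousD.
by apply/funext => z; rewrite big_cons.
Qed.

Lemma mctnM m n k (B : 'rV[R]_N -> 'M[R]_(m, n)) (C : 'rV[R]_N -> 'M[R]_(n, k)) :
  mctn x B -> mctn x C -> mctn x (fun z => B z *m C z).
Proof.
move=> Bc Cc i j; rewrite (_ : (fun z => _) = fun z => \sum_l B z i l * C z l j).
  by apply: continuous_sumr => l; apply: continuousM; [apply: Bc|apply: Cc].
by apply/funext => z; rewrite mxE.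
Qed.

Lemma mctn_block m1 m2 n1 n2 (A : 'rV[R]_N -> 'M[R]_(m1, n1)) (B : 'rV[R]_N -> 'M[R]_(m1, n2))
    (C : 'rV[R]_N -> 'M[R]_(m2, n1)) (D : 'rV[R]_N -> 'M[R]_(m2, n2)) :
  mctn x A -> mctn x B -> mctn x C -> mctn x D ->
  mctn x (fun z => block_mx (A z) (B z) (C z) (D z)).
Proof.
move=> Ac Bc Cc Dc i j; case: (split_ordP i) => i' ->; case: (split_ordP j) => j' ->.
- by rewrite (_ : (fun z => _) = fun z => A z i' j') ?Ac //; apply/funext => z; rewrite block_mxEul.
- by rewrite (_ : (fun z => _) = fun z => B z i' j') ?Bc //; apply/funext => z; rewrite block_mxEur.
- by rewrite (_ : (fun z => _) = fun z => C z i' j') ?Cc //; apply/funext => z; rewrite block_mxEdl.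
by rewrite (_ : (fun z => _) = fun z => D z i' j') ?Dc //; apply/funext => z; rewrite block_mxEdr.
Qed.

Lemma mctn_col m1 m2 n1 (A : 'rV[R]_N -> 'M[R]_(m1, n1)) (B : 'rV[R]_N -> 'M[R]_(m2, n1)) :
  mctn x A -> mctn x B -> mctn x (fun z => col_mx (A z) (B z)).
Proof.
move=> Ac Bc i j; case: (split_ordP i) => i' ->.
- by rewrite (_ : (fun z => _) = fun z => A z i' j) ?Ac //; apply/funext => z; rewrite col_mxEu.
by rewrite (_ : (fun z => _) = fun z => B z i' j) ?Bc //; apply/funext => z; rewrite col_mxEd.
Qed.

Lemma mctn_horner n (h : {poly R}) (B : 'rV[R]_N -> 'M[R]_n.+1) :
  mctn x B -> mctn x (fun z => horner_mx (B z) h).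
Proof.
move=> Bc; elim/poly_ind: h => [|h c IH].
  by rewrite (_ : (fun z => _) = fun=> 0); [exact: mctn_cst|apply/funext => z; rewrite rmorph0].
rewrite (_ : (fun z => _) = fun z => horner_mx (B z) h *m B z + c%:M).
  by apply: mctnD; [apply: mctnM|apply: mctn_cst].
by apply/funext => z; rewrite rmorphD rmorphM /= horner_mx_X horner_mx_C.
Qed.
End Closure.

Lemma mctn_comp N N' (x : 'rV[R]_N) (g : 'rV[R]_N -> 'rV[R]_N') m n (B : 'rV[R]_N' -> 'M[R]_(m, n)) :
  mctn x g -> mctn (g x) B -> mctn x (fun z => B (g z)).
Proof.
move=> gc Bc i j; apply/continuousPe => e e0; have [d d0 Hd] := mctn_eps Bc e0.
have [d' d'0 Hd'] := mctn_eps gc (divr_gt0 d0 (ltr0n R 2)).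
exists d' => // x' /Hd' nx; apply: Hd => k.
by apply: le_lt_trans (nx 0 k) _; lra.
Qed.

Lemma mctn_lsub N1 N2 (x : 'rV[R]_(N1 + N2)) : mctn x lsubmx.
Proof.
move=> i j; rewrite (_ : (fun z => _) = fun z : 'rV[R]_(N1 + N2) => z i (lshift N2 j)); first exact: coord_continuous.
by apply/funext => z; rewrite mxE.
Qed.

Lemma mctn_rsub N1 N2 (x : 'rV[R]_(N1 + N2)) : mctn x rsubmx.
Proof.
move=> i j; rewrite (_ : (fun z => _) = fun z : 'rV[R]_(N1 + N2) => z i (rshift N1 j)); first exact: coord_continuous.
by apply/funext => z; rewrite mxE.
Qed.

Lemma mctn_N1 N (x : 'rV[R]_N) m (B : 'rV[R]_N -> 'rV[R]_m) :
  mctn x B -> {for x, continuous (fun z => N1 (B z))}.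
Proof.
move=> Bc; apply: continuous_sumr => i.
apply: (@continuous_comp _ _ _ (fun z => B z 0 i) Num.norm); first exact: Bc.
exact: norm_continuous.
Qed.

Lemma continuous_nsup N (x : 'rV[R]_N) : {for x, continuous (@nsup R N)}.
Proof.
apply/continuousPe => e e0; have N0 : (0 : R) < N.+1%:R by rewrite ltr0n.
exists (e / N.+1%:R); first by rewrite divr_gt0.
move=> x' nx; apply: le_trans (nsup_N1 _ _) _; apply: le_trans (N1_nsup _) _.
apply: (@le_trans _ _ (N.+1%:R * (e / N.+1%:R))); last first.
  by rewrite mulrC divfK // gt_eqF.
apply: ler_pM => //; rewrite ?nsup_ge0 ?ler_nat //.
apply: nsup_le => [|i]; first by rewrite ltW // divr_gt0.
by rewrite !mxE ltW.
Qed.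

Lemma vopen_neq N (f : 'rV[R]_N -> R) a : (forall x, {for x, continuous f}) ->
  vopen (fun x => f x != a).
Proof.
move=> fc x; rewrite -subr_eq0 -normr_gt0 => fx.
have /continuousPe/(_ _ (divr_gt0 fx (ltr0n R 2)))[d d0 Hd] := fc x.
exists d => // x' /Hd h; apply: contraTneq fx => fx'; rewrite -leNgt.
by move: h; rewrite fx'; lra.
Qed.

Lemma cubeE q (x : 'rV[R]_q) : cube q x <-> nsup x = 1.
Proof.
split=> [[x1 [i xi] _]|x1].
  by apply/eqP; rewrite eq_le -{2}xi nsup_ge andbT; apply: nsup_le.
have x0 : x != 0.
  apply: contra_eq_neq x1 => ->; rewrite lt_eqF // (@le_lt_trans _ _ 0) //.
  by apply: nsup_le => // i; rewrite mxE normr0.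
by have := cube_nsup x0; rewrite x1 invr1 scale1r.
Qed.

Lemma vopen_cube q : vopen (fun x : 'rV[R]_q => ~ cube q x).
Proof.
move=> x /cubeE/eqP; rewrite -/(is_true (_ != _)) => /(vopen_neq (@continuous_nsup q))[d d0 Hd].
by exists d => // x' /Hd /eqP h /cubeE.
Qed.

Lemma cube_box q (x : 'rV[R]_q) : cube q x -> forall i, `|x 0 i| <= 1.
Proof. by case. Qed.

Lemma mctn_qf N (x : 'rV[R]_N) m (A : 'rV[R]_N -> 'M[R]_m) (y : 'rV[R]_N -> 'rV[R]_m) :
  mctn x A -> mctn x y -> {for x, continuous (fun z => qf (A z) (y z))}.
Proof.
by move=> Ac yc; apply: (mctnM (mctnM yc Ac) (mctn_tr yc)).
Qed.

(** Both sides are homogeneous in [y], so [N1 y = 1] may be assumed. The remaining pairs [(x, y)],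
    written as one row vector for [local_global], form a compact set on which the continuous
    function [N1 (y *m B x)] is positive. *)
Lemma family_lower q m k (A : 'rV[R]_q -> 'M[R]_m) (B : 'rV[R]_q -> 'M[R]_(m, k)) :
  (forall x, cube q x -> mctn x A) -> (forall x, cube q x -> mctn x B) ->
  (forall x y, cube q x -> y != 0 -> qf (A x) y <= 0 -> y *m B x != 0) ->
  exists2 c : R, 0 < c &
    forall x y, cube q x -> qf (A x) y <= 0 -> c * N1 y <= N1 (y *m B x).
Proof.
move=> Ac Bc H.
pose K (v : 'rV[R]_(q + m)) :=
  [/\ cube q (lsubmx v), N1 (rsubmx v) = 1 & qf (A (lsubmx v)) (rsubmx v) <= 0].
have [||||c c0 Hc] := @local_global _ K (fun c v => c <= N1 (rsubmx v *m B (lsubmx v))).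
- move=> v [cv rv _] i; case: (split_ordP i) => j ->.
    by have [/(_ j)] := cv; rewrite mxE.
  by rewrite -rv; have := N1_coord (rsubmx v) j; rewrite mxE.
- move=> v nK; have [cv|] := pselect (cube q (lsubmx v)); last first.
    move=> /vopen_cube [d d0 Hd]; exists d => // v' nv [cv' _ _]; apply: Hd cv' => i.
    by rewrite !mxE.
  have [rv|] := eqVneq (N1 (rsubmx v)) 1; last first.
    have fc (z : 'rV[R]_(q + m)) : {for z, continuous (fun z => N1 (@rsubmx _ _ q m z))}.
      by apply: mctn_N1; apply: mctn_rsub.
    move=> /(vopen_neq fc)[d d0 Hd]; exists d => // v' /Hd/eqP n1 [_ + _].
    by move=> /n1.
  have qv : 0 < qf (A (lsubmx v)) (rsubmx v) by rewrite ltNge; apply/negP => qv; apply: nK.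
  have /continuousPe/(_ _ (divr_gt0 qv (ltr0n R 2)))[d d0 Hd] :=
    mctn_qf (mctn_comp (@mctn_lsub q m v) (Ac _ cv)) (@mctn_rsub q m v).
  by exists d => // v' /Hd h [_ _ h']; move: h; rewrite ler_norml => /andP[]; lra.
- by move=> c c' v cc; apply: le_trans.
- move=> v [cv rv qv].
  have L0 : 0 < N1 (rsubmx v *m B (lsubmx v)).
    by apply/N1_gt0/H => //; apply: contra_eq_neq rv => ->; rewrite N10 eq_sym oner_eq0.
  have /continuousPe/(_ _ (divr_gt0 L0 (ltr0n R 2)))[d d0 Hd] :=
    mctn_N1 (mctnM (@mctn_rsub q m v) (mctn_comp (@mctn_lsub q m v) (Bc _ cv))).
  exists (Num.min d (N1 (rsubmx v *m B (lsubmx v)) / 2%:R)); first by rewrite lt_min d0 divr_gt0.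
  move=> v' nv _; rewrite ge_min; apply/orP; right.
  have /Hd : vnear d v v' by apply: vnear_mono nv; rewrite ge_min lexx.
  by rewrite ler_norml => /andP[]; lra.
exists c => // x y cx qy; have [->|y0] := eqVneq y 0; first by rewrite N10 mulr0 N1_ge0.
have n0 := N1_gt0 y0.
have : c <= N1 ((N1 y)^-1 *: y *m B x).
  have := Hc (row_mx x ((N1 y)^-1 *: y)); rewrite /K row_mxKl row_mxKr; apply; split=> //.
    exact: N1_unitv.
  by rewrite qfZ pmulr_rle0 // exprn_gt0 // invr_gt0.
by rewrite -scalemxAl N1Z gtr0_norm ?invr_gt0 // mulrC ler_pdivlMr.
Qed.

End Compactness.

(** * Quadratic forms *)

Section Forms.
Variable R : realType.

Lemma row_base_neq0 m n (U : 'M[R]_(m, n)) (u : 'rV[R]_(\rank U)) : u != 0 -> u *m row_base U != 0.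
Proof.
have := row_base_free U; rewrite -kermx_eq0 => /eqP k0.
by apply: contra => /eqP/sub_kermxP; rewrite k0 submx0.
Qed.

Lemma qf0 m (S : 'M[R]_m) : qf S 0 = 0.
Proof. by rewrite /qf !mul0mx mxE. Qed.

Lemma formDl m (S : 'M[R]_m) u v w : form S (u + v) w = form S u w + form S v w.
Proof. by rewrite /form !mulmxDl mxE. Qed.
Lemma formDr m (S : 'M[R]_m) u v w : form S u (v + w) = form S u v + form S u w.
Proof. by rewrite /form linearD mulmxDr mxE. Qed.
Lemma formZl m (S : 'M[R]_m) a u v : form S (a *: u) v = a * form S u v.
Proof. by rewrite /form -!scalemxAl mxE. Qed.
Lemma formZr m (S : 'M[R]_m) a u v : form S u (a *: v) = a * form S u v.
Proof. by rewrite /form linearZ -scalemxAr mxE. Qed.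
Lemma formC m (S : 'M[R]_m) u v : S^T = S -> form S u v = form S v u.
Proof.
move=> ST; rewrite /form -[in RHS]ST.
have -> : v *m S^T *m u^T = (u *m S *m v^T)^T by rewrite !trmx_mul trmxK mulmxA.
by rewrite [RHS]mxE.
Qed.
Lemma qfD m (S : 'M[R]_m) u v : S^T = S -> qf S (u + v) = qf S u + 2%:R * form S u v + qf S v.
Proof.
move=> ST; rewrite -![qf _ _]/(form _ _ _) formDl !formDr (formC v u ST); ring.
Qed.

Lemma qf_mul m k (S : 'M[R]_m) (B : 'M[R]_(k, m)) u : qf S (u *m B) = qf (B *m S *m B^T) u.
Proof. by rewrite /qf trmx_mul !mulmxA. Qed.

Lemma qf_addl m (S S' : 'M[R]_m) u : qf (S + S') u = qf S u + qf S' u.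
Proof. by rewrite /qf mulmxDr mulmxDl mxE. Qed.

Lemma qf_scalar m a (u : 'rV[R]_m) : qf a%:M u = a * n2 u.
Proof. by rewrite /qf mul_mx_scalar -scalemxAl mxE. Qed.

Lemma n2_ge0 m (u : 'rV[R]_m) : 0 <= n2 u.
Proof. by rewrite n2E; apply: sumr_ge0 => i _; apply: sqr_ge0. Qed.

Lemma n2_gt0 m (u : 'rV[R]_m) : u != 0 -> 0 < n2 u.
Proof.
move=> u0; rewrite lt_def n2_ge0 andbT; apply: contra u0; rewrite n2E psumr_eq0; last first.
  by move=> i _; apply: sqr_ge0.
move=> /allP H; apply/eqP/rowP => i; rewrite mxE; apply/eqP.
by have := H i (mem_index_enum _); rewrite /= sqrf_eq0.
Qed.

Lemma N1_n2 m (u : 'rV[R]_m) : N1 u ^+ 2 <= m%:R ^+ 2 * n2 u.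
Proof.
have [->|u0] := eqVneq u 0; first by rewrite N10 expr0n /= mulr_ge0 ?exprn_ge0 ?n2_ge0.
have [i Hi] := N1_large u0.
apply: (@le_trans _ _ ((m%:R * `|u 0 i|) ^+ 2)).
  by rewrite ler_pXn2r // ?nnegrE ?N1_ge0 // mulr_ge0.
rewrite exprMn ler_wpM2l ?exprn_ge0 // n2E real_normK ?num_real //.
by rewrite (bigD1 i) //= lerDl; apply: sumr_ge0 => j _; apply: sqr_ge0.
Qed.

Definition negdef m k (S : 'M[R]_m) (F : 'M[R]_(k, m)) := forall u, u != 0 -> qf S (u *m F) < 0.

Definition negidx m (S : 'M[R]_m) r :=
  (exists F : 'M[R]_(r, m), negdef S F) /\ forall k (F : 'M[R]_(k, m)), negdef S F -> (k <= r)%N.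

Lemma negdef_bound m (N : 'M[R]_m) : (forall u, u != 0 -> qf N u < 0) ->
  exists2 b : R, 0 < b & forall u, qf N u <= - (b * N1 u ^+ 2).
Proof.
move=> Nn; have [||||b b0 Hb] := @local_global R m (fun u => N1 u = 1)
  (fun b u => qf N u <= - b).
- by move=> u u1 i; rewrite -u1 N1_coord.
- move=> u /eqP; rewrite -/(is_true (_ != _)) => u1.
  have fc (z : 'rV[R]_m) : {for z, continuous (fun z : 'rV[R]_m => N1 z)}.
    by apply: (@mctn_N1 R m z m id); apply: mctn_id.
  by have [d d0 Hd] := vopen_neq fc u1; exists d => // x' /Hd/eqP.
- by move=> c c' x cc /le_trans; apply; rewrite lerN2.
- move=> u u1; have q0 : qf N u < 0.
    by apply: Nn; apply: contra_eq_neq u1 => ->; rewrite N10 eq_sym oner_eq0.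
  have q0' : 0 < - qf N u by rewrite oppr_gt0.
  have /continuousPe/(_ _ (divr_gt0 q0' (ltr0n R 2)))[d d0 Hd] :=
    mctn_qf (@mctn_cst R m u m m N) (@mctn_id R m u).
  exists (Num.min d (- qf N u / 2%:R)); first by rewrite lt_min d0 divr_gt0.
  move=> x' nx _; have := Hd x'; rewrite ler_norml => /(_ _)/andP[].
    by apply: vnear_mono nx; rewrite ge_min lexx.
  have : Num.min d (- qf N u / 2%:R) <= - qf N u / 2%:R by rewrite ge_min lexx orbT.
  by move: (Num.min _ _) => M; lra.
exists b => // u; have [->|u0] := eqVneq u 0.
  by rewrite N10 expr0n /= mulr0 oppr0 /qf !mul0mx mxE.
have n0 := N1_gt0 u0; have := Hb _ (N1_unitv u0).
rewrite qfZ exprVn => h; rewrite -mulNr -ler_pdivrMr ?exprn_gt0 // mulrC //.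
Qed.

Lemma nonneg_lin (a b : R) : (forall s, 0 <= 2%:R * s * b + s ^+ 2 * a) -> b = 0.
Proof.
move=> H; have a0 : 0 <= `|a| + 1 by rewrite addr_ge0.
have a1 : `|a| + 1 != 0 by rewrite gt_eqF // ltr_wpDl.
(* The critical point of the quadratic would be -b / a; the larger denominator 1 + |a| admits a = 0
   and still gives a negative value unless b = 0. *)
have := H (- b / (`|a| + 1)).
have -> : 2%:R * (- b / (`|a| + 1)) * b + (- b / (`|a| + 1)) ^+ 2 * a =
    - (b ^+ 2 * (2%:R * (`|a| + 1) - a)) / (`|a| + 1) ^+ 2 by field.
have h : 0 < 2%:R * (`|a| + 1) - a by have := ler_norm a; have := normr_ge0 a; lra.
rewrite pmulr_lge0 ?invr_gt0 ?exprn_gt0 ?lt_def ?a1 // oppr_ge0 pmulr_lle0 // => b0.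
by apply/eqP; rewrite -sqrf_eq0 eq_le b0 sqr_ge0.
Qed.

Lemma negdef_col m r (S : 'M[R]_m) (F : 'M[R]_(r, m)) (y : 'rV[R]_m) :
  (forall u s, (u != 0) || (s != 0) -> qf S (u *m F + s *: y) < 0) -> negdef S (col_mx F y).
Proof.
move=> H u u0; rewrite -[u]hsubmxK mul_row_col.
have -> : rsubmx u *m y = (rsubmx u 0 0) *: y.
  by rewrite {1}[rsubmx u]mx11_scalar mul_scalar_mx.
apply: H; rewrite -negb_and; apply: contra u0 => /andP[/eqP l0 /eqP r0].
by rewrite -[u]hsubmxK l0 [rsubmx u]mx11_scalar r0 raddf0 row_mx0.
Qed.

Lemma negdef_mono m k (S : 'M[R]_m) c (F : 'M[R]_(k, m)) : 0 <= c -> negdef (S + c%:M) F -> negdef S F.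
Proof.
move=> c0 H u /H; rewrite qf_addl qf_scalar; apply: le_lt_trans.
by rewrite lerDl mulr_ge0 // n2_ge0.
Qed.

Lemma form_neg_def (m k : nat) (S : 'M[R]_m) (F : 'M[R]_(k, m)) :
  negdef S F -> F *m S *m F^T \in unitmx.
Proof.
move=> Fn; rewrite -row_free_unit -kermx_eq0; apply/rowV0P => u /sub_kermxP uN.
apply/eqP/negPn/negP => /Fn; rewrite qf_mul /qf uN mul0mx mxE ltxx //.
Qed.

(* A kernel vector of [S x + c] would enlarge a maximal negative definite subspace of [S x]. *)
Lemma index_gap q t r (S : 'rV[R]_q -> 'M[R]_t) : (forall x, (S x)^T = S x) ->
  (forall x, cube q x -> mctn x S) -> (forall x, cube q x -> negidx (S x) r) ->
  exists2 c : R, 0 < c & forall x, cube q x -> S x + c%:M \in unitmx /\ negidx (S x + c%:M) r.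
Proof.
move=> ST Sc Sr.
have [|x cx|c c0 Hc] := @local_global R q (cube q)
    (fun c x => forall c', 0 < c' -> c' <= c -> exists F : 'M[R]_(r, t), negdef (S x + c'%:M) F)
    (@cube_box R q) (@vopen_cube R q).
- by move=> c c' x cc H c'' c0 c1; apply: H => //; apply: le_trans cc.
- have [[F Fn] _] := Sr _ cx.
  have [|b b0 Hb] := @negdef_bound r (F *m S x *m F^T).
    by move=> u /Fn; rewrite qf_mul.
  have [C C0 HC] := mx_bounded F.
  (* [K] bounds [N1 (u *m F)] by [K * N1 u]. The variation of [S] and the shift [c'] each get a
     quarter of [b / K^2], so half of the gap [b] remains. *)
  pose K := t%:R * C + 1; have K0 : 0 < K by rewrite ltr_wpDl // mulr_ge0 // ltW.
  have e0 : 0 < b / (4%:R * K ^+ 2) by rewrite divr_gt0 // mulr_gt0 // exprn_gt0.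
  have [d d0 Hd] := mctn_eps (Sc _ cx) e0.
  exists (Num.min d (b / (4%:R * K ^+ 2))); first by rewrite lt_min d0.
  move=> x' nx cx' c' c'0; rewrite le_min => /andP[_ c'e]; exists F => u u0.
  have -> : S x' + c'%:M = S x - (S x - S x' - c'%:M).
    by apply/matrixP => i j; rewrite !mxE; ring.
  rewrite qf_addl qf_mul.
  have hE : `|qf (- (S x - S x' - c'%:M)) (u *m F)| <= (b / (2%:R * K ^+ 2)) * N1 (u *m F) ^+ 2.
    apply: qf_bound => i j; rewrite !mxE.
    have h1 : `|S x i j - S x' i j| <= b / (4%:R * K ^+ 2).
      by apply: Hd; apply: vnear_mono nx; rewrite ge_min lexx.
    have h2 : `|c' *+ (i == j)| <= b / (4%:R * K ^+ 2).
      by case: (i == j); rewrite ?mulr1n ?mulr0n ?normr0 ?(ltW e0) // gtr0_norm.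
    rewrite normrN; have := ler_normB (S x i j - S x' i j) (c' *+ (i == j)).
    have -> : b / (2%:R * K ^+ 2) = b / (4%:R * K ^+ 2) + b / (4%:R * K ^+ 2).
      by field; rewrite gt_eqF.
    by move: (b / _) h1 h2 => e h1 h2; lra.
  have hN : N1 (u *m F) ^+ 2 <= K ^+ 2 * N1 u ^+ 2.
    rewrite -exprMn ler_pXn2r ?nnegrE ?mulr_ge0 ?N1_ge0 ?(ltW K0) //.
    apply: le_trans (N1_mul u HC) _; rewrite ler_wpM2r ?N1_ge0 // /K; lra.
  have hq : `|qf (- (S x - S x' - c'%:M)) (u *m F)| <= b / 2%:R * N1 u ^+ 2.
    apply: le_trans hE _; apply: (@le_trans _ _ (b / (2%:R * K ^+ 2) * (K ^+ 2 * N1 u ^+ 2))).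
      by apply: ler_wpM2l hN; rewrite ltW // divr_gt0 // mulr_gt0 // exprn_gt0.
    have -> // : b / (2%:R * K ^+ 2) * (K ^+ 2 * N1 u ^+ 2) = b / 2%:R * N1 u ^+ 2.
    by field; rewrite gt_eqF.
  have := Hb u; have : 0 < b * N1 u ^+ 2 by rewrite mulr_gt0 // exprn_gt0 // N1_gt0.
  move: hq; rewrite ler_norml mulrAC => /andP[_]; move: (qf _ _) (qf _ _) (b * _) => a1 a2 a3; lra.
exists c => // x cx; have [F Fn] := Hc _ cx _ c0 (lexx c).
have [_ Smax] := Sr _ cx; split; last first.
  by split; [exists F|move=> k F' F'n; apply: Smax; apply: negdef_mono F'n; apply: ltW].
rewrite -row_free_unit -kermx_eq0; apply/rowV0P => y /sub_kermxP yS.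
apply/eqP/negPn/negP => y0.
have yS' : y *m S x = - (c *: y).
  by apply/eqP; rewrite -addr_eq0 -mul_mx_scalar -mulmxDr yS.
have : negdef (S x) (col_mx F y); last by move/Smax; rewrite addn1 ltnn.
apply: negdef_col => u s us.
have ST' : (S x + c%:M)^T = S x + c%:M by rewrite linearD /= tr_scalar_mx ST.
have E : qf (S x) (u *m F + s *: y) = qf (S x + c%:M) (u *m F) - c * n2 (u *m F + s *: y).
  have := qf_addl (S x) c%:M (u *m F + s *: y); rewrite qf_scalar qfD // qfZ.
  have yT : form (S x + c%:M) y (u *m F) = 0 by rewrite /form yS mul0mx mxE.
  have -> : qf (S x + c%:M) y = 0 by rewrite /qf yS mul0mx mxE.
  rewrite formZr (formC _ _ ST') yT !mulr0 !addr0 => ->; ring.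
rewrite E; have [u0|u0] := eqVneq u 0.
  move: us; rewrite u0 eqxx /= mul0mx add0r => s0.
  rewrite /qf !mul0mx mxE sub0r oppr_lt0 mulr_gt0 // n2_gt0 //.
  by rewrite scaler_eq0 negb_or s0.
have := Fn _ u0; have : 0 <= c * n2 (u *m F + s *: y) by rewrite mulr_ge0 ?n2_ge0 // ltW.
lra.
Qed.

(* Cauchy-Schwarz on the orthogonal complement of a maximal negative definite subspace. *)
Lemma neg_complement t r (S : 'M[R]_t) (F : 'M[R]_(r, t)) z : S^T = S -> negdef S F ->
  (forall k (F' : 'M[R]_(k, t)), negdef S F' -> (k <= r)%N) ->
  z *m S *m F^T = 0 -> 0 <= qf S z /\ (qf S z <= 0 -> z *m S = 0).
Proof.
move=> ST Fn Fmax zF.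
have zorth y u : y *m S *m F^T = 0 -> form S (u *m F) y = 0.
  by move=> yF; rewrite (formC _ _ ST) /form trmx_mul mulmxA yF mul0mx mxE.
have pos y : y *m S *m F^T = 0 -> 0 <= qf S y.
  move=> yF; rewrite leNgt; apply/negP => zn.
  have : negdef S (col_mx F y); last by move/Fmax; rewrite addn1 ltnn.
  apply: negdef_col => u s us; rewrite qfD // formZr zorth // !mulr0 addr0 qfZ.
  have [u0|u0] := eqVneq u 0.
    move: us; rewrite u0 eqxx /= => s0; rewrite {1}/qf !mul0mx mxE add0r.
    by rewrite pmulr_rlt0 // exprn_even_gt0.
  by have := Fn _ u0; have : s ^+ 2 * qf S y <= 0; [rewrite mulr_ge0_le0 ?sqr_ge0 // ltW|lra].
split=> [|zneg]; first exact: pos.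
have qz0 : qf S z = 0 by apply/eqP; rewrite eq_le zneg pos.
have Nu := form_neg_def Fn.
pose P1 := S *m F^T *m invmx (F *m S *m F^T).
pose z' v : 'rV[R]_t := v - v *m P1 *m F.
have z'F v : z' v *m S *m F^T = 0.
  rewrite /z' !mulmxBl -(mulmxA _ F) -(mulmxA _ (F *m S)).
  by rewrite /P1 -!mulmxA [F *m (S *m _)]mulmxA mulVmx // mulmx1 subrr.
have zS v : form S z v = 0.
  have -> : form S z v = form S z (z' v).
    have -> : z' v = v + (-1) *: (v *m P1 *m F) by rewrite scaleN1r.
    by rewrite formDr formZr (formC _ _ ST) (formC _ (_ *m F) ST) zorth // mulr0 addr0 (formC _ _ ST).
  apply: (@nonneg_lin (qf S (z' v))) => s.
  have : 0 <= qf S (z + s *: z' v).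
    by apply: pos; rewrite !mulmxDl zF -!scalemxAl z'F scaler0 addr0.
  by rewrite qfD // qz0 formZr qfZ add0r mulrA.
by apply/eqP/negPn/negP => /n2_gt0; rewrite /n2 -/(form _ _ _) zS ltxx.
Qed.

(** [P1] takes the coordinates in [F] of a vector along the [S]-orthogonal complement, where [S] is
    nonnegative. The retraction scales that complement by [1 - s], which can only lower the form.
    The coordinate of weight -1 is one more negative direction, whence [r + 1]. *)
Lemma pole_data t r (S : 'M[R]_t) : S^T = S -> S \in unitmx -> negidx S r ->
  let A := block_mx S 0 0 (-1)%:M : 'M[R]_(t + 1) in
  exists P : 'M[R]_(t + 1, r + 1), exists U : 'M[R]_(r + 1, t + 1), exists c : R,
  [/\ U *m P = 1%:M, forall u, qf A (u *m U) <= 0,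
    forall y s, 0 <= s -> s <= 1 -> qf A y <= 0 -> qf A (y - s *: (y - y *m P *m U)) <= 0,
    0 < c & forall y, qf A y <= 0 -> c * N1 y <= N1 (y *m P)].
Proof.
move=> ST Su [[F Fn] Fmax] A.
pose N := F *m S *m F^T; have Nu : N \in unitmx by apply: form_neg_def.
pose P1 := S *m F^T *m invmx N.
have FP : F *m P1 = 1%:M by rewrite /P1 !mulmxA -/N mulmxV.
pose z' z : 'rV[R]_t := z - z *m P1 *m F.
have zF z : z' z *m S *m F^T = 0.
  rewrite /z' !mulmxBl -(mulmxA _ F) -(mulmxA _ (F *m S)) -/N.
  by rewrite /P1 -!mulmxA mulVmx // mulmx1 mulmxA subrr.
have zorth z u : form S (u *m F) (z' z) = 0.
  by rewrite (formC _ _ ST) /form trmx_mul mulmxA zF mul0mx mxE.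
have zpos z : 0 <= qf S (z' z) by have [] := neg_complement ST Fn Fmax (zF z).
have qz z s : qf S (z - s *: z' z) = qf S (z *m P1 *m F) + (1 - s) ^+ 2 * qf S (z' z).
  have -> : z - s *: z' z = z *m P1 *m F + (1 - s) *: z' z.
    by rewrite /z'; move: (z *m P1 *m F) => v; apply/rowP => i; rewrite !mxE; ring.
  by rewrite qfD // formZr zorth !mulr0 addr0 qfZ.
have qA y : qf A y = qf S (lsubmx y) - rsubmx y 0 0 ^+ 2.
  rewrite -{1}[y]hsubmxK /qf mul_row_block !mulmx0 addr0 add0r tr_row_mx mul_row_col mxE; congr (_ + _).
  by rewrite mul_mx_scalar -scalemxAl mxE mulN1r -/(n2 _) n2E big_ord1.
pose P := block_mx P1 0 0 1%:M : 'M[R]_(t + 1, r + 1).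
pose U := block_mx F 0 0 1%:M : 'M[R]_(r + 1, t + 1).
have UP : U *m P = 1%:M.
  by rewrite mulmx_block !mulmx0 !mul0mx !addr0 !add0r mulmx1 FP -scalar_mx_block.
have ret y s : y - s *: (y - y *m P *m U) = row_mx (lsubmx y - s *: z' (lsubmx y)) (rsubmx y).
  rewrite -{1 2 3}[y]hsubmxK !mul_row_block !mulmx0 !addr0 !add0r !mulmx1.
  by rewrite opp_row_mx add_row_mx subrr scale_row_mx scaler0 opp_row_mx add_row_mx subr0.
have Fneg u : qf S (u *m F) <= 0.
  have [->|/Fn/ltW//] := eqVneq u 0; by rewrite /qf !mul0mx mxE.
(* A single form is treated as a constant family over the sphere of a line. *)
have [||x y cx y0 qy|c c0 Hc] := @family_lower R 1 (t + 1) (r + 1) (fun=> A) (fun=> P).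
- by move=> x _; apply: mctn_cst.
- by move=> x _; apply: mctn_cst.
- apply: contra y0 => /eqP yP.
  have : row_mx (lsubmx y *m P1) (rsubmx y) = 0.
    by rewrite -yP -{3}[y]hsubmxK mul_row_block !mulmx0 addr0 add0r mulmx1.
  rewrite -(row_mx0 _ 1 _) => /eq_row_mx[lP ry].
  pose z := lsubmx y; have zz : z' z = z by rewrite /z' lP mul0mx subr0.
  have zS : z *m S = 0.
    have [_] := neg_complement ST Fn Fmax (zF z); rewrite zz; apply.
    by move: qy; rewrite qA ry mxE expr0n subr0.
  have z0 : z = 0 by rewrite -[z](mulmxK Su) zS mul0mx.
  by rewrite -[y]hsubmxK -/z z0 ry row_mx0.
exists P, U, c; split=> //.
- move=> u; rewrite -[u]hsubmxK mul_row_block !mulmx0 addr0 add0r mulmx1 qA row_mxKl row_mxKr.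
  by have := Fneg (lsubmx u); have := sqr_ge0 (rsubmx u 0 0); lra.
- move=> y s s0 s1; rewrite ret !qA row_mxKl row_mxKr qz.
  have := qz (lsubmx y) 0; rewrite scale0r subr0 subr0 expr1n mul1r => ->.
  have h : (1 - s) ^+ 2 <= 1 by rewrite expr_le1 //; lra.
  have := ler_wpM2r (zpos (lsubmx y)) h; lra.
by move=> y; apply: Hc (cube_delta R ord0).
Qed.

Lemma negdef_free m k (S : 'M[R]_m) (F : 'M[R]_(k, m)) : negdef S F -> row_free F.
Proof.
move=> Fn; rewrite -kermx_eq0; apply/rowV0P => u /sub_kermxP uF.
by apply/eqP/negPn/negP => /Fn; rewrite uF /qf !mul0mx mxE ltxx.
Qed.

Lemma negdef_leq m k (S : 'M[R]_m) (F : 'M[R]_(k, m)) : negdef S F -> (k <= m)%N.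
Proof. by move=> /negdef_free /eqP <-; apply: rank_leq_col. Qed.

Lemma negidx_ex m (S : 'M[R]_m) : exists r, negidx S r.
Proof.
have ex : exists r, `[< exists F : 'M[R]_(r, m), negdef S F >].
  by exists 0%N; apply/asboolP; exists 0 => u; rewrite thinmx0 eqxx.
have ub r : `[< exists F : 'M[R]_(r, m), negdef S F >] -> (r <= m)%N.
  by move/asboolP => [F]; apply: negdef_leq.
case: (ex_maxnP ex ub) => r /asboolP Fr H; exists r; split=> // k F Fn.
by apply: H; apply/asboolP; exists F.
Qed.
End Forms.

(** * Families of self-adjoint maps *)

Section Geo.
Variables (R : realType) (n q t : nat) (G : 'M[R]_n) (Wb : 'M[R]_(q, n)) (Tb : 'M[R]_(t, n)).
Hypothesis GT : G^T = G.
Hypothesis Wpos : forall u, u != 0 -> 0 < qf G (u *m Wb).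
Hypothesis Tneg : negdef G Tb.
Hypothesis WT : Tb *m G *m Wb^T = 0.
Hypothesis Gu : G \in unitmx.
Hypothesis split : forall v : 'rV[R]_n, exists w z, v = w *m Wb + z *m Tb.

Lemma formWT w z : form G (w *m Wb) (z *m Tb) = 0.
Proof.
rewrite (formC _ _ GT) /form trmx_mul !mulmxA -(mulmxA z) -(mulmxA z) WT.
by rewrite mulmx0 mul0mx mxE.
Qed.

Lemma orthW (v : 'rV[R]_n) : v *m G *m Wb^T = 0 -> exists z, v = z *m Tb.
Proof.
have [w [z ->]] := split v => vW; exists z.
have : form G (w *m Wb + z *m Tb) (w *m Wb) = 0.
  by rewrite /form trmx_mul mulmxA vW mul0mx mxE.
rewrite formDl (formC _ (w *m _) GT) formWT addr0 => qw.
have [->|/Wpos] := eqVneq w 0; first by rewrite mul0mx add0r.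
by rewrite -[qf _ _]/(form _ _ _) qw ltxx.
Qed.

Lemma orthW_le (v : 'rV[R]_n) : v *m G *m Wb^T = 0 -> qf G v <= 0 ?= iff (v == 0).
Proof.
move=> /orthW[z ->]; have [->|z0] := eqVneq z 0.
  by rewrite mul0mx eqxx /qf !mul0mx mxE; apply/leifP; rewrite eqxx.
have zn := Tneg z0; apply/leifP; case: ifP => // /eqP z1.
by move: zn; rewrite z1 /qf !mul0mx mxE ltxx.
Qed.

Lemma orthT (v : 'rV[R]_n) : v *m G *m Tb^T = 0 -> v != 0 -> 0 < qf G v.
Proof.
have [w [z ->]] := split v => vT.
have : form G (w *m Wb + z *m Tb) (z *m Tb) = 0.
  by rewrite /form trmx_mul mulmxA vT mul0mx mxE.
rewrite formDl formWT add0r => qz.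
have [->|/Tneg] := eqVneq z 0; last by rewrite -[qf _ _]/(form _ _ _) qz ltxx.
rewrite mul0mx addr0 => w0; apply: Wpos; apply: contraNneq w0 => ->.
by rewrite mul0mx.
Qed.

(** Pairing with [T] is injective on a negative definite subspace, because vectors orthogonal to [T]
    are positive. *)
Lemma Tmax k (F : 'M[R]_(k, n)) : negdef G F -> (k <= t)%N.
Proof.
move=> Fn; have : row_free (F *m G *m Tb^T).
  rewrite -kermx_eq0; apply/rowV0P => u /sub_kermxP; rewrite !mulmxA => uF.
  apply/eqP/negPn/negP => u0; have := Fn _ u0; rewrite ltNge => /negP; apply.
  have [->|/(orthT uF)/ltW//] := eqVneq (u *m F) 0.
  by rewrite /qf !mul0mx mxE.
by move=> /eqP <-; apply: rank_leq_col.
Qed.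

Section SelfAdjoint.
Variable Q : 'M[R]_n.
Hypothesis QG : (Q *m G)^T = Q *m G.

Lemma selfadj u v : form G (u *m Q) v = form G u (v *m Q).
Proof.
rewrite /form -(mulmxA u) -QG trmx_mul GT trmx_mul !mulmxA //.
Qed.

(** The range of [Q] is isotropic, so it meets the positive definite complement of [T] only in 0.
    Hence [Q] keeps its rank on [T], and the index of minus a Euclidean square is that rank. *)
Lemma index_nilpotent : Q *m Q = 0 -> negidx (- (Tb *m Q *m (Tb *m Q)^T)) (\rank Q).
Proof.
move=> QQ.
have <- : \rank (Tb *m Q) = \rank Q.
  have GQ : \rank (Tb *m Q) = \rank (Q *m (G *m Tb^T)).
    have -> : Q *m (G *m Tb^T) = (Tb *m (Q *m G))^T by rewrite trmx_mul QG mulmxA.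
    by rewrite mxrank_tr mulmxA [RHS]mxrankMfree ?row_free_unit.
  rewrite GQ -(mxrank_mul_ker Q (G *m Tb^T)).
  suff -> : (Q :&: kermx (G *m Tb^T))%MS = 0 by rewrite mxrank0 addn0.
  apply/eqP; rewrite -submx0; apply/rV_subP => v; rewrite sub_capmx => /andP[/submxP[u ->]].
  move=> /sub_kermxP; rewrite mulmxA submx0 => vT; apply/negPn/negP => /(orthT vT).
  by rewrite -[qf _ _]/(form _ _ _) selfadj -mulmxA QQ mulmx0 /form trmx0 mulmx0 mxE ltxx.
set M := Tb *m Q.
have qM y : qf (- (M *m M^T)) y = - n2 (y *m M).
  by rewrite /qf /n2 mulmxN mulNmx [(y *m M)^T]trmx_mul !mulmxA [LHS]mxE.
split.
  have /submxP[F FM] : (row_base M <= M)%MS by rewrite eq_row_base.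
  exists F => u u0; rewrite qM oppr_lt0; apply: n2_gt0; rewrite -mulmxA -FM.
  exact: row_base_neq0.
move=> k F Fn; have : row_free (F *m M).
  rewrite -kermx_eq0; apply/rowV0P => u /sub_kermxP; rewrite mulmxA => uF.
  apply/eqP/negPn/negP => /Fn; rewrite qM uF /n2 mul0mx mxE oppr0 ltxx //.
by move=> /eqP <-; rewrite mxrankM_maxr.
Qed.

(* [Q] is an anti-isometry of its range, which therefore has signature [(a, a)]. *)
Lemma index_antiinvolution : Q *m Q *m Q = - Q ->
  negidx (- (Tb *m (Q *m Q) *m G *m Tb^T)) (\rank Q)./2 /\ ~~ odd (\rank Q).
Proof.
(* [P] is the self-adjoint projection onto the range of [Q], and the form in question is
   [(P z, P z)] on [T]. *)
move=> QQQ; pose P := - (Q *m Q).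
have PQ : P *m Q = Q by rewrite /P mulNmx QQQ opprK.
have QP : Q *m P = Q by rewrite /P mulmxN mulmxA QQQ opprK.
have PP : P *m P = P by rewrite {1}/P mulNmx -mulmxA QP.
have PG : (P *m G)^T = P *m G.
  rewrite /P mulNmx linearN /= trmx_mul trmx_mul GT.
  have QT : G *m Q^T = Q *m G by rewrite -[LHS]trmxK trmx_mul trmxK GT QG.
  by rewrite mulmxA QT -mulmxA QT mulmxA.
have selfadjP u v : form G (u *m P) v = form G u (v *m P).
  by rewrite /form -(mulmxA u) -PG trmx_mul GT trmx_mul !mulmxA.
have -> : - (Tb *m (Q *m Q) *m G *m Tb^T) = Tb *m (P *m G) *m Tb^T.
  by rewrite /P mulNmx mulmxN mulNmx !mulmxA.
set S := Tb *m (P *m G) *m Tb^T; pose S2 := P *m G.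
have ST : S^T = S by rewrite /S !trmx_mul trmxK -trmx_mul PG mulmxA.
have qS2 v : qf S2 v = qf G (v *m P).
  rewrite /S2 -![qf _ _]/(form _ _ _) selfadjP -mulmxA PP -selfadjP.
  by rewrite /form !mulmxA.
have qS z : qf S z = qf S2 (z *m Tb) by rewrite qf_mul.
have qQ v : qf G (v *m Q) = - qf S2 v.
  rewrite qS2 -![qf _ _]/(form _ _ _) selfadj -mulmxA -/(_ *m _).
  have -> : v *m (Q *m Q) = (-1) *: (v *m P) by rewrite /P mulmxN scaleN1r opprK.
  by rewrite formZr mulN1r selfadjP -mulmxA PP.
have Q0 v : v *m S2 = 0 -> v *m Q = 0.
  by rewrite /S2 mulmxA => h; rewrite -PQ mulmxA -[v *m P](mulmxK Gu) h !mul0mx.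
have [a [[F2 F2n] F2max]] := negidx_ex S2.
(* [Q] reverses the sign of [(P v, P v)]. So it maps the complement [K] of a maximal negative
   subspace, where this form is nonnegative, onto a negative definite space, whose dimension is at
   least [\rank Q - a]. *)
have aQ : (\rank Q <= a + a)%N.
  pose K := kermx (S2 *m F2^T); pose E := row_base (K *m Q).
  have En : negdef S2 E.
    move=> u u0; have /submxP[D ED] : (E <= K *m Q)%MS by rewrite eq_row_base.
    have uE : u *m E != 0 by apply: row_base_neq0.
    pose v := u *m D *m K; have Ev : u *m E = v *m Q by rewrite ED /v !mulmxA.
    have vK : v *m S2 *m F2^T = 0 by rewrite -(mulmxA v) /v -(mulmxA _ K) /K mulmx_ker mulmx0.
    have [vp v0] := neg_complement PG F2n F2max vK.
    rewrite Ev qS2 -mulmxA QP qQ oppr_lt0 ltNge; apply: contra uE => /v0/Q0.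
    by rewrite Ev => ->.
  have := F2max _ _ En; have := mxrank_mul_ker K Q.
  have : (\rank (K :&: kermx Q)%MS <= n - \rank Q)%N.
    by rewrite -mxrank_ker mxrankS // capmxSr.
  have := mxrank_ker (S2 *m F2^T); rewrite -/K; have := rank_leq_col (S2 *m F2^T).
  have := rank_leq_row Q; lia.
(* Restriction to [T] loses no index. The [a] negative directions in the range of [P], together with
   the [1 - P] parts of the [S]-orthogonal complement of [F] in [T], are negative definite for [G];
   that is at least [a + (t - k)] dimensions, and [Tmax] allows [t]. *)
have aF k (F : 'M[R]_(k, t)) : negdef S F ->
    (forall k' (F' : 'M[R]_(k', t)), negdef S F' -> (k' <= k)%N) -> (a <= k)%N.
  move=> Fn Fmax; pose K := kermx (S *m F^T); pose E := row_base K.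
  pose M := col_mx (F2 *m P) (E *m Tb *m (1%:M - P)).
  have Mn : negdef G M.
    move=> u u0; rewrite -[u]hsubmxK mul_row_col (mulmxA _ F2) (mulmxA _ (E *m Tb)) (mulmxA _ E).
    move: (lsubmx u) (rsubmx u) (hsubmxK u) => u1 u2 Eu.
    pose Z := u2 *m E *m Tb.
    have orth (y : 'rV[R]_n) : form G (u1 *m F2 *m P) (y *m (1%:M - P)) = 0.
      have P0 : (1%:M - P) *m P = 0 by rewrite mulmxBl mul1mx PP subrr.
      by rewrite selfadjP -(mulmxA y) P0 mulmx0 /form trmx0 mulmx0 mxE.
    rewrite qfD // orth mulr0 addr0.
    have n1 : u1 != 0 -> qf G (u1 *m F2 *m P) < 0 by move=> /F2n; rewrite qS2.
    have E1 : qf G (Z *m (1%:M - P)) = qf G Z - qf G (Z *m P).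
      rewrite mulmxBr mulmx1 -scaleN1r qfD // qfZ formZr -selfadjP.
      have -> : form G (Z *m P) Z = qf G (Z *m P).
        by rewrite -[qf _ _]/(form _ _ _) [RHS]selfadjP -(mulmxA Z) PP -selfadjP.
      by ring.
    have E2 : 0 <= qf G (Z *m P).
      rewrite -qS2 /Z -qS.
      have [] // := neg_complement ST Fn Fmax (z := u2 *m E).
      have /submxP[D ED] : (E <= K)%MS by rewrite eq_row_base.
      have -> : u2 *m E *m S *m F^T = u2 *m D *m (K *m (S *m F^T)) by rewrite ED !mulmxA.
      by rewrite mulmx_ker mulmx0.
    have n2' : u2 != 0 -> qf G (Z *m (1%:M - P)) < 0.
      move=> u20; have : qf G Z < 0; last by rewrite E1; lra.
      by apply: Tneg; apply: row_base_neq0.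
    have [u10|/n1 h1] := eqVneq u1 0; have [u20|/n2' h2] := eqVneq u2 0.
    - by move: u0; rewrite -Eu u10 u20 row_mx0 eqxx.
    - by rewrite u10 !mul0mx qf0 add0r.
    - by rewrite u20 !mul0mx qf0 addr0; exact: h1.
    by rewrite -[0]addr0; apply: ltrD.
  have := Tmax Mn; have := mxrank_ker (S *m F^T); rewrite -/K.
  have := rank_leq_col (S *m F^T); have := negdef_leq Fn; lia.
(* [P] and [Q] send an [S]-negative subspace to a negative and to a positive subspace of the range
   of [Q], which are independent. *)
have up k (F : 'M[R]_(k, t)) : negdef S F -> (k + k <= \rank Q)%N.
  move=> Fn; pose E1 := F *m Tb *m P; pose E2 := F *m Tb *m Q.
  have q1 u : qf G (u *m E1) = qf S (u *m F) by rewrite qS qS2 !mulmxA.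
  have q2 u : qf G (u *m E2) = - qf S (u *m F) by rewrite qS -qQ !mulmxA.
  have : row_free (col_mx E1 E2).
    rewrite -kermx_eq0; apply/rowV0P => u /sub_kermxP.
    rewrite -[u]hsubmxK mul_row_col; move: (lsubmx u) (rsubmx u) => u1 u2 /eqP.
    rewrite addr_eq0 => /eqP h.
    have e : qf S (u1 *m F) = - qf S (u2 *m F) by rewrite -q1 h qfN q2.
    have [u10|/Fn h1] := eqVneq u1 0; have [u20|/Fn h2] := eqVneq u2 0.
    - by rewrite u10 u20 row_mx0.
    - by move/eqP: e; rewrite u10 mul0mx qf0 eq_sym oppr_eq0 lt_eqF.
    - by move: h1; rewrite e u20 mul0mx qf0 oppr0 ltxx.
    by move: h1; rewrite e oppr_lt0 ltNge (ltW h2).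
  move=> /eqP <-; apply: mxrankS; rewrite col_mx_sub /E1 /E2 submxMl andbT.
  by rewrite /P mulmxN mulmxA -mulNmx submxMl.
have [k [[F Fn] Fmax]] := negidx_ex S.
have := aF k F Fn Fmax; have := up k F Fn => h1 h2.
have -> : \rank Q = k.*2 by lia.
by rewrite doubleK odd_double; split=> //; split=> //; exists F.
Qed.
End SelfAdjoint.

Section Family.
Variable Q : 'rV[R]_q -> 'M[R]_n.
Hypothesis tq : (t < q)%N.
Hypothesis Qc : forall x, cube q x -> mctn x Q.
Hypothesis QN : forall x, Q (- x) = Q x.
Hypothesis QG : forall x, (Q x *m G)^T = Q x *m G.
Hypothesis xQ : forall x, cube q x -> x *m Wb *m Q x = 0.

(* The pairs [(z, mu)] on which [A x] is not positive form a cone over [x] avoiding the kernel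
   of [w x], which is the setting of [cone_contradiction]. *)
Lemma geo_contradiction r (S : 'rV[R]_q -> 'M[R]_t) : (0 < r)%N ->
  (forall x, cube q x -> mctn x S) -> (forall x, S (- x) = S x) -> (forall x, (S x)^T = S x) ->
  (forall x, cube q x -> negidx (S x) r) ->
  (forall x z, cube q x -> z *m Tb *m Q x *m G *m Wb^T = 0 -> 0 <= qf (S x) z) ->
  False.
Proof.
move=> r0 Sc SN ST Sr HS.
have [c c0 Hc] := index_gap ST Sc Sr.
pose A x := block_mx (S x + c%:M) 0 0 (-1)%:M : 'M[R]_(t + 1).
pose w x := col_mx (Tb *m Q x *m G *m Wb^T) (x *m Wb *m G *m Wb^T).
have AT x : (A x)^T = A x.
  by rewrite /A tr_block_mx linearD /= ST !tr_scalar_mx !trmx0.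
have SAT x : (S x + c%:M)^T = S x + c%:M by rewrite linearD /= ST tr_scalar_mx.
have Ac x : cube q x -> mctn x A.
  move=> cx; apply: mctn_block; try exact: mctn_cst.
  by apply: mctnD; [apply: Sc|apply: mctn_cst].
have wc x : cube q x -> mctn x w.
  move=> cx; apply: mctn_col; apply: mctnM; try exact: mctn_cst; apply: mctnM; try exact: mctn_cst.
    by apply: mctnM; [apply: mctn_cst|apply: Qc].
  by apply: mctnM; [apply: mctn_id|apply: mctn_cst].
have qA x y : qf (A x) y = qf (S x) (lsubmx y) + c * n2 (lsubmx y) - rsubmx y 0 0 ^+ 2.
  rewrite -{1}[y]hsubmxK /qf mul_row_block !mulmx0 addr0 add0r tr_row_mx mul_row_col mxE; congr (_ + _).
    by rewrite -qf_scalar -qf_addl.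
  by rewrite mul_mx_scalar -scalemxAl mxE mulN1r -/(n2 _) n2E big_ord1.
apply: (@cone_contradiction R t q (r + 1) A w) => //.
- by rewrite addn1.
- by move=> x _; rewrite /A SN.
- move=> x _; rewrite /A /flip !mulmx_block !mulmx0 !mul0mx !mulmx1 !mul1mx !addr0 !add0r.
  by rewrite mulmxN mulNmx mulmx1 mul1mx.
- by apply: mctn_mcont => //; [exact: cube_box|exact: vopen_cube].
- by apply: mctn_bounded => //; [exact: cube_box|exact: vopen_cube].
(* The zero form puts no condition on [y], so this bounds the invertible [A x] from below on all
   vectors. *)
- have [|x|x y cx y0 _|b b0 Hb] := @family_lower R q (t + 1) (t + 1) (fun=> 0) A.
  + by move=> x _; apply: mctn_cst.
  + exact: Ac.
  + have Au : A x \in unitmx.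
      have [Su _] := Hc _ cx.
      by rewrite unitmxE /A det_ublock unitrM -unitmxE Su det_scalar1 unitrN1.
    by apply: contra y0 => /eqP yA; rewrite -[y](mulmxK Au) yA mul0mx.
  have t0 : (0 : R) < (t + 1)%:R ^+ 2 by rewrite exprn_gt0 // ltr0n addn1.
  exists (b ^+ 2 / (t + 1)%:R ^+ 2); first by rewrite divr_gt0 // exprn_gt0.
  move=> x y cx; rewrite mulrAC ler_pdivrMr // -exprMn [n2 _ * _]mulrC.
  apply: le_trans (N1_n2 (y *m A x)); rewrite ler_pXn2r ?nnegrE ?mulr_ge0 ?N1_ge0 ?(ltW b0) //.
  by apply: Hb => //; rewrite /qf mulmx0 mul0mx mxE.
- by move=> x _; rewrite /A block_mxEdr mxE mulr1n lerN10.
- move=> x _; rewrite /w /flip QN mul_block_col !mul1mx !mul0mx addr0 add0r.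
  by rewrite mulNmx mul1mx !mulNmx opprK.
- by apply: mctn_mcont => //; [exact: cube_box|exact: vopen_cube].
- by apply: mctn_bounded => //; [exact: cube_box|exact: vopen_cube].
- have [|||b b0 Hb] := @family_lower R q (t + 1) q A w.
  + exact: Ac.
  + exact: wc.
  + move=> x y cx y0; rewrite qA => qy; apply/eqP => yw.
    pose z := lsubmx y; pose mu := rsubmx y 0 0; pose X := x *m Wb.
    pose v := z *m Tb *m Q x + mu *: X.
    have vW : v *m G *m Wb^T = 0.
      rewrite -yw -{1}[y]hsubmxK mul_row_col /w -/z /v !mulmxDl -/X; congr (_ + _).
        by rewrite !mulmxA.
      by rewrite [rsubmx y]mx11_scalar mul_scalar_mx -!scalemxAl.
    have x0 : x != 0.
      by case: cx => _ [i xi] _; apply: contra_eq_neq xi => ->; rewrite mxE normr0 eq_sym oner_eq0.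
    (* [v] is orthogonal to [X], and so is [Q z] because [Q] kills [X]; hence [mu (X, X) = 0] with
       [(X, X) > 0]. *)
    have mu0 : mu = 0.
      have : form G v X = 0 by rewrite /form trmx_mul mulmxA vW mul0mx mxE.
      rewrite formDl formZl selfadj // /X xQ // {1}/form trmx0 mulmx0 mxE add0r => /eqP.
      by rewrite mulf_eq0 => /orP[/eqP //|]; rewrite gt_eqF //; apply: Wpos.
    have z0 : z != 0.
      apply: contra y0 => /eqP z0; rewrite -[y]hsubmxK -/z z0 [rsubmx y]mx11_scalar -/mu mu0.
      by rewrite raddf0 row_mx0.
    (* Now [Q z] itself is orthogonal to [W], so [S] is nonnegative at [z], and the perturbation
       makes the form positive there, against [qy]. *)
    have := HS x z cx; rewrite -vW /v mu0 scale0r addr0 => /(_ erefl).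
    have := mulr_gt0 c0 (n2_gt0 z0); move: qy; rewrite -/z -/mu mu0 expr0n subr0 /=.
    by move: (qf _ _) (c * _) => a b; lra.
  have q0 : (0 : R) < q%:R by rewrite ltr0n; lia.
  exists (b / q%:R); first by rewrite divr_gt0.
  move=> x y cx y0 qy; have h := Hb x y cx qy.
  have [|i Hi] := @N1_large R q (y *m w x).
    apply: contraTneq h => ->; rewrite N10 -ltNge mulr_gt0 // N1_gt0 //.
  exists i; rewrite mulrAC ler_pdivrMr // mulrC [`|_| * _]mulrC.
  by rewrite mulrC; apply: le_trans Hi.
move=> j; have [Su Sr'] := Hc _ (cube_delta R j); exact: pole_data.
Qed.

Lemma nilpotent_contradiction r : (0 < r)%N -> (forall x, cube q x -> Q x *m Q x = 0) ->
  (forall x, cube q x -> \rank (Q x) = r) -> False.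
Proof.
move=> r0 QQ Qr.
apply: (@geo_contradiction r (fun x => - (Tb *m Q x *m (Tb *m Q x)^T))) => //.
- move=> x cx; apply: mctnN; apply: mctnM; [|apply: mctn_tr]; apply: mctnM; try exact: mctn_cst; exact: Qc.
- by move=> x; rewrite QN.
- by move=> x; rewrite linearN /= trmx_mul trmxK.
- by move=> x cx; rewrite -(Qr x cx); apply: index_nilpotent => //; apply: QQ.
(* If [Q z] is orthogonal to [W], it lies in the definite space [T]; being isotropic, it is 0. *)
move=> x z cx /orthW_le /leifP; rewrite /= => h.
have qS : qf (- (Tb *m Q x *m (Tb *m Q x)^T)) z = - n2 (z *m Tb *m Q x).
  by rewrite /qf /n2 mulmxN mulNmx [(z *m Tb *m _)^T]trmx_mul (trmx_mul z) [(Tb *m _)^T]trmx_mul !mulmxA [LHS]mxE.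
have q0 : qf G (z *m Tb *m Q x) = 0.
  by rewrite -[qf _ _]/(form _ _ _) selfadj // -mulmxA QQ // mulmx0 /form trmx0 mulmx0 mxE.
move: h; rewrite q0 ltxx qS; case: eqP => // -> _.
by rewrite /n2 mul0mx mxE oppr0.
Qed.

Lemma antiinvolution_contradiction r : (0 < r)%N ->
  (forall x, cube q x -> Q x *m Q x *m Q x = - Q x) -> (forall x, cube q x -> \rank (Q x) = r) ->
  False.
Proof.
move=> r0 QQ Qr.
pose S x := - (Tb *m (Q x *m Q x) *m G *m Tb^T).
have Sr x : cube q x -> negidx (S x) r./2.
  by move=> cx; rewrite -(Qr x cx); have [] := index_antiinvolution (QG x) (QQ x cx).
have qS x z : qf (S x) z = - qf G (z *m Tb *m Q x).
  rewrite -[qf G _]/(form _ _ _) -selfadj // /form /S /qf mulmxN mulNmx [LHS]mxE.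
  by congr (- fun_of_matrix _ _ _); rewrite trmx_mul !mulmxA.
apply: (@geo_contradiction r./2 S) => //.
(* The index [r./2] is positive because the rank [r] is even and nonzero. *)
- have m1 := cube_delta R (Ordinal (leq_ltn_trans (leq0n _) tq)).
  have [_] := index_antiinvolution (QG _) (QQ _ m1).
  by rewrite Qr //; case: (r) r0 => // -[].
- move=> x cx; apply: mctnN; do 3?[apply: mctnM; try exact: mctn_cst].
  by apply: mctnM; apply: Qc.
- by move=> x; rewrite /S QN.
- move=> x; rewrite /S linearN /=; congr (- _).
  have QT : G *m (Q x)^T = Q x *m G by rewrite -[LHS]trmxK trmx_mul trmxK GT QG.
  by rewrite !trmx_mul trmxK GT !mulmxA -(mulmxA Tb G) QT mulmxA -(mulmxA (Tb *m Q x) G) QT mulmxA.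
by move=> x z cx /orthW_le [h _]; rewrite qS oppr_ge0.
Qed.
End Family.
End Geo.

(** * Polynomials and the minimal polynomial *)

Section RealPoly.
Variable R : rcfType.

(** Take a complex root. If it is not real, the remainder of [p] modulo its real quadratic is a real
    polynomial of degree at most 1 vanishing at a nonreal point, hence 0. *)
Lemma linear_or_quadratic_factor (p : {poly R}) : size p != 1%N ->
  (exists a, root p a) \/ exists a b, b != 0 /\ ('X - a%:P) ^+ 2 + (b ^+ 2)%:P %| p.
Proof.
move=> sp; pose toC := real_complex R.
have [z pz] : exists z : R[i], root (map_poly toC p) z.
  by apply/closed_rootP; rewrite size_map_poly.
case: z pz => a b pz; have [b0|b0] := eqVneq b 0.
  left; exists a; move: pz; rewrite b0 -[(_ +i* _)%C]/(toC a) fmorph_root //.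
right; exists a, b; split=> //; set f := _ + _.
have sf : size f = 3%N.
  rewrite size_polyDl size_exp_XsubC // (leq_ltn_trans (size_polyC_leq1 _)) //.
have f0 : f != 0 by rewrite -size_poly_eq0 sf.
rewrite /dvdp -size_poly_eq0 size_poly_eq0.
set r := p %% f.
have sr : (size r <= 2)%N by rewrite -ltnS -sf ltn_modp.
have rz : (map_poly toC r).[(a +i* b)%C] = 0.
  have := pz; rewrite {1}(divp_eq p f) -/r rootE rmorphD rmorphM /= hornerD hornerM.
  have -> : (map_poly toC f).[(a +i* b)%C] = 0.
    rewrite /f rmorphD rmorphXn rmorphB /= map_polyX !map_polyC !hornerE /=.
    apply/eqP; rewrite eq_complex /= subrr mul0r sub0r subr0 -expr2 addNr eqxx /=.
    by rewrite mul0r mulr0 !addr0 eqxx.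
  by rewrite mulr0 add0r => /eqP.
move: rz; rewrite (@horner_coef_wide _ 2) ?size_map_poly // !big_ord_recl big_ord0 !coef_map /=.
move=> /eqP; rewrite eq_complex /= => /andP[/eqP h1 /eqP h2].
move: h1 h2; rewrite /bump /= !mulr0 !mul0r !mulr1 !add0r !addr0 !subr0 addn0 => h1 /eqP.
rewrite mulf_eq0 (negPf b0) orbF => /eqP r1; move: h1; rewrite r1 mul0r addr0 => r0.
apply/eqP/polyP => i; rewrite coef0; case: i => [|[|i]] //.
by rewrite nth_default // (leq_trans sr).
Qed.

Lemma split_of_roots (m : {poly R}) : m != 0 ->
  (forall d : {poly R}, d %| m -> size d != 1%N -> exists a, root d a) ->
  exists rs, m %| \prod_(x <- rs) ('X - x%:P).
Proof.
move: {2}(size m) (leqnn (size m)) => k; elim: k m => [|k IH] m sm m0 H.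
  by move: m0; rewrite -size_poly_gt0; case: (size m) sm.
have [/eqP|s1] := eqVneq (size m) 1%N.
  by rewrite -/(is_true _) => /size_poly1P[c c0 ->]; exists [::]; rewrite big_nil /= dvdp1 size_polyC c0.
have [a /factor_theorem[m' Em]] := H m (dvdpp m) s1.
have m'0 : m' != 0 by apply: contra m0 => /eqP m'0; rewrite Em m'0 mul0r.
have [|d dm|rs Hrs] := IH m' _ m'0.
- by move: sm; rewrite Em size_Mmonic ?monicXsubC // size_XsubC addn2.
- by move=> sd; apply: H => //; rewrite Em dvdp_mulr.
by exists (a :: rs); rewrite big_cons Em mulrC dvdp_mul2l // polyXsubC_eq0.
Qed.

(* A nonreal root [a + ib] gives [h = (X - a) e / b], where [e] is idempotent modulo [m]. *)
Lemma split_or_witness (m : {poly R}) : m != 0 ->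
  (exists2 rs, uniq rs & m %| \prod_(x <- rs) ('X - x%:P)) \/
  exists h, ~~ (m %| h) /\ (m %| h ^+ 2 \/ m %| h ^+ 3 + h).
Proof.
move=> m0; case: (pselect (exists h, ~~ (m %| h) /\ (m %| h ^+ 2 \/ m %| h ^+ 3 + h))); first by right.
move=> nw; left.
have H2 h : m %| h ^+ 2 -> m %| h by move=> h2; apply/negPn/negP => nh; apply: nw; exists h; auto.
have H3 h : m %| h ^+ 3 + h -> m %| h by move=> h3; apply/negPn/negP => nh; apply: nw; exists h; auto.
have [d dm sd|rs Hrs] := split_of_roots m0.
  have [//|[a [b [b0 fd]]]] := linear_or_quadratic_factor sd; exfalso.
  move: fd; set f := _ + _ => fd; have {dm} fd := dvdp_trans fd dm.
  have sf : size f = 3%N.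
    by rewrite size_polyDl size_exp_XsubC // (leq_ltn_trans (size_polyC_leq1 _)).
  have f0 : f != 0 by rewrite -size_poly_eq0 sf.
  have irf : irreducible_poly f.
    apply: cubic_irreducible; rewrite ?sf // => x; rewrite /root /f !hornerE /=.
    by rewrite paddr_eq0 ?sqr_ge0 // !sqrf_eq0 negb_and b0 orbT.
  have f1 : ~~ (f %| 1) by rewrite dvdp1 sf.
  have [k Em] := dvdpP _ _ fd.
  have k0 : k != 0 by apply: contra m0 => /eqP k0; rewrite Em k0 mul0r.
  (* If [f] divided [k], then [m = k f] would divide [k^2], hence [k] by [H2]. *)
  have cfk : coprimep f k.
    rewrite irreducible_poly_coprime //; apply/negP => fk.
    have : m %| k by apply: H2; rewrite Em expr2 dvdp_mul2l.
    by rewrite Em -{2}[k]mulr1 dvdp_mul2l // (negPf f1).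
  have [[u v] /= uv] := Bezout_eq1_coprimepP _ _ cfk.
  (* [(X - a) / b] squares to -1 modulo [f], and [e] is 1 modulo [f] and 0 modulo [k]. So
     [h^2 = - e^2] modulo [m]; were [h] divisible by [m], so would be [e], against [e = 1] modulo
     [f]. *)
  pose e := v * k; pose h := b^-1%:P * ('X - a%:P) * e.
  have e1 : m %| e * (1 - e).
    by rewrite -uv /e addrK Em [k * f]mulrC mulrC dvdp_mul // ?dvdp_mulIr // dvdp_mull.
  have he : m %| h ^+ 2 + e ^+ 2.
    have -> : h ^+ 2 + e ^+ 2 = (b^-1 ^+ 2)%:P * e * v * (k * f).
      have bb : b^-1%:P * b%:P = 1 :> {poly R} by rewrite -polyCM mulVf.
      rewrite /h /f !polyCM; rewrite -[X in _ + X]mul1r -[1](expr1n _ 2) -bb /e.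
      by rewrite !expr2; ring.
    by rewrite Em dvdp_mulIr.
  have mh : m %| h.
    apply: H3; have -> : h ^+ 3 + h = h * (h ^+ 2 + e ^+ 2) + b^-1%:P * ('X - a%:P) * (1 + e) * (e * (1 - e)).
      by rewrite /h; ring.
    by rewrite dvdp_add // dvdp_mull.
  have me : m %| e.
    by apply: H2; move: he; rewrite dvdp_addr // expr2 dvdp_mull.
  have fe : f %| e by apply: dvdp_trans me.
  by move/negP: f1; apply; rewrite -uv dvdp_add // dvdp_mulIr.
exists (undup rs); first exact: undup_uniq.
set h := \prod_(x <- undup rs) _.
(* When all roots are real, [m] divides a power of the squarefree [h]. With a power of 2 as
   exponent, [H2] extracts square roots down to [h] itself. *)
have Hh : m %| h ^+ (size rs).
  apply: dvdp_trans Hrs _.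
  have : {subset rs <= undup rs} by move=> x; rewrite mem_undup.
  elim: (rs) (undup rs) @h => [|x s IH] r h sub; first by rewrite big_nil dvd1p.
  rewrite big_cons exprS; apply: dvdp_mul; last by apply: IH => y ys; apply: sub; rewrite in_cons ys orbT.
  by rewrite /h dvdp_XsubCl root_prod_XsubC sub // mem_head.
have {}Hh : m %| h ^+ (2 ^ size rs).
  by apply: dvdp_trans Hh _; rewrite dvdp_exp2l // ltnW // ltn_expl.
elim: (size rs) Hh => [|k IH]; first by rewrite expr1.
by rewrite expnSr exprM => /H2/IH.
Qed.

Lemma diagonalizable_or_witness n (J : 'M[R]_n.+1) : ~ diagonalizable J ->
  exists h, horner_mx J h != 0 /\
    (horner_mx J h *m horner_mx J h = 0 \/
     horner_mx J h *m horner_mx J h *m horner_mx J h = - horner_mx J h).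
Proof.
move=> nd; have m0 := monic_neq0 (mxminpoly_monic J).
have [rsm|[h [nh Hh]]] := split_or_witness m0; first by case: nd; apply: (diagonalizableP J).2.
exists h; split; first by apply: contra nh; rewrite dvd_mxminpoly.
case: Hh; rewrite dvd_mxminpoly => /eqP hJ; [left|right]; move: hJ; rewrite !mulmxE.
  by rewrite rmorphXn expr2.
rewrite rmorphD rmorphXn /= => /eqP; rewrite addr_eq0 => /eqP <-.
by rewrite !exprS expr0 mulr1 mulrA.
Qed.
End RealPoly.

(** * Jacobi operators *)

Section Signature.
Variables (R : realType) (n : nat).

Lemma qf_opp (G : 'M[R]_n) u : qf (- G) u = - qf G u.
Proof. by rewrite /qf mulmxN mulNmx mxE. Qed.

(** [T] is the orthogonal complement of [W]. By maximality of [W], [neg_complement] for [- G] makes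
    [G] nonpositive there and puts isotropic vectors of [T] in the radical, which is 0. So [T] is
    timelike, which bounds its dimension by [p]. *)
Lemma signature_splitting (G : 'M[R]_n) p q : inner_product G -> has_signature G p q ->
  exists t (Wb : 'M[R]_(q, n)) (Tb : 'M[R]_(t, n)),
  [/\ (t <= p)%N, forall u, u != 0 -> 0 < qf G (u *m Wb), negdef G Tb, Tb *m G *m Wb^T = 0 &
    forall v : 'rV[R]_n, exists w z, v = w *m Wb + z *m Tb].
Proof.
move=> [GT Gu] [_ [pmax [[U [Us Ur]] qmax]]].
have NGT : (- G)^T = - G by rewrite linearN /= GT.
have [Wb Wpos] : exists Wb : 'M[R]_(q, n), forall u, u != 0 -> 0 < qf G (u *m Wb).
  rewrite -Ur; exists (row_base U) => u u0; apply: Us; last exact: row_base_neq0.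
  by rewrite -(eq_row_base U) submxMl.
have Wneg : negdef (- G) Wb by move=> u /Wpos; rewrite qf_opp oppr_lt0.
have Wmax k (F : 'M[R]_(k, n)) : negdef (- G) F -> (k <= q)%N.
  move=> Fn; have /eqP <- := negdef_free Fn; rewrite -(mxrank_gen F); apply: qmax => v.
  rewrite genmxE => /submxP[u ->] uF; have : u != 0 by apply: contra uF => /eqP->; rewrite mul0mx.
  by move=> /Fn; rewrite qf_opp oppr_lt0.
pose K := kermx (G *m Wb^T); pose Tb := row_base K.
have TK z : z *m Tb *m G *m Wb^T = 0.
  have /submxP[D ->] : (Tb <= K)%MS by rewrite eq_row_base.
  have -> : z *m (D *m K) *m G *m Wb^T = z *m D *m (K *m (G *m Wb^T)) by rewrite !mulmxA.
  by rewrite mulmx_ker mulmx0.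
have Tn : negdef G Tb.
  move=> u u0; have v0 : u *m Tb != 0 by apply: row_base_neq0.
  have [|_ h] := neg_complement (z := u *m Tb) NGT Wneg Wmax.
    by rewrite mulmxN mulNmx TK oppr0.
  move: h; rewrite qf_opp oppr_le0 ltNge => h; apply: contra v0 => /h.
  by move=> /eqP; rewrite mulmxN oppr_eq0 => /eqP v0; rewrite -[u *m Tb](mulmxK Gu) v0 mul0mx.
exists (\rank K), Wb, Tb; split=> //.
- have /eqP <- := negdef_free Tn; rewrite -(mxrank_gen Tb); apply: pmax => v.
  rewrite genmxE => /submxP[u ->] uT; apply: Tn.
  by apply: contra uT => /eqP->; rewrite mul0mx.
- by apply/row_matrixP => i; rewrite row0 rowE (mulmxA _ _ Wb^T) (mulmxA _ Tb) TK.
move=> v; have Nu := form_neg_def Wneg.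
pose w := v *m (- G) *m Wb^T *m invmx (Wb *m (- G) *m Wb^T).
have : (v - w *m Wb <= Tb)%MS.
  rewrite eq_row_base; apply/sub_kermxP; apply/eqP; rewrite -oppr_eq0 -mulmxN -[- (G *m _)]mulNmx mulmxBl.
  rewrite -(mulmxA w) (mulmxA Wb) /w -(mulmxA _ (invmx _)) mulVmx // mulmx1 mulmxA.
  by rewrite subrr.
by move=> /submxP[z Ez]; exists w, z; rewrite -Ez addrC subrK.
Qed.
End Signature.

Section Jacobi.
Variables (R : realType) (n : nat) (G : 'M[R]_n) (T : tensor4 R n).
Hypotheses (GI : inner_product G) (TC : algebraic_curvature_tensor T).

Let M (x : 'rV[R]_n) := \matrix_(i < n, j < n) teval T (delta_mx 0 i) x x (delta_mx 0 j).

Lemma jacobiG x : jacobi G T x *m G = M x.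
Proof. by rewrite /jacobi mulmxKV //; case: GI. Qed.

Lemma jacobi_selfadj x : (jacobi G T x *m G)^T = jacobi G T x *m G.
Proof.
rewrite !jacobiG; apply/matrixP => i j; rewrite !mxE; have [T1 [T2 _]] := TC.
by rewrite T1 T2 T1 T2 opprK.
Qed.

Lemma teval_sum x y z w :
  teval T x y z w = \sum_i x 0 i * teval T (delta_mx 0 i) y z w.
Proof.
rewrite /teval; apply: eq_bigr => i _; rewrite [X in _ * X](bigD1 i) //= [X in _ + X]big1 ?addr0.
  rewrite mulr_sumr; apply: eq_bigr => j _; rewrite mulr_sumr; apply: eq_bigr => k _.
  rewrite mulr_sumr; apply: eq_bigr => l _; rewrite mxE !eqxx mulr1; ring.
move=> i' ii'; rewrite big1 // => j _; rewrite big1 // => k _; rewrite big1 // => l _.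
by rewrite mxE (negPf ii') andbF mulr0 !mul0r.
Qed.

Lemma jacobi_self x : x *m jacobi G T x = 0.
Proof.
rewrite /jacobi mulmxA; have -> : x *m \matrix_(i, j) teval T (delta_mx 0 i) x x (delta_mx 0 j) = 0.
  apply/rowP => j; rewrite !mxE; have [_ [T2 _]] := TC.
  have : teval T x x x (delta_mx 0 j) = 0 by have := T2 x x x (delta_mx 0 j); lra.
  by rewrite teval_sum => E; rewrite -[RHS]E; apply: eq_bigr => i _; rewrite mxE.
by rewrite mul0mx.
Qed.

Lemma jacobiZ a x : jacobi G T (a *: x) = a ^+ 2 *: jacobi G T x.
Proof.
rewrite /jacobi scalemxAl; congr (_ *m _); apply/matrixP => i j; rewrite !mxE.
rewrite /teval !mulr_sumr; apply: eq_bigr => k1 _; rewrite mulr_sumr; apply: eq_bigr => k2 _.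
rewrite mulr_sumr; apply: eq_bigr => k3 _; rewrite mulr_sumr; apply: eq_bigr => k4 _.
by rewrite !mxE; ring.
Qed.

Lemma mctn_jacobi x : mctn x (jacobi G T).
Proof.
apply: (@mctnM R n x n n n M (fun=> invmx G)); last exact: mctn_cst.
move=> i j.
rewrite (_ : (fun z => _) = fun z : 'rV[R]_n => \sum_k1 \sum_k2 \sum_k3 \sum_k4
  T k1 k2 k3 k4 * (delta_mx 0 i : 'rV[R]_n) 0 k1 * z 0 k2 * z 0 k3 * (delta_mx 0 j : 'rV[R]_n) 0 k4); last first.
  by apply/funext => z; rewrite mxE.
have cc (a : R) : {for x, continuous (fun=> a)} by apply: cst_continuous.
have cx k : {for x, continuous (fun z : 'rV[R]_n => z 0 k)} by apply: coord_continuous.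
apply: continuous_sumr => k1; apply: continuous_sumr => k2; apply: continuous_sumr => k3.
apply: continuous_sumr => k4.
by do 3![apply: continuousM => //].
Qed.
End Jacobi.

Section HornerMx.
Variables (R : realType) (n : nat) (J G : 'M[R]_n.+1).

Lemma horner_selfadj h : G^T = G -> (J *m G)^T = J *m G ->
  (horner_mx J h *m G)^T = horner_mx J h *m G.
Proof.
move=> GT JG; elim/poly_ind: h => [|h c IH]; first by rewrite rmorph0 !mul0mx trmx0.
have JT : G *m J^T = J *m G by rewrite -JG trmx_mul GT.
rewrite rmorphD rmorphM /= horner_mx_X horner_mx_C mulmxDl linearD /=; congr (_ + _); last first.
  by rewrite mul_scalar_mx linearZ /= GT.
rewrite -mulmxE -{1}mulmxA -JT mulmxA trmx_mul trmxK IH mulmxA; congr (_ *m _).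
by apply: comm_mx_horner; apply: comm_mx_refl.
Qed.

Lemma horner_ker (x : 'rV[R]_n.+1) h : x *m J = 0 -> x *m horner_mx J h = h.[0] *: x.
Proof.
move=> xJ; elim/poly_ind: h => [|h c IH]; first by rewrite rmorph0 mulmx0 horner0 scale0r.
rewrite rmorphD rmorphM /= horner_mx_X horner_mx_C mulmxDr -mulmxE mulmxA IH -scalemxAl xJ.
by rewrite scaler0 add0r mul_mx_scalar !hornerE.
Qed.
End HornerMx.

Theorem theorem1p2 (R : realType) (n p q : nat) (G : 'M[R]_n) (T : tensor4 R n) :
  inner_product G -> has_signature G p q -> (p < q)%N ->
  algebraic_curvature_tensor T -> spacelike_jordan_osserman G T ->
  forall x : 'rV[R]_n, unit_spacelike G x -> diagonalizable (jacobi G T x).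
Proof.
case: n G T => [|n] G T GI Gs pq TC JO x0 x0u.
  (* In dimension 0 there are no unit vectors. *)
  by move: x0u; rewrite /unit_spacelike /form [x0^T]flatmx0 mulmx0 mxE => /esym/eqP; rewrite oner_eq0.
have [//|nd] := pselect (diagonalizable (jacobi G T x0)); exfalso.
have [h [Q0 Qh]] := diagonalizable_or_witness nd.
have [t [Wb [Tb [tp Wpos Tneg WT split]]]] := signature_splitting GI Gs.
have [GT Gu] := GI; have tq := leq_ltn_trans tp pq.
(* The Jacobi operator is homogeneous of degree two, so dividing by [(x, x)] gives the operator of
   the normalized vector without square roots and keeps continuity and evenness in view. *)
pose nu x := qf G (x *m Wb).
pose J x := (nu x)^-1 *: jacobi G T (x *m Wb).
pose Q x := horner_mx (J x) h.
have cube0 (x : 'rV[R]_q) : cube q x -> x != 0.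
  by case=> _ [i xi] _; apply: contra_eq_neq xi => ->; rewrite mxE normr0 eq_sym oner_eq0.
have Qsim x : x != 0 -> exists2 P, P \in unitmx & Q x = P *m horner_mx (jacobi G T x0) h *m invmx P.
  move=> xn; have nx : 0 < nu x by apply: Wpos.
  have s0 : 0 < Num.sqrt (nu x) by rewrite sqrtr_gt0.
  pose X := (Num.sqrt (nu x))^-1 *: (x *m Wb).
  have Xu : unit_spacelike G X.
    rewrite -[unit_spacelike _ _]/(qf G X = 1) qfZ exprVn sqr_sqrtr ?(ltW nx) // mulVf //.
    by rewrite gt_eqF.
  rewrite /Q; have -> : J x = jacobi G T X by rewrite /X jacobiZ exprVn sqr_sqrtr // ltW.
  have [P Pu /(similarRL Pu) ->] := JO _ _ x0u Xu.
  by exists P => //; rewrite horner_mx_uconj.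
have JN x : J (- x) = J x.
  by rewrite /J /nu mulNmx qfN -scaleN1r jacobiZ // sqrrN expr1n scale1r.
have QG x : (Q x *m G)^T = Q x *m G.
  apply: horner_selfadj => //; rewrite /J -scalemxAl linearZ /= jacobi_selfadj //.
have Qc x : cube q x -> mctn x Q.
  move=> cx; apply: mctn_horner; apply: mctnZ.
    apply: (@continuousV R _ nu); first by rewrite gt_eqF // Wpos // cube0.
    apply: (@mctn_qf R q x n.+1 (fun=> G) (fun z => z *m Wb)); first exact: mctn_cst.
    by apply: mctnM; [apply: mctn_id|apply: mctn_cst].
  apply: (@mctn_comp R q n.+1 x (fun z => z *m Wb) _ _ (jacobi G T)); last exact: mctn_jacobi.
  by apply: mctnM; [apply: mctn_id|apply: mctn_cst].
have xQ x : x *m Wb *m Q x = h.[0] *: (x *m Wb).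
  by apply: horner_ker; rewrite /J -scalemxAr jacobi_self // scaler0.
have Qr x : cube q x -> \rank (Q x) = \rank (horner_mx (jacobi G T x0) h).
  move=> /cube0/Qsim[P Pu ->]; rewrite mxrankMfree ?row_free_unit ?unitmx_inv //.
  by rewrite eqmxMfull // row_full_unit.
have r0 : (0 < \rank (horner_mx (jacobi G T x0) h))%N by rewrite lt0n mxrank_eq0.
case: Qh => Qh.
  have QQ x : cube q x -> Q x *m Q x = 0.
    by move=> /cube0/Qsim[P Pu ->]; rewrite !mulmxA mulmxKV // -(mulmxA P) Qh mulmx0 mul0mx.
  apply: (nilpotent_contradiction GT Wpos Tneg WT Gu split tq Qc _ QG _ r0 QQ Qr) => [x|x cx]; first by rewrite /Q JN.
  (* [x] is an eigenvector of [Q x] with eigenvalue [h(0)], as the Jacobi operator kills [x]; the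
     square of this eigenvalue is 0. *)
  have : x *m Wb *m (Q x *m Q x) = 0 by rewrite QQ // mulmx0.
  rewrite mulmxA xQ -scalemxAl xQ scalerA => /eqP; rewrite scaler_eq0.
  have /negPf -> : x *m Wb != 0.
    by apply/eqP => xW; have := Wpos _ (cube0 _ cx); rewrite xW qf0 ltxx.
  by rewrite orbF -expr2 sqrf_eq0 => /eqP ->; rewrite scale0r.
have QQ x : cube q x -> Q x *m Q x *m Q x = - Q x.
  move=> /cube0/Qsim[P Pu ->]; rewrite !mulmxA mulmxKV // mulmxKV // -mulNmx -mulmxN -Qh.
  by rewrite !mulmxA.
apply: (antiinvolution_contradiction GT Wpos Tneg WT Gu split tq Qc _ QG _ r0 QQ Qr) => [x|x cx]; first by rewrite /Q JN.
(* Here the eigenvalue [h(0)] is a real root of [s^3 + s], hence 0. *)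
have : x *m Wb *m (Q x *m Q x *m Q x + Q x) = 0 by rewrite QQ // addNr mulmx0.
rewrite mulmxDr !mulmxA !xQ -!scalemxAl xQ -scalemxAl xQ !scalerA -scalerDl => /eqP; rewrite scaler_eq0.
have /negPf -> : x *m Wb != 0.
  by apply/eqP => xW; have := Wpos _ (cube0 _ cx); rewrite xW qf0 ltxx.
rewrite orbF -[X in _ + X]mulr1 -mulrA -mulrDr mulf_eq0 => /orP[/eqP->|]; first by rewrite scale0r.
by rewrite gt_eqF // ltr_wpDl // -expr2 sqr_ge0.
Qed.
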